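(* Let $n\ge 2$ and let $(W,S)$ be the Coxeter system of type $\widetilde{B}_{n+1}$. The set $\mathrm{I}(\widetilde{B}_{n+1})$ of star irreducible fully commutative elements is the disjoint union $$\mathrm{I}(\widetilde{B}_{n+1})=\mathrm{CC}(\widetilde{B}_{n+1})\sqcup \mathrm{K}(\widetilde{B}_{n+1})\sqcup \mathrm{CZ}_\bullet(\widetilde{B}_{n+1}),$$ where $\mathrm{CZ}_\bullet(\widetilde{B}_{n+1})=\{w\in \mathrm{CZ}(\widetilde{B}_{n+1}) : \mathrm{D_L}(w)=\mathrm{D_R}(w)=\{s_0,s_1\}\}$, and $\mathrm{K}(\widetilde{B}_{n+1})=\emptyset$ if $n$ is odd.
   Context: Type $\widetilde{B}_{n+1}$: generators $S=\{s_0,\dots,s_{n+1}\}$, $m_{s,t}=3$ for the pairs $\{s_0,s_2\}$, $\{s_1,s_2\}$, $\{s_i,s_{i+1}\}$ ($2\le i\le n-1$), $m_{s_n,s_{n+1}}=4$; all other pairs of distinct generators commute. $\ell$ is the length. An element $w$ is fully commutative (FC) if any two reduced expressions of $w$ are related by commutation relations only. $\mathrm{D_L}(w)=\{s\in S:\ell(sw)<\ell(w)\}$, $\mathrm{D_R}(w)=\{s\in S:\ell(ws)<\ell(w)\}$, and $supp(w)$ is the set of generators occurring in a reduced expression of $w$. Star reducibility: an FC element $w$ is left (resp. right) star reducible by $s$ with respect to $t$ to $sw$ (resp. $ws$) if $s\in \mathrm{D_L}(w)$ and $t\in \mathrm{D_L}(sw)$ (resp. $s\in \mathrm{D_R}(w)$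 and $t\in \mathrm{D_R}(ws)$) with $m_{s,t}\ge 3$. An FC element is star irreducible if it is neither left nor right star reducible by any $s$ with respect to any $t$; $\mathrm{I}(\widetilde{B}_{n+1})$ is the set of these. $\mathrm{CC}(\widetilde{B}_{n+1})$ is the set of products of pairwise commuting distinct generators (including $e$). Complete zigzags: let $\mathcal{A}=s_2s_3\cdots s_ns_{n+1}$ and $\mathcal{B}=s_ns_{n-1}\cdots s_2s_1s_0$. $\mathrm{CZ}(\widetilde{B}_{n+1})$ is the set of FC elements having a reduced expression of the form $s_0s_1(\mathcal{A}\mathcal{B})^k\mathcal{A}^h$ or $s_{n+1}(\mathcal{B}\mathcal{A})^k\mathcal{B}^h$, with $k\ge 0$, $h\in\{0,1\}$, $k+h>0$. Cartier–Foata normal form (CFNF): every FC element $w$ factors uniquely as $w=u_0\cdots u_m$ with each $u_i$ completely commutative, $supp(u_0)=\mathrm{D_L}(w)$, $\ell(w)=\sum_i\ell(u_i)$, and for every $t\in supp(u_{j+1})$ there is $s\in supp(u_j)$ with $m_{s,t}\ge 3$. Candies: for $n$ even, an FC element $w$ with CFNF $w=u_0\cdots u_m$, $m\ge 2$, is a candy if $m$ is even, $supp(u_{2i})=\{s_3,s_5,\dots,s_{n+1}\}\cup\{x_i\}$ with $x_i\in\{s_0,s_1\}$ for $0\le i\le m/2$ and $x_i\ne x_{i+1}$ for consecutive indices, and $supp(u_{2i+1})=\{s_2,s_4,\dots,s_n\}$ for $0\le i<m/2$. $\mathrm{K}(\widetilde{B}_{n+1})$ is the set of candies; it is set to be $\emptyset$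 when $n$ is odd. *)

(* Defs.v *)
From mathcomp Require Import all_boot all_fingroup.
From mathcomp Require Import boolp classical_sets.
From Stdlib Require Import Relation_Operators.

Set Implicit Arguments.
Unset Strict Implicit.
Unset Printing Implicit Defensive.

Local Open Scope classical_set_scope.
Local Open Scope group_scope.

(* [M] is a Coxeter matrix all of whose entries are finite (there is no bond
   labelled infinity in the types considered here), with [M s s = 1].  The
   relators include [s s], so the generators are involutions, and the monoid
   presentation below is also the group presentation
   < T | (s t)^(M s t) = 1 for all s, t >. *)
Inductive relator_step (T : Type) (M : T -> T -> nat) : seq T -> seq T -> Prop :=
  RelatorStep (u v : seq T) (s t : T) :
    relator_step M (u ++ flatten (nseq (M s t) [:: s; t]) ++ v) (u ++ v).

Record coxeterSystem (T : finType) (M : T -> T -> nat) := CoxeterSystem {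
  cox_group :> groupType;
  gen : T -> cox_group;
  gen_generates : forall x : cox_group, exists w : seq T, \prod_(s <- w) gen s = x;
  gen_presentation : forall w w' : seq T,
    \prod_(s <- w) gen s = \prod_(s <- w') gen s
    <-> clos_refl_sym_trans (seq T) (relator_step M) w w' }.

Section Coxeter.
Variables (T : finType) (M : T -> T -> nat) (W : coxeterSystem M).
Implicit Types (x y : W) (s t : T) (w : seq T).

Definition ev w : W := \prod_(s <- w) gen W s.

Lemma ex_word_size x : exists k, `[< exists2 w, ev w = x & size w = k >].
Proof. by have [w wx] := gen_generates x; exists (size w); apply/asboolP; exists w. Qed.

Definition ell x : nat := ex_minn (ex_word_size x).

Definition reduced w x : Prop := ev w = x /\ size w = ell x.

Definition DL x : set T := [set s | (ell (gen W s * x) < ell x)%N].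
Definition DR x : set T := [set s | (ell (x * gen W s) < ell x)%N].
Definition supp x : set T := [set s | exists2 w, reduced w x & s \in w].

Inductive comm_step : seq T -> seq T -> Prop :=
  CommStep (u v : seq T) (s t : T) :
    M s t = 2 -> comm_step (u ++ [:: s; t] ++ v) (u ++ [:: t; s] ++ v).

Definition FC : set W :=
  [set x | forall w w', reduced w x -> reduced w' x ->
                        clos_refl_sym_trans (seq T) comm_step w w'].

Definition left_star_reducible x s t : Prop :=
  [/\ DL x s, DL (gen W s * x) t & (3 <= M s t)%N].
Definition right_star_reducible x s t : Prop :=
  [/\ DR x s, DR (x * gen W s) t & (3 <= M s t)%N].

Definition star_irreducible : set W :=
  [set x | FC x /\ forall s t,
    ~ left_star_reducible x s t /\ ~ right_star_reducible x s t].

Definition CC : set W :=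
  [set x | exists w, [/\ uniq w, pairwise (fun s t => M s t == 2) w & x = ev w]].

(* [u] lists the factors u_0, ..., u_m, so that [m = (size u).-1]. *)
Definition CFNF x (u : seq W) : Prop :=
  [/\ (0 < size u)%N /\ x = \prod_(y <- u) y,
      forall i, (i < size u)%N -> CC (nth 1 u i),
      supp (nth 1 u 0) = DL x,
      ell x = (\sum_(y <- u) ell y)%N
    & forall j t, (j.+1 < size u)%N -> supp (nth 1 u j.+1) t ->
        exists2 s, supp (nth 1 u j) s & (3 <= M s t)%N].

End Coxeter.

Arguments FC {T M} W.
Arguments star_irreducible {T M} W.
Arguments CC {T M} W.

Definition mB n (i j : 'I_n.+2) : nat :=
  let a := minn i j in let b := maxn i j in
  if a == b then 1%N
  else if (a == n) && (b == n.+1) then 4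
  else if [|| (a == 0) && (b == 2), (a == 1%N) && (b == 2)
            | [&& (2 <= a)%N, (a < n)%N & b == a.+1]] then 3
  else 2.

Arguments mB n i j : clear implicits.

Section TypeB.
Variables (n : nat) (W : coxeterSystem (mB n)).
Implicit Types x : W.

Definition sB (k : nat) : 'I_n.+2 := inord k.

Definition wA : seq 'I_n.+2 := [seq sB k | k <- iota 2 n].
Definition wB : seq 'I_n.+2 := [seq sB k | k <- rev (iota 0 n.+1)].

Definition zigzag1 (k : nat) (h : bool) : seq 'I_n.+2 :=
  [:: sB 0; sB 1] ++ flatten (nseq k (wA ++ wB)) ++ (if h then wA else [::]).
Definition zigzag2 (k : nat) (h : bool) : seq 'I_n.+2 :=
  [:: sB n.+1] ++ flatten (nseq k (wB ++ wA)) ++ (if h then wB else [::]).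

Definition CZ : set W :=
  [set x | FC W x /\ exists (k : nat) (h : bool),
    (0 < k + h)%N /\ (reduced (zigzag1 k h) x \/ reduced (zigzag2 k h) x)].

Definition CZdot : set W :=
  [set x | CZ x /\ DL x = [set sB 0; sB 1] /\ DR x = [set sB 0; sB 1]].

(* [u] is u_0, ..., u_m; the sets {s_3, s_5, ..., s_{n+1}} and
   {s_2, s_4, ..., s_n} are given by parity since [n] is even in [candies]. *)
Definition candy x : Prop :=
  FC W x /\ exists (m : nat) (u : seq W) (c : nat -> 'I_n.+2),
    [/\ CFNF x u /\ size u = m.+1,
        (2 <= m)%N /\ ~~ odd m,
        forall i, (i <= m./2)%N ->
          supp (nth 1 u i.*2) = [set s : 'I_n.+2 | odd s /\ (3 <= s)%N] `|` [set c i]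
          /\ (c i = sB 0 \/ c i = sB 1),
        forall i, (i < m./2)%N -> c i <> c i.+1
      & forall i, (i < m./2)%N ->
          supp (nth 1 u i.*2.+1) = [set s : 'I_n.+2 | ~~ odd s /\ (2 <= s)%N]].

Definition candies : set W := if odd n then set0 else candy.

End TypeB.

Arguments CZ {n} W.
Arguments CZdot {n} W.
Arguments candies {n} W.

(* Main.v *)
Require Import Defs.
From mathcomp Require Import all_boot all_fingroup.
From mathcomp Require Import boolp classical_sets.
From mathcomp Require Import zify.
From Stdlib Require Import Relation_Operators.

(* Proof idea.  Two reduced words of a fully commutative element differ by
   commutations, so one works with words over the labels 0, ..., n+1 modulo
   commutation of non-adjacent labels.  Full commutativity bounds from below
   the neighbours of a label i met between two consecutive occurrences of i,
   and star irreducibility says that no word of the class starts or ends with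
   two adjacent letters.

   If after some occurrence of i, and before the next one, only neighbours on
   one side of i are met, the same happens later at the neighbouring label, and
   so on; the chain of such turns stops only at a last 2 followed by both 0 and
   1 and by no 3.  A word (or its mirror image) with such an end is forced
   letter by letter to be a zigzag 0 1 (2 3 ... n+1 n ... 2 1 0)^k.
   Otherwise, between any two occurrences of i in 2..n both sides of i occur;
   unless no two adjacent labels occur at all, every label in 2..n+1 occurs,
   labels of the parity of n+1 come first and last, n must be even, and the word
   splits into alternating layers, which is a candy.

   That a product of distinct commuting generators has no shorter expression is
   seen on an action of W obtained by reducing the affine reflection
   representation modulo 2. *)

Set Implicit Arguments.
Unset Strict Implicit.
Unset Printing Implicit Defensive.

(** Why a turn propagates: between consecutive occurrences of a label in 2, ..., n-1 at least two
    neighbours are met, so a gap that misses one side contains neighbours of the other side twice,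
    and away from the fork the stretch between these two is again a turn. If the label does not
    recur, the word would end with two adjacent letters unless the neighbouring label is itself
    followed by a turn. The two ends of the diagram act as mirrors. The bond of order 4 lets
    [n, n+1, n] pass but not [n, n+1, n, n+1], so a turn above [n] comes back as a turn below [n].
    At 2 the leaves 0 and 1 occur once each and neither recurs in the following gap, so a turn below
    2 comes back as a turn above 2. Each turn starts further right, hence the chain stops, and only
    the fork can stop it.

    Lengths are bounded from below for products of commuting generators; zigzag and candy words
    inherit their reducedness from the element that they represent. *)

Ltac cats := repeat progress (rewrite -?catA /=); rewrite ?cats0 //.
Ltac mems := rewrite ?(mem_cat, in_cons, mem_rcons, mem_rev, in_nil, has_cat, has_rcons, negb_or) /=.

(** * Words up to commutation *)

Section Prefix.
Variable T : eqType.
Implicit Types (s t : T) (a b v : seq T).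

(** The default case matters: if [s] does not occur, [pre s v] is all of [v] and [post s v] is
    empty, so [pre i h] is the stretch up to the next [i] or, failing that, up to the end of the
    word. *)
Definition pre s v := take (index s v) v.
Definition post s v := drop (index s v).+1 v.

Lemma pre_notin s v : s \notin pre s v.
Proof.
rewrite /pre; case sv: (s \in v); first by rewrite in_take // ltnn.
by rewrite memNindex ?sv // take_size sv.
Qed.

Lemma pre_split s v : s \in v -> v = pre s v ++ s :: post s v.
Proof.
move=> sv; rewrite -{1}(cat_take_drop (index s v) v) (drop_nth s) ?index_mem //.
by rewrite nth_index.
Qed.

Lemma pre_id s v : s \notin v -> pre s v = v.
Proof. by move=> sv; rewrite /pre memNindex // take_size. Qed.

Lemma pre_sub s v t : t \in pre s v -> t \in v.
Proof. exact: mem_take. Qed.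

Lemma pre_cat s a v : s \notin a -> pre s (a ++ v) = a ++ pre s v.
Proof. by move=> sa; rewrite /pre index_cat (negPf sa) take_cat ltnNge leq_addr addKn. Qed.

Lemma pre_cons s t v : s != t -> pre s (t :: v) = t :: pre s v.
Proof. by move=> st; rewrite -cat1s pre_cat // inE. Qed.

Lemma pre_head s a v : s \notin a -> pre s (a ++ s :: v) = a.
Proof. by move=> sa; rewrite pre_cat // /pre /= eqxx take0 cats0. Qed.

Lemma pre_asym s t v : s \in pre t v -> t \notin pre s v.
Proof.
move=> sp; have sv := pre_sub sp; apply/negP => tp; have tv := pre_sub tp.
move: sp tp; rewrite /pre !in_take // => st ts.
by have := ltn_trans st ts; rewrite ltnn.
Qed.

Lemma last_split s v : s \in v -> exists a b, v = a ++ s :: b /\ s \notin b.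
Proof.
rewrite -mem_rev => sv; exists (rev (post s (rev v))), (rev (pre s (rev v))).
rewrite mem_rev pre_notin -[X in X = _]revK {1}(pre_split sv) rev_cat rev_cons.
by rewrite cat_rcons.
Qed.

Lemma last_splitP (P : pred T) v : has P v ->
  exists a s b, [/\ v = a ++ s :: b, P s & ~~ has P b].
Proof.
elim/last_ind: v => // v x IH; rewrite has_rcons.
have [Px _|Px /= /IH [a [s [b [-> Ps Pb]]]]] := boolP (P x).
  by exists v, x, [::]; rewrite cats1.
by exists a, s, (rcons b x); rewrite has_rcons (negPf Px) -rcons_cons rcons_cat.
Qed.

Lemma first_splitP (P : pred T) v : has P v ->
  exists a s b, [/\ v = a ++ s :: b, P s & ~~ has P a].
Proof.
elim: v => // x v IH /=.
have [Px _|Px /= /IH [a [s [b [-> Ps Pb]]]]] := boolP (P x); first by exists [::], x, v.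
by exists (x :: a), s, b; rewrite /= (negPf Px).
Qed.

End Prefix.

(** The Coxeter graph without its upper end: 0 and 1 are leaves at 2, followed by the chain 2, 3, 4,
    .... Commutation thus does not mention [n]; the bound on labels enters through [irr_le]. *)
Definition adj1 s t := ((s <= 1) && (t == 2)) || ((2 <= s) && (t == s.+1)).
Definition adj s t := adj1 s t || adj1 t s.
Definition dep s t := (s == t) || adj s t.
(** A predicate rather than a predecessor, because 2 has two lower neighbours, 0 and 1. *)
Definition low i j := adj i j && (j < i).

Lemma adjC s t : adj s t = adj t s. Proof. by rewrite /adj orbC. Qed.
Lemma depC s t : dep s t = dep t s. Proof. by rewrite /dep eq_sym adjC. Qed.

(** A chain of single swaps read from the left word, so that every induction treats one swap;
    transitivity and symmetry are derived. *)
Inductive ceq : seq nat -> seq nat -> Prop :=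
| ceq_refl w : ceq w w
| ceq_swap u s t v w :
    ~~ dep s t -> ceq (u ++ t :: s :: v) w -> ceq (u ++ s :: t :: v) w.

Lemma ceq_trans w2 w1 w3 : ceq w1 w2 -> ceq w2 w3 -> ceq w1 w3.
Proof.
move=> e; elim: e w3 => // u s t v w st _ IH w3 /IH; exact: ceq_swap.
Qed.

Lemma ceq_sym w1 w2 : ceq w1 w2 -> ceq w2 w1.
Proof.
elim=> [w|u s t v w st _ IH]; first exact: ceq_refl.
by apply: ceq_trans IH _; apply: ceq_swap (ceq_refl _); rewrite depC.
Qed.

Lemma ceq_catl u v w : ceq v w -> ceq (u ++ v) (u ++ w).
Proof.
elim=> [z|a s t b z st _ IH]; first exact: ceq_refl.
by rewrite catA; apply: ceq_swap => //; rewrite -catA.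
Qed.

Lemma ceq_catr u v w : ceq v w -> ceq (v ++ u) (w ++ u).
Proof.
elim=> [z|a s t b z st _ IH]; first exact: ceq_refl.
by rewrite -catA /=; apply: ceq_swap => //; rewrite -catA in IH.
Qed.

Lemma ceq_cons s v w : ceq v w -> ceq (s :: v) (s :: w).
Proof. exact: (@ceq_catl [:: s]). Qed.

Lemma ceq_rev v w : ceq v w -> ceq (rev v) (rev w).
Proof.
elim=> [z|a s t b z st _ IH]; first exact: ceq_refl.
move: IH; rewrite !rev_cat !rev_cons !cat_rcons; apply: ceq_swap.
by rewrite depC.
Qed.

Lemma ceq_perm v w : ceq v w -> perm_eq v w.
Proof.
elim=> [z|a s t b z st _]; first exact: perm_refl.
by apply: perm_trans; rewrite perm_cat2l; apply/seq.permP => p /=; rewrite addnCA.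
Qed.

Lemma ceq_mem v w : ceq v w -> v =i w.
Proof. by move/ceq_perm/perm_mem. Qed.

(** Dependent letters never pass each other, so the subword on a dependent pair is an invariant of
    the commutation class (the easy half of the projection criterion for trace monoids). *)
Lemma ceq_filter s t v w : dep s t -> ceq v w ->
  filter (pred2 s t) v = filter (pred2 s t) w.
Proof.
move=> st; elim=> [z|a x y b z xy _ <-] //; rewrite !filter_cat /=; congr (_ ++ _).
case: ifP => // xst; case: ifP => // yst; move: xst yst xy.
by case/orP=> /eqP->; case/orP=> /eqP->; rewrite // ?(depC t) ?st // /dep eqxx.
Qed.

Lemma ceq_move s a b : ~~ has (dep s) a -> ceq (a ++ s :: b) (s :: a ++ b).
Proof.
elim: a b => [|x a IH] b /=; first by move=> _; apply: ceq_refl.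
rewrite negb_or => /andP[sx sa]; apply: ceq_trans (ceq_cons x (IH b sa)) _.
by apply: (@ceq_swap [::] x s) (ceq_refl _); rewrite depC.
Qed.

Lemma ceq_front s v : s \in v -> ~~ has (dep s) (pre s v) ->
  ceq v (s :: pre s v ++ post s v).
Proof. by move=> sv sp; rewrite {1}(pre_split sv); apply: ceq_move. Qed.

(** If some [y] dependent on [s] preceded the first [s] of [v], the subwords on [s] and [y] of the
    two sides would begin with different letters. *)
Lemma front_inv s v w : ceq (s :: w) v -> s \in v /\ ~~ has (dep s) (pre s v).
Proof.
move=> e; have sv : s \in v by rewrite -(ceq_mem e) mem_head.
split=> //; apply/hasPn => y yp; apply/negP => sy.
have := ceq_filter sy e; rewrite {1}(pre_split sv) filter_cat /= !eqxx /=.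
have : y \in filter (pred2 s y) (pre s v) by rewrite mem_filter /= eqxx orbT.
have : s \notin filter (pred2 s y) (pre s v).
  by rewrite mem_filter (negPf (pre_notin _ _)) andbF.
by case: filter => //= x z; rewrite inE negb_or => /andP[/eqP sx _] _ [/sx].
Qed.

Lemma adj_succ i : 2 <= i -> adj i i.+1.
Proof. by rewrite /adj /adj1; lia. Qed.

Lemma adj_2 c : c <= 1 -> adj 2 c.
Proof. by rewrite /adj /adj1; lia. Qed.

Lemma cnt_gt0 (x : nat) (g : seq nat) : (0 < count_mem x g) = (x \in g).
Proof. by rewrite -has_count has_pred1. Qed.

Lemma cnt0 (x : nat) (g : seq nat) : x \notin g -> count_mem x g = 0.
Proof. by move/count_memPn. Qed.

Lemma cnt_cons (p : pred nat) (a : seq nat) (x : nat) (b : seq nat) :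
  count p (a ++ x :: b) = count p a + p x + count p b.
Proof. by rewrite count_cat /= addnA. Qed.

Lemma count_adj i g : 2 <= i -> count (adj i) g = count (low i) g + count_mem i.+1 g.
Proof.
move=> hi; rewrite -(@count_predUI _ (low i) (pred1 i.+1)).
rewrite (@eq_count _ (predI _ _) pred0) ?count_pred0 ?addn0.
  by apply: eq_count => x; rewrite /= /low /adj /adj1; lia.
by move=> x; rewrite /= /low /adj /adj1; lia.
Qed.

Lemma count_low3 i g : 2 <= i -> count (low i.+1) g = count_mem i g.
Proof. by move=> hi; apply: eq_count => x; rewrite /= /low /adj /adj1; lia. Qed.

Lemma count_low2 g : count (low 2) g = count_mem 0 g + count_mem 1 g.
Proof.
rewrite -count_predUI (@eq_count _ (predI _ _) pred0) ?count_pred0 ?addn0.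
  by apply: eq_count => x; rewrite /= /low /adj /adj1; lia.
by move=> x /=; lia.
Qed.

Lemma low_ge3 i g : 2 <= i -> has (low i.+1) g = (i \in g).
Proof.
move=> hi; rewrite -has_pred1; apply: eq_has => x.
by rewrite /= /low /adj /adj1; lia.
Qed.

Lemma low_2 g : has (low 2) g = (0 \in g) || (1 \in g).
Proof.
rewrite -!has_pred1 -has_predU; apply: eq_has => x.
by rewrite /= /low /adj /adj1; lia.
Qed.

Lemma indep_mid i g : 2 <= i -> i \notin g -> i.+1 \notin g -> ~~ has (low i) g ->
  ~~ has (dep i) g.
Proof.
move=> hi h1 h2 /hasPn h3; apply/hasPn => x xg; apply/negP => h.
have := h3 x xg; rewrite /low; have [?|?|E] := ltngtP x i.
- by move: h; rewrite /dep; lia.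
- have E : x = i.+1 by move: h; rewrite /dep /adj /adj1; lia.
  by rewrite -E xg in h2.
- by rewrite -E xg in h1.
Qed.

Lemma indep_01 i g : i <= 1 -> i \notin g -> 2 \notin g -> ~~ has (dep i) g.
Proof.
move=> hi h1 h2; apply/hasPn => x xg; apply/negP; rewrite /dep /adj /adj1 => h.
have [E|E] : x = i \/ x = 2 by lia.
  by rewrite -E xg in h1.
by rewrite -E xg in h2.
Qed.

(** * Irreducible words and the gaps between equal letters *)

Section Irreducible.
Variable n : nat.
Implicit Types w a b c g h : seq nat.
Hypothesis hn : 2 <= n.

Definition spec s t := ((s == n) && (t == n.+1)) || ((s == n.+1) && (t == n)).

(* The properties of the commutation class of a reduced word of a star
   irreducible FC element that the combinatorial part relies on. *)
Record irr (w : seq nat) : Prop := Irr {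
  irr_le : {in w, forall s, s <= n.+1};
  irr_sq : forall a s b, ~ ceq w (a ++ s :: s :: b);
  irr_br3 : forall a s t b, adj s t -> ~~ spec s t -> ~ ceq w (a ++ s :: t :: s :: b);
  irr_br4 : forall a s t b, spec s t -> ~ ceq w (a ++ s :: t :: s :: t :: b);
  irr_l : forall s t b, adj s t -> ~ ceq w (s :: t :: b);
  irr_r : forall a s t, adj s t -> ~ ceq w (a ++ [:: s; t]) }.

Lemma irr_ceq w w' : ceq w w' -> irr w -> irr w'.
Proof.
move=> e [h1 h2 h3 h4 h5 h6]; split.
- by move=> s; rewrite -(ceq_mem e); apply: h1.
- by move=> a s b /(ceq_trans e)/h2.
- by move=> a s t b st nst /(ceq_trans e)/(h3 _ _ _ _ st nst).
- by move=> a s t b st /(ceq_trans e)/(h4 _ _ _ _ st).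
- by move=> s t b st /(ceq_trans e)/(h5 _ _ _ st).
- by move=> a s t st /(ceq_trans e)/(h6 _ _ _ st).
Qed.

Lemma specC s t : spec s t = spec t s.
Proof. by rewrite /spec orbC ![(t == _) && _]andbC. Qed.

Lemma irr_rev w : irr w -> irr (rev w).
Proof.
have rc w1 w2 : ceq (rev w1) w2 -> ceq w1 (rev w2) by move/ceq_rev; rewrite revK.
move=> [h1 h2 h3 h4 h5 h6]; split.
- by move=> s; rewrite mem_rev; apply: h1.
- by move=> a s b /rc; rewrite rev_cat !rev_cons !cat_rcons => /h2.
- move=> a s t b st nst /rc; rewrite rev_cat !rev_cons !cat_rcons.
  exact: h3.
- move=> a s t b st /rc; rewrite rev_cat !rev_cons !cat_rcons.
  by apply: h4; rewrite specC.
- move=> s t b st /rc; rewrite !rev_cons -!cats1 -catA.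
  by apply: h6; rewrite adjC.
- move=> a s t st /rc; rewrite rev_cat.
  by apply: h5; rewrite adjC.
Qed.

(** Otherwise the second [i] slides back to the first and a square appears. *)
Lemma gap1 w a i g c : irr w -> w = a ++ i :: g ++ i :: c -> has (dep i) g.
Proof.
move=> iw E; apply/negPn/negP => ig; apply: (@irr_sq _ iw a i (g ++ c)).
by rewrite E; apply/ceq_catl/ceq_cons/ceq_move.
Qed.

Lemma gap1' w a i g c : irr w -> w = a ++ i :: g ++ i :: c -> i \notin g -> has (adj i) g.
Proof.
move=> iw E ig; have /hasP[x xg /orP[/eqP ix|ax]] := gap1 iw E; last by apply/hasP; exists x.
by rewrite ix xg in ig.
Qed.

(** Both copies of [i] slide next to [j] and form [i j i], which only the bond of order 4
    tolerates. *)
Lemma gap3 w a i g1 j g2 c : irr w -> w = a ++ i :: g1 ++ j :: g2 ++ i :: c ->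
  adj i j -> ~~ has (dep i) g1 -> ~~ has (dep i) g2 -> spec i j.
Proof.
move=> iw E ij h1 h2; apply/negPn/negP => nij.
apply: (@irr_br3 _ iw (a ++ g1) i j (g2 ++ c)) => //.
rewrite E -catA; apply: ceq_catl; apply: ceq_trans (ceq_sym (ceq_move _ h1)) _.
by apply/ceq_catl/ceq_cons/ceq_cons/ceq_move.
Qed.

(** The four letters slide together into [s t s t]. Both orders of the pair [n], [n+1] are used
    later. *)
Lemma gap4 w a s g1 t g2 g3 c : irr w ->
  w = a ++ s :: g1 ++ t :: g2 ++ s :: g3 ++ t :: c -> spec s t ->
  ~~ has (dep s) g1 -> ~~ has (dep s) g2 -> ~~ has (dep t) g2 -> ~~ has (dep t) g3 -> False.
Proof.
move=> iw E st h1 h2 h2' h3.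
apply: (@irr_br4 _ iw (a ++ g1 ++ g2) s t (g3 ++ c)) => //.
rewrite E -!catA; apply: ceq_catl; apply: ceq_trans (ceq_sym (ceq_move _ h1)) _.
apply: ceq_catl.
apply: (@ceq_trans (s :: (g2 ++ (t :: s :: t :: g3 ++ c)))).
  apply: ceq_cons; apply: ceq_trans (ceq_sym (ceq_move _ h2')) _.
  by do 3!apply: ceq_catl || apply: ceq_cons; apply: ceq_move.
by apply: ceq_sym (ceq_move _ h2).
Qed.

Lemma left_red w a s b t c : irr w -> w = a ++ s :: b ++ t :: c -> adj s t ->
  ~~ has (dep s) a -> ~~ has (dep t) (a ++ b) -> False.
Proof.
move=> iw E st h1; rewrite has_cat negb_or => /andP[h2 h3].
apply: (@irr_l _ iw s t (a ++ b ++ c)) => //; rewrite E.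
apply: ceq_trans (ceq_move _ h1) _; apply: ceq_cons.
apply: ceq_trans (ceq_catl _ (ceq_move _ h3)) _; exact: ceq_move.
Qed.

Lemma right_red w a s b t c : irr w -> w = a ++ s :: b ++ t :: c -> adj s t ->
  ~~ has (dep t) c -> ~~ has (dep s) (b ++ c) -> False.
Proof.
move=> /irr_rev iw E st h1 h2.
apply: (@left_red _ (rev c) t (rev b) s (rev a) iw).
- by rewrite E !(rev_cat, rev_cons) -!cats1; cats.
- by rewrite adjC.
- by rewrite has_rev.
- by rewrite -rev_cat has_rev.
Qed.

(** A single neighbour in the gap would fall under [gap3]. The last hypothesis excludes the
    tolerated cases: [i = n] separated by [n+1], and [i = n+1] separated by [n]. *)
Lemma gap2 w a i g c : irr w -> w = a ++ i :: g ++ i :: c -> i \notin g ->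
  (i < n) || ((i == n) && (n.+1 \notin g)) -> 1 < count (adj i) g.
Proof.
move=> iw E ig hi; rewrite ltnNge; apply/negP => hc.
have /first_splitP[g1 [j [g2 [Eg ij h1]]]] := gap1' iw E ig.
move: hc; rewrite Eg count_cat /= ij.
move: h1; rewrite has_count -leqNgt leqn0 => /eqP h1.
rewrite h1 add0n -[1]addn0 leq_add2l leqn0 => /eqP h2.
have dd h : {subset h <= g} -> count (adj i) h = 0 -> ~~ has (dep i) h.
  move=> hg h0; apply/hasPn => x xh; apply/negP => /orP[/eqP ix|ax].
    by rewrite ix (hg _ xh) in ig.
  by have := has_count (adj i) h; rewrite h0 ltnn => /hasP; apply; exists x.
have := @gap3 _ a i g1 j g2 c iw; rewrite E Eg -!catA /= => /(_ erefl ij).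
have sg1 : {subset g1 <= g} by move=> x xg; rewrite Eg mem_cat xg.
have sg2 : {subset g2 <= g} by move=> x xg; rewrite Eg mem_cat inE xg !orbT.
move/(_ (dd _ sg1 h1) (dd _ sg2 h2)); rewrite /spec; case/orP=> /andP[/eqP ei /eqP ej].
  by move: hi; rewrite ei ltnn eqxx /= Eg ej mem_cat mem_head orbT.
by move: hi; rewrite ei; lia.
Qed.

(** At most one of the two neighbours demanded by [gap2] comes from below. For [i = n], assuming
    [n+1] absent is just what makes [gap2] applicable. *)
Lemma gapL w a i g c : irr w -> w = a ++ i :: g ++ i :: c -> i \notin g ->
  2 <= i <= n -> count (low i) g <= 1 -> i.+1 \in g.
Proof.
move=> iw E ig /andP[hi hi'] h; apply/negPn/negP => h'.
have := gap2 iw E ig; rewrite count_adj // (count_memPn h').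
have [hin|hin] : i < n \/ i = n by lia.
  by rewrite hin => /(_ isT); lia.
by rewrite -hin h' eqxx orbT => /(_ isT); lia.
Qed.

(** Restricted to [i < n], because one [n+1] is enough to separate two copies of [n]. *)
Lemma gapU w a i g c : irr w -> w = a ++ i :: g ++ i :: c -> i \notin g ->
  2 <= i < n -> count_mem i.+1 g <= 1 -> has (low i) g.
Proof.
move=> iw E ig /andP[hi hi'] h; rewrite has_count.
by have := gap2 iw E ig; rewrite count_adj // hi'; lia.
Qed.

Lemma gapLU w a i g c : irr w -> w = a ++ i :: g ++ i :: c -> i \notin g ->
  2 <= i -> (i.+1 \in g) || has (low i) g.
Proof.
move=> iw E ig hi; have := gap1' iw E ig.
by rewrite has_count count_adj // addn_gt0 -!has_count has_pred1 orbC.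
Qed.

Lemma gap01 w a i g c : irr w -> w = a ++ i :: g ++ i :: c -> i \notin g ->
  i <= 1 -> 1 < count_mem 2 g.
Proof.
move=> iw E ig hi; have := gap2 iw E ig; rewrite (leq_ltn_trans hi) // => /(_ isT).
by rewrite (@eq_count _ _ (pred1 2)) // => x; rewrite /= /adj /adj1; lia.
Qed.

Lemma gapN w a g c : irr w -> w = a ++ n.+1 :: g ++ n.+1 :: c -> n.+1 \notin g -> n \in g.
Proof.
move=> iw E ig; have /hasP[x xg] := gap1' iw E ig.
have : x \in w by rewrite E; mems; rewrite xg !orbT.
move/(irr_le iw) => xn; rewrite /adj /adj1 => h.
have -> // : n = x by move: h xn; lia.
Qed.

Lemma indep_N g : {in g, forall x, x <= n.+1} -> n \notin g -> n.+1 \notin g ->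
  ~~ has (dep n.+1) g.
Proof.
move=> hg h1 h2; apply/hasPn => x xg; apply/negP; rewrite /dep /adj /adj1 => h.
have [E|E] : x = n.+1 \/ x = n by have := hg x xg; lia.
  by rewrite -E xg in h2.
by rewrite -E xg in h1.
Qed.

End Irreducible.

(** * Turns *)

Section Turn.
Variable n : nat.
Hypothesis hn : 2 <= n.
Implicit Types w a b g h : seq nat.
Local Notation irr := (irr n).
Local Notation N := n.+1.

Lemma once01 w a g b c : irr w -> w = a ++ g ++ b -> 2 \notin g -> c <= 1 ->
  count_mem c g <= 1.
Proof.
move=> iw E g2 hc; rewrite leqNgt; apply/negP => h.
have cg : c \in g by rewrite -cnt_gt0 (leq_trans _ h).
have cp : c \in post c g.
  move: h; rewrite {1}(pre_split cg) cnt_cons -cnt_gt0 /= eqxx.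
  by rewrite (cnt0 (pre_notin _ _)).
have := @gap01 n hn w (a ++ pre c g) c (pre c (post c g)) (post c (post c g) ++ b) iw.
rewrite {1}E {1}(pre_split cg) {1}(pre_split cp) => /(_ _ (pre_notin _ _) hc).
rewrite (@cnt0 2) ?ltn0; first by move=> H; apply: notF; apply: H; cats.
by apply: contra g2 => /pre_sub h2; rewrite (pre_split cg) mem_cat inE h2 !orbT.
Qed.

(** The last [c] of [g] and the first [c] of [g'] would be separated by a single 2, against
    [gap01]. *)
Lemma alt01 w a g g' b c : irr w -> w = a ++ g ++ 2 :: g' ++ b ->
  2 \notin g -> 2 \notin g' -> c <= 1 -> c \in g -> c \in g' -> False.
Proof.
move=> iw E h2 h2' hc /last_split[p [q [Eg cq]]] cg'.
have := @gap01 n hn w (a ++ p) c (q ++ 2 :: pre c g') (post c g' ++ b) iw.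
rewrite E Eg {1}(pre_split cg') => H.
have : 1 < count_mem 2 (q ++ 2 :: pre c g').
  by apply: H => //; [cats | mems; rewrite cq pre_notin; lia].
rewrite cnt_cons !(@cnt0 2) //.
  by apply: contra h2' => /pre_sub.
by apply: contra h2; rewrite Eg => h; mems; rewrite h !orbT.
Qed.

(* The mirror image of the way a zigzag starts. *)
Definition fork_end w := exists a h, w = a ++ 2 :: h /\
  [/\ 2 \notin h, 3 \notin h, 0 \in h & 1 \in h].

Lemma size_lt h g (x : nat) r k : h = g ++ x :: r -> size h <= k -> size r < k.
Proof. by move=> ->; rewrite size_cat /= addnS => /(leq_trans _); apply; rewrite ltnS leq_addl. Qed.

(** Induction hypothesis shared by the four cases that follow, on the length of what comes after
    [i]. The first clause treats a turn below [i], the second a turn above [i]. *)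
Definition down w k := forall a i h, w = a ++ i :: h -> 2 <= i <= n -> size h < k ->
  (i.+1 \notin pre i h -> has (low i) (pre i h) -> fork_end w) /\
  (~~ has (low i) (pre i h) -> i.+1 \in pre i h -> fork_end w).

(** The turn passes from [i+1] to [i]. If [i] recurs within the gap, the stretch between its first
    two copies is a turn below [i]. If not, a next [i+1] would require an [i+2] in between, so the
    gap runs to the end of the word, which then ends with [i+1, i] up to commutation unless
    something lower follows [i]. *)
Lemma down_low w k : irr w -> down w k -> forall a i h, w = a ++ i.+1 :: h -> 2 <= i < n ->
  size h <= k -> i.+2 \notin pre i.+1 h -> has (low i.+1) (pre i.+1 h) -> fork_end w.
Proof.
move=> iw IH a i h E /andP[hi hin] sh up; rewrite low_ge3 // => ig.
set g := pre i.+1 h in up ig *.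
have ng : i.+1 \notin g by apply: pre_notin.
have [r Er] : exists r, h = g ++ r by exists (drop (index i.+1 h) h); rewrite cat_take_drop.
have Eg := pre_split ig; set g2 := pre i g in Eg; set g1 := post i g in Eg.
have E' : w = (a ++ i.+1 :: g2) ++ i :: (g1 ++ r) by rewrite E Er Eg; cats.
have [IH1 _] := IH _ _ _ E' ltac:(lia) (size_lt (etrans Er (etrans (congr1 (cat^~ r) Eg) (esym (catA _ _ _)))) sh).
have subg x : x \in g1 -> x \in g by rewrite Eg; mems => ->; rewrite !orbT.
have subg2 x : x \in g2 -> x \in g by rewrite Eg; mems => ->.
have ng1 : i.+1 \notin g1 by apply: contra ng => /subg.
have ng2 : i.+1 \notin g2 by apply: contra ng => /subg2.
have [ig1|ig1] := boolP (i \in g1).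
  have Eg1 := pre_split ig1.
  have Ep : pre i (g1 ++ r) = pre i g1.
    by rewrite {1}Eg1 -catA /= pre_head // pre_notin.
  have nn : i.+1 \notin pre i g1 by apply: contra ng1 => /pre_sub.
  apply: IH1; rewrite Ep // .
  have := @gapLU n w (a ++ i.+1 :: g2) i (pre i g1) (post i g1 ++ r) iw.
  rewrite (negPf nn) /=; apply => //; last exact: pre_notin.
  by rewrite E' {1}Eg1; cats.
have [ih|ih] := boolP (i.+1 \in h).
  exfalso; move/negP: up; apply.
  apply: (@gapL n hn w a i.+1 g (post i.+1 h) iw) => //; first by rewrite E {1}(pre_split ih).
    by rewrite (leqW hi).
  by rewrite count_low3 // Eg cnt_cons /= eqxx (cnt0 (pre_notin _ _)) (cnt0 ig1).
have Eh : g = h by apply: pre_id.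
have r0 : r = [::].
  by move/eqP: Er; rewrite -Eh -{1}[g]cats0 eqseq_cat // eqxx => /eqP.
rewrite r0 cats0 in E' IH1.
have [lg|lg] := boolP (has (low i) g1).
  by apply: IH1; rewrite pre_id.
exfalso; apply: (@right_red n w a i.+1 g2 i g1 iw).
- by rewrite E -Eh Eg.
- by rewrite adjC adj_succ.
- by apply: indep_mid.
- rewrite has_cat negb_or; apply/andP; split; apply: indep_mid => //; rewrite ?low_ge3 ?pre_notin //.
  + exact: leqW.
  + by apply: contra up => /subg2.
  + exact: leqW.
  + by apply: contra up => /subg.
Qed.

(** At 2 the chain turns back or stops. If another 2 follows, the gap contains both leaves, neither
    recurs in the next gap by [alt01], and a turn on the side of 3 begins there. If none follows,
    both leaves must be present, which is [fork_end]. *)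
Lemma down_low2 w k : irr w -> down w k -> forall a h, w = a ++ 2 :: h ->
  size h <= k -> 3 \notin pre 2 h -> has (low 2) (pre 2 h) -> fork_end w.
Proof.
move=> iw IH a h E sh up lg.
set g := pre 2 h in up lg *; have ng : 2 \notin g by apply: pre_notin.
have [h2|h2] := boolP (2 \in h).
  have Eh := pre_split h2; rewrite -/g in Eh; set h' := post 2 h in Eh.
  have E' : w = (a ++ 2 :: g) ++ 2 :: h' by rewrite E Eh; cats.
  have cnt : 1 < count (low 2) g.
    rewrite ltnNge; apply: contra up => cl.
    by apply: (@gapL n hn w a 2 g h' iw) => //; rewrite ?E'; cats.
  have Elow := count_low2 g.
  have o1 := @once01 w (a ++ [:: 2]) g (2 :: h') _ iw _ ng.
  have Eo : w = (a ++ [:: 2]) ++ g ++ 2 :: h' by rewrite E'; cats.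
  have := o1 0 Eo isT; have := o1 1 Eo isT => o11 o10.
  have g0 : 0 \in g by rewrite -cnt_gt0; lia.
  have g1 : 1 \in g by rewrite -cnt_gt0; lia.
  have [_ IH2] := IH _ _ _ E' ltac:(lia) (size_lt Eh sh).
  have [r Er] : exists r, h' = pre 2 h' ++ r.
    by exists (drop (index 2 h') h'); rewrite cat_take_drop.
  have nl c : c <= 1 -> c \in g -> c \notin pre 2 h'.
    move=> hc cg; apply/negP => ch.
    apply: (@alt01 w (a ++ [:: 2]) g (pre 2 h') r c iw) => //; last exact: pre_notin.
    by rewrite -Er.
  have nl' : ~~ has (low 2) (pre 2 h') by rewrite low_2 negb_or !nl.
  apply: IH2 => //.
  have [h'2|h'2] := boolP (2 \in h').
    have := @gapLU n w (a ++ 2 :: g) 2 (pre 2 h') (post 2 h') iw.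
    rewrite (negPf nl') orbF; apply => //; last exact: pre_notin.
    by rewrite E' {1}(pre_split h'2).
  apply/negPn/negP => h'3; rewrite pre_id // in nl' h'3.
  (* Nothing dependent on this last 2 is left behind it, so the last 0 and the 2 can be carried to
     the end of the word. *)
  have [p [q [Epq q0]]] := last_split g0.
  have sq x : x \in q -> x \in g by rewrite Epq; mems => ->; rewrite !orbT.
  apply: (@right_red n w (a ++ 2 :: p) 0 q 2 h' iw) => //.
  - by rewrite E' Epq; cats.
  - exact: indep_mid.
  - rewrite has_cat negb_or; apply/andP; split; apply: indep_01 => //.
      by apply: contra ng => /sq.
    by move: nl'; rewrite low_2 negb_or => /andP[].
have Eh : g = h by apply: pre_id.
rewrite Eh in ng up lg.
have o c : c <= 1 -> count_mem c h <= 1.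
  by move=> hc; apply: (@once01 w (a ++ [:: 2]) h [::]) => //; rewrite E; cats.
(* A leaf [c] without the other leaf [d] could be carried to the end together with the 2. *)
have key c d : c <= 1 -> d <= 1 -> c != d -> c \in h -> d \notin h -> False.
  move=> hc hd cd ch dh; have Ec := pre_split ch; have oc := o c hc.
  have c2 : c \notin post c h.
    move: oc; rewrite {1}Ec cnt_cons /= eqxx addn1 -cnt_gt0.
    by case: (count_mem c (post c h)) => // m; rewrite addnS.
  have sp x : x \in pre c h -> x \in h by apply: pre_sub.
  have sq x : x \in post c h -> x \in h by move=> xh; rewrite Ec; mems; rewrite xh !orbT.
  have nl g0 : {subset g0 <= h} -> c \notin g0 -> ~~ has (low 2) g0.
    move=> sg cg; have dg : d \notin g0 by apply: contra dh => /sg.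
    by rewrite low_2 negb_or; move: cg dg cd; case: c hc {Ec oc sp sq c2 ch} => [|[]] //; case: d hd {dh} => [|[]] // _ _ -> ->.
  apply: (@right_red n w a 2 (pre c h) c (post c h) iw).
  - by rewrite E {1}Ec.
  - exact: adj_2.
  - by apply: indep_01 => //; apply: contra ng => /sq.
  - rewrite has_cat negb_or; apply/andP; split; apply: indep_mid => //.
    + by apply: contra ng => /sp.
    + by apply: contra up => /sp.
    + by apply: nl => //; apply: pre_notin.
    + by apply: contra ng => /sq.
    + by apply: contra up => /sq.
    + by apply: nl.
exists a, h; split => //; rewrite low_2 in lg.
have [h0|h0] := boolP (0 \in h); have [h1|h1] := boolP (1 \in h); split => //.
- by case: (key 0 1).
- by case: (key 1 0).
- by rewrite (negPf h0) (negPf h1) in lg.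
- by rewrite (negPf h0) (negPf h1) in lg.
Qed.

(** Reflection of [down_low] in the diagram: either [i+1] recurs within the gap, or the gap runs to
    the end, since a next [i] would require a lower neighbour. *)
Lemma down_up w k : irr w -> down w k -> forall a i h, w = a ++ i :: h -> 2 <= i < n ->
  size h <= k -> ~~ has (low i) (pre i h) -> i.+1 \in pre i h -> fork_end w.
Proof.
move=> iw IH a i h E /andP[hi hin] sh lo ig.
set g := pre i h in lo ig *.
have ng : i \notin g by apply: pre_notin.
have [r Er] : exists r, h = g ++ r by exists (drop (index i h) h); rewrite cat_take_drop.
have Eg := pre_split ig; set g2 := pre i.+1 g in Eg; set g1 := post i.+1 g in Eg.
have E' : w = (a ++ i :: g2) ++ i.+1 :: (g1 ++ r) by rewrite E Er Eg; cats.
have [_ IH1] := IH _ _ _ E' ltac:(lia) (size_lt (etrans Er (etrans (congr1 (cat^~ r) Eg) (esym (catA _ _ _)))) sh).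
have subg x : x \in g1 -> x \in g by rewrite Eg; mems => ->; rewrite !orbT.
have subg2 x : x \in g2 -> x \in g by rewrite Eg; mems => ->.
have ng1 : i \notin g1 by apply: contra ng => /subg.
have ng2 : i \notin g2 by apply: contra ng => /subg2.
have [ig1|ig1] := boolP (i.+1 \in g1).
  have Eg1 := pre_split ig1.
  have Ep : pre i.+1 (g1 ++ r) = pre i.+1 g1.
    by rewrite {1}Eg1 -catA /= pre_head // pre_notin.
  have nn : ~~ has (low i.+1) (pre i.+1 g1).
    by rewrite low_ge3 //; apply: contra ng1 => /pre_sub.
  apply: IH1; rewrite Ep // .
  have := @gapLU n w (a ++ i :: g2) i.+1 (pre i.+1 g1) (post i.+1 g1 ++ r) iw.
  rewrite (negPf nn) orbF; apply => //; [|exact: pre_notin|exact: leqW].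
  by rewrite E' {1}Eg1; cats.
have [ih|ih] := boolP (i \in h).
  exfalso; move/negP: lo; apply.
  apply: (@gapU n hn w a i g (post i h) iw) => //.
  - by rewrite E {1}(pre_split ih).
  - by rewrite hi.
  - by rewrite Eg cnt_cons /= eqxx (cnt0 (pre_notin _ _)) (cnt0 ig1).
have Eh : g = h by apply: pre_id.
have r0 : r = [::].
  by move/eqP: Er; rewrite -Eh -{1}[g]cats0 eqseq_cat // eqxx => /eqP.
rewrite r0 cats0 in E' IH1.
have [lg|lg] := boolP (i.+2 \in g1).
  by apply: IH1; rewrite pre_id // low_ge3.
have lo1 : ~~ has (low i) g1 by apply/hasPn => x /subg; apply/hasPn.
have lo2 : ~~ has (low i) g2 by apply/hasPn => x /subg2; apply/hasPn.
exfalso; apply: (@right_red n w a i g2 i.+1 g1 iw).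
- by rewrite E -Eh Eg.
- exact: adj_succ.
- by apply: indep_mid (leqW hi) _ _ _; rewrite ?low_ge3.
- by rewrite has_cat negb_or; apply/andP; split; apply: indep_mid => //; apply: pre_notin.
Qed.

(** The bond of order 4 sends the chain back. The gap has only one [n+1], since two copies would
    have an [n] between them. If [n] recurs, [gap4] forbids a further [n+1] before the following
    [n], so the next gap is a turn below [n]. A word stopping earlier would end with [n, n+1] or
    [n+1, n]. *)
Lemma down_upn w k : irr w -> down w k -> forall a h, w = a ++ n :: h ->
  size h <= k -> ~~ has (low n) (pre n h) -> N \in pre n h -> fork_end w.
Proof.
move=> iw IH a h E sh lo ig.
set g := pre n h in lo ig *.
have ng : n \notin g by apply: pre_notin.
have [r Er] : exists r, h = g ++ r by exists (drop (index n h) h); rewrite cat_take_drop.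
have Eg := pre_split ig; set g2 := pre N g in Eg; set g1 := post N g in Eg.
have subg x : x \in g1 -> x \in g by rewrite Eg; mems => ->; rewrite !orbT.
have subg2 x : x \in g2 -> x \in g by rewrite Eg; mems => ->.
have ng1 : n \notin g1 by apply: contra ng => /subg.
have ng2 : n \notin g2 by apply: contra ng => /subg2.
have lo1 : ~~ has (low n) g1 by apply/hasPn => x /subg; apply/hasPn.
have lo2 : ~~ has (low n) g2 by apply/hasPn => x /subg2; apply/hasPn.
have Ew : w = (a ++ n :: g2) ++ N :: g1 ++ r by rewrite E Er Eg; cats.
have Ng1 : N \notin g1.
  apply/negP => Ng1; have := @gapN n hn w (a ++ n :: g2) (pre N g1) (post N g1 ++ r) iw.
  rewrite {1}Ew {1}(pre_split Ng1) pre_notin => /(_ _ isT) h'.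
  by move/negP: ng1; apply; apply: pre_sub (h' _); cats.
have iN : ~~ has (dep N) g1.
  by apply: indep_N => //; move=> x xg; apply: (irr_le iw); rewrite Ew; mems; rewrite xg !orbT.
have in1 : ~~ has (dep n) g1 by apply: indep_mid.
have in2 : ~~ has (dep n) g2 by apply: indep_mid => //; apply: pre_notin.
have aN := adj_succ hn.
have [nh|nh] := boolP (n \in h); last first.
  have Eh : g = h by apply: pre_id.
  exfalso; apply: (@right_red n w a n g2 N g1 iw) => //; first by rewrite E -Eh Eg.
  by rewrite has_cat negb_or in2.
have Eh := pre_split nh; rewrite -/g in Eh; set h' := post n h in Eh.
have E' : w = (a ++ n :: g) ++ n :: h' by rewrite E Eh; cats.
have [IH1 _] := IH _ _ _ E' (introT andP (conj hn (leqnn n))) (size_lt Eh sh).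
have Nh' : N \notin pre n h'.
  apply/negP => Np; have Ep := pre_split Np.
  have [r' Er'] : exists r', h' = pre n h' ++ r'.
    by exists (drop (index n h') h'); rewrite cat_take_drop.
  apply: (@gap4 n w a n g2 N g1 (pre N (pre n h')) (post N (pre n h') ++ r') iw) => //.
  - by rewrite E' {1}Er' {1}Ep Eg; cats.
  - by rewrite /spec !eqxx.
  - apply: indep_N => //; last exact: pre_notin.
      by move=> x /pre_sub /pre_sub xh; apply: (irr_le iw); rewrite E'; mems; rewrite xh !orbT.
    by apply/negP => /pre_sub; apply/negP/pre_notin.
apply: IH1 => //; apply/negPn/negP => lo'.
have [nh'|nh'] := boolP (n \in h').
  have := @gapLU n w (a ++ n :: g) n (pre n h') (post n h') iw.
  rewrite (negPf lo') (negPf Nh'); move/(_ _ (pre_notin _ _) hn) => H.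
  by apply: notF; apply: H; rewrite E' {1}(pre_split nh').
rewrite pre_id // in lo' Nh'.
apply: (@right_red n w (a ++ n :: g2) N g1 n h' iw).
- by rewrite E' Eg; cats.
- by rewrite adjC.
- exact: indep_mid.
- rewrite has_cat negb_or iN; apply: indep_N => //.
  by move=> x xh; apply: (irr_le iw); rewrite E'; mems; rewrite xh !orbT.
Qed.

Lemma down_turn w k : irr w -> down w k.
Proof.
move=> iw; elim: k => // k IH a i h E /andP[hi hin] sh; split=> H1 H2.
  case: i hi E hin H1 H2 => [|[|[|i]]] // _ E hin H1 H2; first exact: down_low2 IH _ _ E _ H1 H2.
  by apply: (down_low iw IH E) => //; lia.
have [in'|in'] : i < n \/ i = n by lia.
  by apply: (down_up iw IH E) => //; rewrite hi.
by subst i; apply: (down_upn iw IH E).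
Qed.

(** The two one-sided cases are turns and lead to a fork; a gap with neither side can only follow
    the last [i], by [gapLU]. *)
Lemma after_gap w a i h : irr w -> ~ fork_end w -> w = a ++ i :: h -> 2 <= i <= n ->
  (i \notin h /\ ~~ has (dep i) h) \/ (i.+1 \in pre i h /\ has (low i) (pre i h)).
Proof.
move=> iw nz E hi; have [H1 H2] := down_turn iw E hi (ltnSn _).
have [u|u] := boolP (i.+1 \in pre i h); have [l|l] := boolP (has (low i) (pre i h)).
- by right.
- by case: nz; apply: H2.
- by case: nz; apply: H1.
left; have [ih|ih] := boolP (i \in h).
  have := @gapLU n w a i (pre i h) (post i h) iw.
  rewrite (negPf u) (negPf l) => /(_ _ (pre_notin _ _)) H; exfalso; apply: notF; apply: H.
    by rewrite E {1}(pre_split ih).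
  by case/andP: hi.
by rewrite pre_id // in u l; split=> //; apply: indep_mid => //; case/andP: hi.
Qed.

End Turn.

(** * Zigzags *)

Section Zigzag.
Variable n : nat.
Hypothesis hn : 2 <= n.
Implicit Types w a b g h u v p q r t : seq nat.
Local Notation irr := (irr n).
Local Notation N := n.+1.

(** Bookkeeping on the prefix already read, [t] being what follows the last occurrence of a label.
    The bounds are those with which [gap01] and [gapU] forbid a premature return: no leaf comes back
    before the next 2, and no [j < b] before the next [j+1]. *)
Definition ok_up u (b : nat) :=
  (forall c, c <= 1 -> exists a t, [/\ u = a ++ c :: t, c \notin t & count_mem 2 t <= 1]) /\
  (forall j, 2 <= j < b -> exists a t,
     [/\ u = a ++ j :: t, j \notin t, count_mem j.+1 t <= 1 & ~~ has (low j) t]).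

(** Counterpart for the way down. The factor [n, n+1, n] is recorded because it is [gap4] that keeps
    [n+1] from coming back before [n]. *)
Definition ok_down u i :=
  (exists a t, [/\ u = a ++ n :: N :: n :: t, n \notin t & N \notin t]) /\
  (forall j, i < j <= n -> exists a t,
     [/\ u = a ++ j :: t, j \notin t, count (low j) t <= 1 & j.+1 \notin t]).

Lemma up_01 u (b : nat) v c : irr (u ++ v) -> ok_up u b -> c <= 1 -> c \notin pre 2 v.
Proof.
move=> iw [ok1 _] hc; apply/negP => cp; have cv := pre_sub cp.
have [a [t [Eu ct cnt]]] := ok1 c hc.
have := @gap01 n hn _ a c (t ++ pre c v) (post c v) iw.
rewrite {1}Eu {1}(pre_split cv) mem_cat (negPf ct) pre_notin => /(_ _ isT hc) H.
have : 1 < count_mem 2 (t ++ pre c v) by apply: H; cats.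
by rewrite count_cat (cnt0 (pre_asym cp)) addn0 ltnNge cnt.
Qed.

(** Induction from the fork upwards: an early return of a label has met its upper neighbour at most
    once since the last occurrence, hence requires a lower letter, which would itself be early. *)
Lemma up_mid u (b : nat) v j : irr (u ++ v) -> ok_up u b -> b <= n -> 2 <= j < b ->
  j \notin pre j.+1 v.
Proof.
move=> iw ok bn; elim: j => // j IH /andP[hj hjb]; apply/negP => jp.
have jv := pre_sub jp; have [_ ok2] := ok.
have [a [t [Eu jt cnt lt]]] := ok2 j.+1 ltac:(by rewrite hj).
have := @gapU n hn _ a j.+1 (t ++ pre j.+1 v) (post j.+1 v) iw.
rewrite {1}Eu {1}(pre_split jv) mem_cat (negPf jt) pre_notin.
rewrite count_cat (cnt0 (pre_asym jp)) addn0 cnt has_cat (negPf lt) hj (leq_trans hjb bn).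
move=> H; have {H} : has (low j.+1) (pre j.+1 v) by apply: H => //; cats.
have [j2|j2] := leqP 2 j.
  by rewrite low_ge3 //; apply/negP/IH; rewrite j2 ltnW.
have -> : j = 1 by apply/eqP; rewrite eqn_leq -ltnS j2.
by rewrite low_2 !(negPf (up_01 iw ok _)).
Qed.

Lemma down_N u i v : irr (u ++ v) -> ok_down u i -> N \notin pre n v.
Proof.
move=> iw [[a [t [Eu nt Nt]]] _]; apply/negP => Np; have Nv := pre_sub Np.
have sg x : x \in t ++ pre N v -> x \in u ++ v.
  by rewrite Eu; mems => /orP[->|/pre_sub->]; rewrite !orbT.
apply: (@gap4 n _ a n [::] N [::] (t ++ pre N v) (post N v) iw) => //.
- by rewrite Eu {1}(pre_split Nv); cats.
- by rewrite /spec !eqxx.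
- apply: indep_N; rewrite ?mem_cat ?(negPf nt) ?(negPf Nt) ?pre_notin ?pre_asym //.
  by move=> x /sg; apply: (irr_le iw).
Qed.

(** The same argument from [n] downwards, hence the induction on [n - j], started by [down_N]. *)
Lemma down_mid u i v j : irr (u ++ v) -> ok_down u i -> 2 <= i <= j -> j <= n ->
  j.+1 \notin pre j v.
Proof.
move=> iw ok /andP[hi hij] hjn.
have [k Ek] : exists k, n = j + k by exists (n - j); rewrite subnKC.
elim: k j hij hjn Ek => [|k IH] j hij hjn Ek.
  by rewrite addn0 in Ek; rewrite -Ek; apply: down_N iw ok.
have jn : j < n by rewrite Ek addnS ltnS leq_addr.
apply/negP => jp; have jv := pre_sub jp; have [_ ok2] := ok.
have [a [t [Eu jt cnt lt]]] := ok2 j.+1 ltac:(by rewrite ltnS hij).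
have := @gapL n hn _ a j.+1 (t ++ pre j.+1 v) (post j.+1 v) iw.
rewrite {1}Eu {1}(pre_split jv) mem_cat (negPf jt) pre_notin.
have j2 : 2 <= j := leq_trans hi hij.
rewrite count_low3 // count_cat (cnt0 (pre_asym jp)) addn0 -count_low3 // cnt.
rewrite mem_cat (negPf lt) jn (leqW j2) => H.
have {H} : j.+2 \in pre j.+1 v by apply: H => //; cats.
by apply/negP/IH; rewrite ?(leqW hij) // Ek addSnnS.
Qed.

(** The last letter is [m+1], so [ascent n] reaches [n+1]. Likewise [descent i] runs from [n] to [i]
    and is empty for [i = n+1]. *)
Definition ascent m := [:: 0, 1 & iota 2 m].
Definition descent i := rev (iota i (n.+1 - i)).

Lemma ascentS m : ascent m.+1 = ascent m ++ [:: m.+2].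
Proof. by rewrite /ascent -{1}(addn1 m) iotaD. Qed.

Lemma ascent_pred m : 0 < m -> ascent m = ascent m.-1 ++ [:: m.+1].
Proof. by case: m => // m _; apply: ascentS. Qed.

Lemma descentS i : i <= n -> descent i = descent i.+1 ++ [:: i].
Proof. by move=> h; rewrite /descent subSn //= rev_cons -cats1 subSS. Qed.

Lemma ascent_split m j : j < m -> ascent m = ascent j ++ j.+2 :: iota j.+3 (m - j.+1).
Proof.
move=> h; have E : m = j + (m - j.+1).+1 by rewrite addnS -addSn subnKC.
by rewrite /ascent {1}E iotaD.
Qed.

Lemma descent_split i j : i <= j <= n -> descent i = descent j.+1 ++ j :: rev (iota i (j - i)).
Proof.
move=> /andP[hi hj]; rewrite /descent.
have -> : n.+1 - i = (j - i) + (n.+1 - j.+1).+1 by lia.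
rewrite iotaD subnKC //= rev_cat rev_cons cat_rcons.
by rewrite subSS.
Qed.

Lemma count_iota_le1 (x i m : nat) : count_mem x (iota i m) <= 1.
Proof. by rewrite count_uniq_mem ?iota_uniq // leq_b1. Qed.

Lemma ok_up_ascent p m : 1 <= m -> ok_up (p ++ ascent m) m.+1.
Proof.
move=> hm; split=> [[|[|c]] // _|j /andP[hj hjm]].
- exists p, (1 :: iota 2 m); rewrite inE mem_iota /= add0n; split=> //.
  exact: count_iota_le1.
- exists (rcons p 0), (iota 2 m); rewrite cat_rcons mem_iota /=; split=> //.
  exact: count_iota_le1.
- case: j hj hjm => [|[|j]] // _ hj; exists (p ++ ascent j), (iota j.+3 (m - j.+1)).
  have jm : j < m := ltnW hj.
  rewrite mem_iota (@ascent_split m j) // -?catA; split=> //.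
  + by rewrite ltnn.
  + exact: count_iota_le1.
  + apply/hasPn => x; rewrite mem_iota /low => /andP[h _]; rewrite negb_and -leqNgt.
    by rewrite (ltnW h) orbT.
Qed.

(** The bound [i - 1] keeps [j+1] out of [descent i], so that only the ascent contributes a [j+1]
    after the last [j]. *)
Lemma ok_up_descent p i : 3 <= i <= n.+1 -> ok_up (p ++ ascent n ++ descent i) i.-1.
Proof.
move=> /andP[hi hin].
have Di x : x < i -> x \notin descent i by move=> h; rewrite mem_rev mem_iota leqNgt h.
split=> [[|[|c]] // _|j /andP[hj hjm]].
- exists p, (1 :: iota 2 n ++ descent i); rewrite inE mem_cat mem_iota /=.
  rewrite (negPf (Di _ _)) //; last by lia.
  split=> //; rewrite add0n count_cat (cnt0 (Di _ _)) // addn0; exact: count_iota_le1.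
- exists (rcons p 0), (iota 2 n ++ descent i); rewrite cat_rcons mem_cat mem_iota /=.
  rewrite (negPf (Di _ _)) //; last by lia.
  split=> //; rewrite count_cat (cnt0 (Di _ _)) // addn0; exact: count_iota_le1.
- case: j hj hjm => [|[|j]] // _ hj; exists (p ++ ascent j), (iota j.+3 (n - j.+1) ++ descent i).
  have ji : j.+3 < i by lia.
  rewrite mem_cat mem_iota (@ascent_split n j); last by lia.
  split=> //.
  + by cats.
  + by rewrite ltnn /= Di // ltnW.
  + rewrite count_cat (cnt0 (Di _ _)) // addn0; exact: count_iota_le1.
  + apply/hasPn => x; rewrite mem_cat mem_rev !mem_iota /low => h.
    rewrite negb_and -leqNgt; apply/orP; right; lia.
Qed.

Lemma ok_down_descent p i : 2 <= i <= n -> ok_down (p ++ ascent n ++ descent i) i.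
Proof.
move=> /andP[hi hin]; split=> [|j /andP[hij hjn]].
  exists (p ++ ascent n.-2), (rev (iota i (n - i))); rewrite !mem_rev !mem_iota; split.
  - rewrite (@descent_split i n) ?leqnn ?hin // (@ascent_split n n.-2); last by lia.
    rewrite /descent subnn /=.
    have -> : n - n.-2.+1 = 1 by lia.
    have -> : n.-2.+2 = n by lia.
    by cats.
  - lia.
  - lia.
exists (p ++ ascent n ++ descent j.+1), (rev (iota i (j - i))); rewrite !mem_rev !mem_iota; split.
- by rewrite (@descent_split i j) ?hjn ?(ltnW hij) //; cats.
- lia.
- rewrite count_rev; case: j hij {hjn} => // j hij.
  by rewrite count_low3 ?count_iota_le1 // (leq_trans hi).
- lia.
Qed.

(* The j.+1 in front would start, inside the nested turns of q, a chain ending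
   with the factor n+1, n, n+1, n. *)
Lemma no_turn_pair w j a p q r : irr w -> 2 <= j <= n ->
  w = a ++ j.+1 :: p ++ j :: q ++ j :: r ->
  j \notin p -> j.+1 \notin p -> j \notin q -> ~~ has (low j) q -> False.
Proof.
move=> iw; have [k] := ubnP (n - j); elim: k j a p q r => // k IH j a p q r.
rewrite ltnS => hk /andP[hj hjn] E jp jp' jq lq.
have jj : j.+1 \in q.
  have := @gapLU n w (a ++ j.+1 :: p) j q r iw.
  by rewrite (negPf lq) orbF; apply => //; rewrite E; cats.
have le x : x \in w -> x <= N by apply: (irr_le iw).
have [jn|jn] : j = n \/ j < n by move: hjn; rewrite leq_eqVlt => /predU1P.
  subst j; have Eq := pre_split jj.
  have nq x : x \in pre N q -> x \in q := @pre_sub _ _ _ _.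
  have nq' x : x \in post N q -> x \in q by rewrite {2}Eq; mems => ->; rewrite !orbT.
  have lq1 : ~~ has (low n) (pre N q) by apply/hasPn => x /nq; apply/hasPn.
  have lq2 : ~~ has (low n) (post N q) by apply/hasPn => x /nq'; apply/hasPn.
  have nq1 : n \notin pre N q by apply: contra jq => /nq.
  have nq2 : n \notin post N q by apply: contra jq => /nq'.
  have Nq2 : N \notin post N q.
    apply/negP => Nq; have := @gapN n hn w (a ++ N :: p ++ n :: pre N q)
      (pre N (post N q)) (post N (post N q) ++ n :: r) iw.
    rewrite E {1}Eq {1}(pre_split Nq) pre_notin => H.
    have {H} /pre_sub : n \in pre N (post N q) by apply: H => //; cats.
    by rewrite (negPf nq2).
  apply: (@gap4 n w a N p n (pre N q) (post N q) r iw).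
  - by rewrite E {1}Eq; cats.
  - by rewrite /spec !eqxx orbT.
  - by apply: indep_N => // x xp; apply: le; rewrite E; mems; rewrite xp !orbT.
  - apply: indep_N => //; last exact: pre_notin.
    by move=> x /nq xq; apply: le; rewrite E; mems; rewrite xq !orbT.
  - by apply: indep_mid => //; exact: pre_notin.
  - exact: indep_mid.
have j2 : 1 < count_mem j.+1 q.
  have := @gapU n hn w (a ++ j.+1 :: p) j q r iw.
  rewrite (negPf lq) hj jn => H; rewrite ltnNge; apply/negP => h.
  by apply: notF; apply: H => //; rewrite E; cats.
have Eq := pre_split jj; set q1 := pre _ q in Eq; set q' := post _ q in Eq.
have jj' : j.+1 \in q'.
  by move: j2; rewrite Eq cnt_cons /= eqxx (cnt0 (pre_notin _ _)) -cnt_gt0.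
have Eq' := pre_split jj'; set q2 := pre _ q' in Eq'; set q3 := post _ q' in Eq'.
have jq1 : j \notin q1 by apply: contra jq => /pre_sub.
have jq2 : j \notin q2.
  by apply: contra jq => /pre_sub h; rewrite Eq; mems; rewrite h !orbT.
have j1q1 : j.+1 \notin q1 := pre_notin _ _.
have Ew : w = a ++ j.+1 :: (p ++ j :: q1) ++ j.+1 :: q2 ++ j.+1 :: q3 ++ j :: r.
  by rewrite E Eq Eq'; cats.
have jn1 : j.+1 \notin p ++ j :: q1.
  by mems; rewrite jp' j1q1 gtn_eqF.
have := @gapL n hn w a j.+1 (p ++ j :: q1) _ iw Ew jn1.
rewrite jn (leqW hj) count_low3 // cnt_cons (cnt0 jp) (cnt0 jq1) /= eqxx => /(_ isT isT).
move=> /last_split[x [y [Exy jy]]].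
have sy z : z \in y -> z \in p ++ j :: q1 by rewrite Exy; mems => ->; rewrite !orbT.
apply: (@IH j.+1 (a ++ j.+1 :: x) y q2 (q3 ++ j :: r)) => //.
- by rewrite (leq_trans _ hk) // ltn_sub2l.
- by rewrite jn (leqW hj).
- by rewrite Ew Exy; cats.
- by apply: contra jn1 => /sy.
- exact: pre_notin.
- by rewrite low_ge3.
Qed.

(** Were 2 not to recur, a later 3 would make a turn above 2 and yield a [fork_end]; but the last 2
    would be the one of [ascent 1], with no leaf behind it. Without a 3 the word would end with
    [1, 2]. *)
Lemma second_2 p v : irr (p ++ ascent 1 ++ v) -> 2 \in v.
Proof.
move=> iw; apply/negPn/negP => v2.
have ok := ok_up_ascent p (leqnn 1).
have iw' : irr ((p ++ ascent 1) ++ v) by rewrite -catA.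
have nc c : c <= 1 -> c \notin v.
  by move=> hc; have := up_01 iw' ok hc; rewrite pre_id.
have lv : ~~ has (low 2) v by rewrite low_2 negb_or !nc.
have E : p ++ ascent 1 ++ v = (p ++ [:: 0; 1]) ++ 2 :: v by cats.
have [v3|v3] := boolP (3 \in v).
  have [] := down_turn hn iw E (introT andP (conj (leqnn 2) hn)) (ltnSn _).
  rewrite pre_id // => _ /(_ lv v3) [a [h [Eh [h2 _ h0 _]]]].
  (* The factorisation at the last 2 is unique; comparing the reversed words identifies [h] with
     [v]. *)
  have := pre_head (rev a) (s := 2) (a := rev h); rewrite mem_rev => /(_ h2).
  have -> : rev h ++ 2 :: rev a = rev v ++ 2 :: rev (p ++ [:: 0; 1]).
    by rewrite -[LHS]cat_rcons -[RHS]cat_rcons -!rev_cons -!rev_cat -Eh E.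
  rewrite pre_head ?mem_rev // => /(inv_inj (@revK nat)) vh.
  by move: h0; rewrite -vh; apply/negP/nc.
apply: (@right_red n _ (p ++ [:: 0]) 1 [::] 2 v iw) => //; first by cats.
  exact: indep_mid.
by apply: indep_01 => //; apply: nc.
Qed.

(** Since 2 recurs and no [j] comes back before [j+1], the label [m+1] recurs too; its gap has no
    lower letter, hence contains [m+2]. It remains to exclude an [m+3] ahead of that [m+2]: if
    [m+1 < n], the gap contains [m+2] twice, and [no_turn_pair] rules out such an [m+3] in front of
    the two. *)
Lemma step_up p m v : 1 <= m < n -> irr (p ++ ascent m ++ v) -> 2 \in v ->
  exists2 v', ceq v (m.+2 :: v') & 2 \in v'.
Proof.
move=> /andP[hm hmn] iw v2.
have ok := ok_up_ascent p hm; have iw' : irr ((p ++ ascent m) ++ v) by rewrite -catA.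
have nc c : c <= 1 -> c \notin pre 2 v by move=> hc; apply: up_01 iw' ok hc.
have nj j : 2 <= j < m.+1 -> j \notin pre j.+1 v by move=> hj; apply: up_mid iw' ok _ hj.
have mv : m.+1 \in v.
  elim: m hm nj {hmn iw iw' ok} => // m IH _ nj.
  case: m IH nj => // m IH nj.
  have /IH mv : 0 < m.+1 by []. 
  have {}mv : m.+2 \in v by apply: mv => j /andP[h1 h2]; apply: nj; rewrite h1 ltnW.
  have := nj m.+2; rewrite ltnSn => /(_ isT); apply: contraR => h.
  by rewrite pre_id.
set g := pre m.+1 v.
have lg : ~~ has (low m.+1) g.
  case: m hm nj @g {mv hmn iw iw' ok} => // -[|m] _ nj g; first by rewrite low_2 negb_or !nc.
  by rewrite low_ge3 //; apply: nj; rewrite ltnSn.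
have ng : m.+1 \notin g := pre_notin _ _.
have Ev := pre_split mv; rewrite -/g in Ev.
have Ew : p ++ ascent m ++ v = (p ++ ascent m.-1) ++ m.+1 :: g ++ m.+1 :: post m.+1 v.
  by rewrite {1}Ev (ascent_pred hm); cats.
have up_g : m.+2 \in g.
  by have := gapLU iw Ew ng hm; rewrite (negPf lg) orbF.
have mv' : m.+2 \in v := pre_sub up_g.
have Eg := pre_split up_g; set g1 := pre m.+2 g in Eg; set g' := post m.+2 g in Eg.
have Eg1 : pre m.+2 v = g1.
  by rewrite Ev Eg -catA /= pre_head // pre_notin.
have sg1 x : x \in g1 -> x \in g := @pre_sub _ _ _ _.
have ind : ~~ has (dep m.+2) g1.
  have [mn|mn] : m.+1 = n \/ m.+1 < n by move: hmn; rewrite leq_eqVlt => /predU1P.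
    rewrite mn; apply: indep_N => //.
    - move=> x /sg1 /pre_sub xv; apply: (irr_le iw).
      by rewrite !mem_cat xv !orbT.
    - by rewrite -mn; apply: contra ng => /sg1.
    - by rewrite -mn pre_notin.
  have m2 : 1 < count_mem m.+2 g.
    rewrite ltnNge; apply: contra lg => h.
    by apply: (gapU hn iw Ew ng) => //; rewrite mn andbT.
  have mg' : m.+2 \in g'.
    by move: m2; rewrite Eg cnt_cons /= eqxx (cnt0 (pre_notin _ _)) -cnt_gt0.
  have Eg' := pre_split mg'.
  apply: indep_mid => //; first exact: pre_notin.
    apply/negP => /last_split[x [y [Exy my]]].
    have sy z : z \in y -> z \in g1 by rewrite Exy; mems => ->; rewrite !orbT.
    have sg' z : z \in pre m.+2 g' -> z \in g.
      by move/pre_sub => h; rewrite Eg; mems; rewrite h !orbT.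
    apply: (@no_turn_pair _ m.+2 ((p ++ ascent m) ++ x) y (pre m.+2 g')
             (post m.+2 g' ++ m.+1 :: post m.+1 v) iw) => //.
    - by rewrite {1}Ev {1}Eg Exy {1}Eg'; cats.
    - by apply/negP => /sy; apply/negP/pre_notin.
    - exact: pre_notin.
    - by rewrite low_ge3 //; apply: contra ng => /sg'.
  by rewrite low_ge3 //; apply: contra ng => /sg1.
exists (pre m.+2 v ++ post m.+2 v); first by apply: ceq_front; rewrite ?Eg1.
by move: v2; rewrite {1}(pre_split mv') !mem_cat inE !eqSS (ltn_eqF hm).
Qed.

Lemma run_up p m v : 1 <= m <= n -> irr (p ++ ascent 1 ++ v) ->
  exists2 v', ceq (p ++ ascent 1 ++ v) (p ++ ascent m ++ v') & 2 \in v'.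
Proof.
move=> + iw; elim: m => // -[|m] IH /andP[_ hm].
  by exists v; [exact: ceq_refl | apply: second_2 iw].
have [|v1 e v12] := IH; first exact: ltnW hm.
have [|v' e' v'2] := @step_up p m.+1 v1 _ (irr_ceq e iw) v12; first exact: hm.
exists v' => //.
by apply: ceq_trans e _; rewrite (ascentS m.+1) -!catA; do 2!apply: ceq_catl.
Qed.

(** This includes [i = n], where the descent is empty and the last letter is the [n+1] of the
    ascent. *)
Lemma descent_last p i : 2 <= i <= n ->
  exists x, forall v, p ++ ascent n ++ descent i.+1 ++ v = x ++ i.+1 :: v.
Proof.
move=> /andP[hi]; rewrite leq_eqVlt => /predU1P[->|hin].
  by exists (p ++ ascent n.-1) => v; rewrite (ascent_pred (ltnW hn)) /descent subnn; cats.
by exists (p ++ ascent n ++ descent i.+2) => v; rewrite (descentS hin); cats.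
Qed.

(** Each label brings in the one below it, because [j+1] is not met before [j]. *)
Lemma down_mem u i v j : irr (u ++ v) -> 2 <= i <= n -> ok_down u i ->
  i <= j -> j \in v -> i \in v.
Proof.
move=> iw /andP[hi hin] ok; move: j; apply: nat_ind => [|j IH]; first by move: hi; case: i {hin ok}.
rewrite leq_eqVlt => /predU1P[->//|]; rewrite ltnS => hij jv; apply: IH => //.
have jn : j <= n by rewrite -ltnS; apply: (irr_le iw); rewrite mem_cat jv orbT.
have := @down_mid u i v j iw ok; rewrite hi => /(_ hij jn); apply: contraR => h.
by rewrite pre_id.
Qed.

(** The rest is not empty, as the word cannot end with adjacent letters. Any letter of the rest
    entails an [i], by the ascent bounds if it lies below [i] and by the descent bounds if above;
    and no neighbour of [i] can come before it. *)
Lemma step_down p i v : 2 <= i <= n -> irr (p ++ ascent n ++ descent i.+1 ++ v) ->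
  exists v', ceq v (i :: v').
Proof.
move=> /andP[hi hin] iw; set u := p ++ ascent n ++ descent i.+1.
have iw' : irr (u ++ v) by rewrite /u -!catA.
have nc c : c <= 1 -> c \notin pre 2 v.
  by move=> hc; apply: (up_01 iw' _ hc); apply: ok_up_descent; rewrite ltnS hi.
have nj j : 2 <= j < i -> j \notin pre j.+1 v.
  by move=> hj; apply: (up_mid iw' _ hin hj); apply: ok_up_descent; rewrite ltnS hi.
have iv_up j : 2 <= j <= i -> j \in v -> i \in v.
  move=> /andP[hj hji] jv; have [k Ek] : exists k, i = k + j by exists (i - j); rewrite subnK.
  rewrite Ek; elim: k {Ek hji}(leq_addl (i - j) j) (eq_leq (esym Ek)) => [|k IH] // h1 h2.
  have {}IH : k + j \in v by apply: IH => //; apply: leq_trans h2; rewrite leq_add2r.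
  have := nj (k + j); rewrite (leq_trans hj (leq_addl _ _)) /=.
  rewrite addSn in h2; rewrite h2 => /(_ isT); apply: contraR => h; by rewrite pre_id.
have nup : i.+1 \notin pre i v.
  move: (hin); rewrite leq_eqVlt => /predU1P[Ein|hin'].
    apply/negP => Np; rewrite Ein in Np; have Nv := pre_sub Np.
    have [|x Ex] := @descent_last p i; first by rewrite hi hin.
    have := @gapN n hn _ x (pre N v) (post N v) iw; rewrite pre_notin.
    have -> : p ++ ascent n ++ descent i.+1 ++ v = x ++ N :: pre N v ++ N :: post N v.
      by rewrite -(pre_split Nv) Ex Ein.
    by move=> /(_ erefl isT); apply/negP/pre_asym.
  have ok : ok_down u i.+1 by apply: ok_down_descent; rewrite hin' (leqW hi).
  have [iv|iv] := boolP (i.+1 \in v); last by apply: contra iv => /pre_sub.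
  apply: pre_asym; have [|x Ex] := @descent_last p i; first by rewrite hi.
  have Ew : p ++ ascent n ++ descent i.+1 ++ v = x ++ i.+1 :: pre i.+1 v ++ i.+1 :: post i.+1 v.
    by rewrite -(pre_split iv) Ex.
  rewrite -(low_ge3 _ hi).
  have := @gapL n hn _ _ _ _ _ iw Ew (pre_notin _ _); rewrite hin' (leqW hi) => /(_ isT).
  have := @down_mid u i.+1 v i.+1 iw' ok; rewrite leqnn (leqW hi) => /(_ isT hin') h1 h2.
  by rewrite has_count; case: (count _ _) h2 => // /(_ isT); rewrite (negPf h1).
have v0 : v != [::].
  apply/eqP => v0; move: (hin); rewrite leq_eqVlt => /predU1P[Ein|hin'].
    apply: (@right_red n _ (p ++ ascent n.-2) n [::] N [::] iw) => //; last by rewrite adj_succ.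
    have n0 : 0 < n.-1 by rewrite -ltnS (ltn_predK hn).
    rewrite v0 Ein /descent subnn (ascent_pred (ltnW hn)) (ascent_pred n0) (ltn_predK hn).
    by cats.
  have [|z Ez] := @descent_last p i.+1; first by rewrite hin' (leqW hi).
  apply: (@right_red n _ z i.+2 [::] i.+1 [::] iw) => //; last by rewrite adjC adj_succ // leqW.
  by rewrite -Ez v0 (descentS hin'); cats.
have iv : i \in v.
  case: v v0 iw iw' nc nj iv_up nup => // x v _ iw iw' nc nj iv_up nup.
  have [x1|x1] := leqP x 1.
    apply: (iv_up 2); first by rewrite hi.
    by have := nc x x1; apply: contraR => h; rewrite pre_id ?mem_head.
  have [xi|xi] := leqP x i; first by apply: (iv_up x); rewrite ?x1 ?mem_head.
  move: (hin); rewrite leq_eqVlt => /predU1P[Ein|hin'].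
    move/negP: nup; case; rewrite pre_cons; last by rewrite ltn_eqF.
    suff -> : x = i.+1 by rewrite mem_head.
    apply/eqP; rewrite eqn_leq xi andbT Ein; apply: (irr_le iw').
    by rewrite mem_cat mem_head orbT.
  have ok : ok_down u i.+1 by apply: ok_down_descent; rewrite hin' (leqW hi).
  have iv1 : i.+1 \in x :: v.
    by apply: (down_mem iw' _ ok xi); rewrite ?mem_head // hin' (leqW hi).
  by apply: contraR nup => h; rewrite pre_id.
exists (pre i v ++ post i v); apply: ceq_front => //.
apply: indep_mid => //; first exact: pre_notin.
case: i hi nj {iv iv_up nup iw iw' u v0 hin} => // -[|[|i]] // _ nj; first by rewrite low_2 negb_or !nc.
by rewrite low_ge3 //; apply: nj; rewrite ltnSn.
Qed.

Lemma run_down p v i : 2 <= i <= n.+1 -> irr (p ++ ascent n ++ v) ->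
  exists v', ceq (p ++ ascent n ++ v) (p ++ ascent n ++ descent i ++ v').
Proof.
move=> /andP[hi hin] iw; have [k Ek] : exists k, N = i + k by exists (N - i); rewrite subnKC.
elim: k i hi hin Ek => [|k IH] i hi hin Ek.
  by exists v; rewrite -[i]addn0 -Ek /descent subnn; exact: ceq_refl.
have ik : i <= n by rewrite -ltnS Ek addnS ltnS leq_addr.
have [|v1 e] := IH i.+1 (leqW hi) ik; first by rewrite Ek addSnnS.
have [|v' e'] := @step_down p i v1 _ (irr_ceq e iw); first by rewrite hi.
exists v'; apply: ceq_trans e _; rewrite (descentS ik) -!catA.
by do 3!apply: ceq_catl.
Qed.

(** The period stops before the next leaves, which open the following period; hence the trailing
    [0, 1] of [zig]. *)
Definition period := ascent n ++ descent 2.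
Definition zig (r : nat) := flatten (nseq r period) ++ [:: 0; 1].

Lemma pre_insert (s t y : nat) a b :
  s != t -> y \in pre s (a ++ b) -> y \in pre s (a ++ t :: b).
Proof.
move=> st; have [sa|sa] := boolP (s \in a).
  by rewrite {1 2}(pre_split sa) -!catA /= !pre_head ?pre_notin.
rewrite !pre_cat // pre_cons // !mem_cat inE => /orP[->//|->].
by rewrite !orbT.
Qed.

Lemma front_01 v : (forall c, c <= 1 -> c \in v /\ 2 \notin pre c v) ->
  exists v', ceq v [:: 0, 1 & v'].
Proof.
move=> h; have [h0 h02] := h 0 isT; have [h1 h12] := h 1 isT.
have i0 : ~~ has (dep 0) (pre 0 v) by apply: indep_01 => //; apply: pre_notin.
have e := ceq_front h0 i0; set v1 := pre 0 v ++ post 0 v in e.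
have h1' : 1 \in v1 by move: h1; rewrite (ceq_mem e) inE.
have i1 : ~~ has (dep 1) (pre 1 v1).
  apply: indep_01 => //; first exact: pre_notin.
  apply: contra h12 => /(@pre_insert 1 0 2) H.
  by rewrite {1}(pre_split h0); apply: H.
exists (pre 1 v1 ++ post 1 v1).
exact: ceq_trans e (ceq_cons 0 (ceq_front h1' i1)).
Qed.

(** If 2 recurs, its gap has no 3 and therefore two leaves, one of each by [once01]. If not, only
    leaves remain by [down_mem], and with fewer than both the word would end with [2, c] or
    [3, 2]. *)
Lemma step_down_01 p v : irr (p ++ ascent n ++ descent 2 ++ v) -> exists v', ceq v [:: 0, 1 & v'].
Proof.
move=> iw; set u := p ++ ascent n ++ descent 2.
have iw' : irr (u ++ v) by rewrite /u -!catA.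
have ok : ok_down u 2 by apply: ok_down_descent; rewrite leqnn.
have [x Ex] : exists x, forall v, p ++ ascent n ++ descent 2 ++ v = x ++ [:: 3, 2 & v].
  have [|x Ex] := @descent_last p 2; first by rewrite leqnn.
  by exists x => v'; rewrite (descentS hn) -Ex; cats.
have n3 := @down_mid u 2 v 2 iw' ok isT hn.
have o c : c <= 1 -> forall g b, 2 \notin g -> v = g ++ b -> count_mem c g <= 1.
  move=> hc g b g2 Ev; apply: (@once01 n hn _ u g b c iw') => //.
  by rewrite Ev.
have [v2|v2] := boolP (2 \in v).
  have Ev := pre_split v2.
  have : 1 < count (low 2) (pre 2 v).
    rewrite ltnNge; apply: contra n3 => cl.
    apply: (@gapL n hn _ (x ++ [:: 3]) 2 (pre 2 v) (post 2 v) iw) => //.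
      by rewrite -Ev Ex; cats.
    exact: pre_notin.
  have := o 0 isT _ _ (pre_notin _ _) Ev; have := o 1 isT _ _ (pre_notin _ _) Ev.
  rewrite count_low2 => o1 o0 o2; apply: front_01 => c hc.
  suff cp : c \in pre 2 v by split; [exact: pre_sub cp | exact: pre_asym].
  rewrite -cnt_gt0; move: o0 o1 o2; case: c hc => [|[|]] //;
  by case: (count_mem 0 _) => [|[|?]] //; case: (count_mem 1 _) => [|[|?]].
have v01 y : y \in v -> y <= 1.
  move=> yv; rewrite leqNgt; apply: contra v2 => y2.
  by apply: (@down_mem u 2 v y iw') => //; rewrite leqnn.
have v3 : 3 \notin v by apply/negP => /v01.
have key c d : c <= 1 -> d <= 1 -> c != d -> c \in v -> d \notin v -> False.
  move=> hc hd cd cv dv; have Ec := pre_split cv.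
  have := o c hc v [::] v2 (esym (cats0 v)); rewrite {1}Ec cnt_cons /= eqxx addn1.
  have vc y : y \in v -> y = c.
    move=> yv; have := v01 y yv; have : y != d by apply: contraNneq dv => <-.
    by move: cd hc hd; clear; case: c => [|[|]] //; case: d => [|[|]] //; case: y => [|[|]].
  have := pre_notin c v; case Ep: (pre c v) => [|y s]; last first.
    by rewrite (vc y) ?mem_head // (@pre_sub _ c) // Ep mem_head.
  case Eq: (post c v) => [|y s]; last first.
    by rewrite (vc y) /= ?eqxx // Ec Eq; mems; rewrite eqxx !orbT.
  move=> _ _; rewrite Ep Eq in Ec; apply: (@right_red n _ (x ++ [:: 3]) 2 [::] c [::] iw) => //.
    by rewrite Ec Ex; cats.
  exact: adj_2.
apply: front_01 => c hc; split; last by apply: contra v2 => /pre_sub.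
apply/negPn/negP => cv.
have [d [hd cd]] : exists d, d <= 1 /\ d != c by case: c hc {cv} => [|[|]] // _; [exists 1 | exists 0].
have [dv|dv] := boolP (d \in v); first exact: key hd hc cd dv cv.
case: v iw {iw' n3 o v2 v3 key ok} v01 cv dv => [|y s] iw v01 cv dv.
  apply: (@right_red n _ x 3 [::] 2 [::] iw) => //.
have := v01 y (mem_head _ _); move: cv dv; rewrite !inE !negb_or.
by move=> /andP[+ _] /andP[+ _]; move: cd hc hd; clear; case: c => [|[|]] //; case: d => [|[|]] //; case: y => [|[|]].
Qed.

Lemma step_2 p v : irr (p ++ ascent n ++ descent 2 ++ [:: 0, 1 & v]) -> v != [::] ->
  exists v', ceq v (2 :: v').
Proof.
move=> iw v0; set u := p ++ ascent n ++ descent 2.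
have iw' : irr (u ++ [:: 0, 1 & v]) by rewrite /u -!catA.
have ok : ok_down u 2 by apply: ok_down_descent; rewrite leqnn.
have n3 : 3 \notin pre 2 v.
  by have := @down_mid u 2 _ 2 iw' ok isT hn; rewrite !pre_cons // !inE.
have nc c : c <= 1 -> c \notin pre 2 v.
  move=> hc; apply/negP => cp; have Ec := pre_split (pre_sub cp).
  have [a [t [Ea ct t2]]] : exists a t, [/\ u ++ [:: 0, 1 & v] = a ++ c :: t ++ v, c \notin t & 2 \notin t].
    by case: c hc {cp Ec} => [|[|]] // _; [exists u, [:: 1] | exists (rcons u 0), [::]; rewrite cat_rcons].
  have := @gap01 n hn _ a c (t ++ pre c v) (post c v) iw'.
  rewrite Ea {1}Ec mem_cat (negPf ct) pre_notin count_cat (cnt0 t2) (cnt0 (pre_asym cp)) => H.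
  by apply: notF; apply: H => //; cats.
have v2 : 2 \in v.
  case: v v0 iw' nc {iw n3} => // x v _ iw' nc.
  have [x1|x1] := leqP x 1.
    by have := nc x x1; apply: contraR => h; rewrite pre_id ?mem_head.
  have : 2 \in [:: 0, 1, x & v].
    apply: (@down_mem u 2 _ x iw') => //.
    by rewrite !inE eqxx !orbT.
  by rewrite !inE.
exists (pre 2 v ++ post 2 v); apply: ceq_front => //.
by apply: indep_mid; rewrite ?pre_notin // low_2 negb_or !nc.
Qed.

(** Each round completes the current period, reads [0, 1], and then either stops or reads a 2, which
    restores the initial situation with one more period and a shorter rest. *)
Lemma zigzag_peel (r : nat) v : irr (flatten (nseq r period) ++ ascent 1 ++ v) ->
  exists2 r' : nat, 0 < r' & ceq (flatten (nseq r period) ++ ascent 1 ++ v) (zig r').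
Proof.
have [k] := ubnP (size (ascent 1 ++ v)); elim: k r v => // k IH r v; rewrite ltnS => sz iw.
set p := flatten (nseq r period) in iw *.
have [|v1 e1 _] := @run_up p n v _ iw; first by rewrite leqnn (ltnW hn).
have [|v2 e2] := @run_down p v1 2 _ (irr_ceq e1 iw); first exact: ltnW.
have e12 := ceq_trans e1 e2; have iw2 := irr_ceq e12 iw.
have [v3 e3] := step_down_01 iw2.
have e : ceq (p ++ ascent 1 ++ v) (p ++ ascent n ++ descent 2 ++ [:: 0, 1 & v3]).
  by apply: ceq_trans e12 _; do 3!apply: ceq_catl.
have iw3 := irr_ceq e iw.
have Ep : p ++ ascent n ++ descent 2 = flatten (nseq r.+1 period).
  by rewrite /p -[r.+1]addn1 nseqD flatten_cat /= cats0.
have [v30|v30] := eqVneq v3 [::].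
  by exists r.+1; rewrite // /zig -Ep -!catA -v30.
have [v4 e4] := step_2 iw3 v30.
have e' : ceq (p ++ ascent 1 ++ v) (flatten (nseq r.+1 period) ++ ascent 1 ++ v4).
  apply: ceq_trans e _; rewrite -Ep -!catA; do 3!apply: ceq_catl.
  exact: (@ceq_catl [:: 0; 1] _ _ e4).
have [|r' r'0 e''] := IH r.+1 v4 _ (irr_ceq e' iw); last first.
  by exists r' => //; apply: ceq_trans e' e''.
have := perm_size (ceq_perm e'); rewrite -Ep !size_cat => E.
move: sz E (isT : 1 < size (ascent n)); rewrite size_cat.
move: (size (ascent n)) (size (descent 2)) (size (ascent 1)) (size v) (size v4) (size p).
by clear; lia.
Qed.

(** Before the first 2 there are one 0, one 1, and letters commuting with 2. Moving the latter
    behind the 2 produces the start [0, 1, 2] of [zigzag_peel], with no period read yet. *)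
Lemma fork_end_zigzag w : irr w -> fork_end (rev w) -> exists2 r : nat, 0 < r & ceq w (zig r).
Proof.
move=> iw [a [h [E [h2 h3 h0 h1]]]].
have {E} E : w = rev h ++ 2 :: rev a by rewrite -[w]revK E rev_cat rev_cons cat_rcons.
have [v e] : exists v, ceq (rev h) [:: 0, 1 & v].
  apply: front_01 => c hc; rewrite mem_rev; split; first by case: c hc => [|[|]].
  by apply/negP => /pre_sub; rewrite mem_rev (negPf h2).
have cv c : c <= 1 -> c \notin v.
  move=> hc; have := @once01 n hn w [::] (rev h) (2 :: rev a) c iw E.
  rewrite mem_rev => /(_ h2 hc); rewrite (seq.permP (ceq_perm e)) /= => cnt.
  rewrite -cnt_gt0 -leqNgt; move: cnt; case: c hc => [|[|]] // _ /=.
have iv : ~~ has (dep 2) v.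
  have sv y : y \in v -> y \in h by rewrite -[y \in h]mem_rev (ceq_mem e) !inE => ->; rewrite !orbT.
  apply: indep_mid => //; first by apply: contra h2 => /sv.
    by apply: contra h3 => /sv.
  by rewrite low_2 negb_or !cv.
have e' : ceq w (flatten (nseq 0 period) ++ ascent 1 ++ (v ++ rev a)).
  rewrite E; apply: ceq_trans (ceq_catr _ e) _ => /=.
  by do 2!apply: ceq_cons; apply: ceq_move.
have [r r0 e''] := zigzag_peel (irr_ceq e' iw).
by exists r => //; apply: ceq_trans e' e''.
Qed.

End Zigzag.

(** * Candies *)

Section Candy.
Variable n : nat.
Hypothesis hn : 2 <= n.
Implicit Types w a b g h u v p : seq nat.
Local Notation irr := (irr n).
Local Notation N := n.+1.

(* The quantification over the class makes this invariant under commutation,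
   which [fork_end] is not syntactically. *)
Definition forkless w := irr w /\ forall w', ceq w w' -> ~ fork_end w' /\ ~ fork_end (rev w').

Lemma forkless_ceq w w' : ceq w w' -> forkless w -> forkless w'.
Proof. by move=> e [iw nz]; split=> [|w'' e']; [exact: irr_ceq e iw | apply/nz/(ceq_trans e e')]. Qed.

Lemma forkless_rev w : forkless w -> forkless (rev w).
Proof.
move=> [iw nz]; split=> [|w' /ceq_rev]; first exact: irr_rev.
by rewrite revK => /nz; rewrite revK => -[].
Qed.

Lemma forkless_gap w a i h : forkless w -> w = a ++ i :: h -> 2 <= i <= n ->
  (i \notin h /\ ~~ has (dep i) h) \/ (i.+1 \in pre i h /\ has (low i) (pre i h)).
Proof. by move=> [iw nz]; apply: after_gap => //; case: (nz w (ceq_refl w)). Qed.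

Lemma pre_has (P : pred nat) i v : has P (pre i v) -> has P v.
Proof. by move=> /hasP[x /pre_sub xv Px]; apply/hasP; exists x. Qed.

(** The letter [y] lies behind the first [i] or in front of it, and the second case is handled in
    the reversed word. Its presence excludes the first alternative of [forkless_gap]. *)
Lemma spread w i y : forkless w -> 2 <= i <= n -> i \in w -> y \in w -> adj i y ->
  i.+1 \in w /\ has (low i) w.
Proof.
move=> nz hi iw yw ay; have E := pre_split iw.
have sb h : i.+1 \in pre i h /\ has (low i) (pre i h) -> {subset h <= w} ->
    i.+1 \in w /\ has (low i) w.
  move=> [/pre_sub h1 /pre_has /hasP[x xh lx]] sh; split; first exact: sh.
  by apply/hasP; exists x => //; apply: sh.
have yi : y != i by apply/eqP => yi; move: ay; rewrite yi /adj /adj1; clear; lia.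
move: (yw); rewrite {1}E mem_cat inE (negPf yi) /= => /orP[ya|yh].
  have E' : rev w = rev (post i w) ++ i :: rev (pre i w).
    by rewrite {1}E rev_cat rev_cons cat_rcons.
  have [[_ /hasPn /(_ y)]|h] := forkless_gap (forkless_rev nz) E' hi.
    by rewrite mem_rev ya /dep ay orbT => /(_ isT).
  by apply: sb h _ => x; rewrite mem_rev => /pre_sub.
have [[_ /hasPn /(_ y)]|h] := forkless_gap nz E hi.
  by rewrite yh /dep ay orbT => /(_ isT).
by apply: sb h _ => x xh; rewrite E; mems; rewrite xh !orbT.
Qed.

Definition full w := (forall x, 2 <= x <= N -> x \in w) /\ has (low 2) w.

Lemma full_2 w : full w -> 2 \in w.
Proof. by move=> [h _]; apply: h; rewrite /= leqW. Qed.

(** Every edge of the diagram has an end in 2, ..., n; from there [spread] carries the presence of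
    both sides down to 2 and up to [n]. *)
Lemma forkless_full w x y : forkless w -> x \in w -> y \in w -> adj x y -> full w.
Proof.
move=> nz; have le z : z \in w -> z <= N by apply: (irr_le nz.1).
wlog: x y / 2 <= x <= n => [H|hx] xw yw axy.
  have [hx|hx] := boolP (2 <= x <= n); first exact: (H x y).
  have [hy|hy] := boolP (2 <= y <= n); first by apply: (H y x) => //; rewrite adjC.
  exfalso; have := le x xw; have := le y yw; move: hx hy axy hn.
  by rewrite /adj /adj1; clear; lia.
pose Q j := [/\ j \in w, j.+1 \in w & has (low j) w].
have Qx : Q x by have [] := spread nz hx xw yw axy.
have Qup j : 2 <= j -> j.+1 <= n -> Q j -> Q j.+1.
  move=> hj hjn [jw j1w lj].
  have [||] := @spread w j.+1 j nz _ j1w jw; first by rewrite hjn leqW.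
    by rewrite adjC adj_succ.
  by split.
have Qdn j : 2 <= j -> j.+1 <= n -> Q j.+1 -> Q j.
  move=> hj hjn [j1w j2w]; rewrite low_ge3 // => jw.
  have [||] := @spread w j j.+1 nz _ jw j1w; first by rewrite hj ltnW.
    by rewrite adj_succ.
  by split.
have /andP[x2 xn] := hx.
have Q2 : Q 2.
  have [k Ek] : exists k, x = 2 + k by exists (x - 2); rewrite subnKC.
  move: Qx xn; rewrite Ek; elim: k {Ek} => // k IH Qk kn.
  by apply: IH; [apply: Qdn; rewrite // -addnS | apply: ltnW; rewrite -addnS].
have QQ j : 2 <= j <= n -> Q j.
  move=> /andP[j2 jn]; have [k Ek] : exists k, j = 2 + k by exists (j - 2); rewrite subnKC.
  move: jn; rewrite Ek {j2 Ek}; elim: k => // k IH kn.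
  have kn' : (2 + k).+1 <= n by rewrite -addnS.
  by rewrite addnS; apply: Qup => //; apply: IH; apply: ltnW.
split; last by case: Q2.
move=> z /andP[z2]; rewrite leq_eqVlt => /predU1P[->|].
  by have [] : Q n by apply: QQ; rewrite hn leqnn.
by rewrite ltnS => zn; have [] : Q z by apply: QQ; rewrite z2.
Qed.

Lemma full_rev w : full w -> full (rev w).
Proof. by move=> [h1 h2]; split=> [x /h1|]; rewrite ?mem_rev ?has_rev. Qed.

Lemma full_ceq w w' : ceq w w' -> full w -> full w'.
Proof.
move=> e [h1 h2]; split=> [x /h1|]; first by rewrite (ceq_mem e).
by rewrite -(eq_has_r (ceq_mem e)).
Qed.

(** An [n] behind the last [n+1] would have nothing dependent behind it, as [n+1] does not return,
    and the word would end with [n+1, n]. *)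
Lemma last_N w p r : forkless w -> w = p ++ N :: r -> N \notin r -> n \notin r.
Proof.
move=> nz E Nr; apply/negP => nr; have Er := pre_split nr.
have E' : w = (p ++ N :: pre n r) ++ n :: post n r by rewrite E {1}Er; cats.
have sub x : x \in post n r -> x \in r by rewrite {2}Er; mems => ->; rewrite !orbT.
have [[n2 i2]|[/pre_sub /sub]] := forkless_gap nz E' (introT andP (conj hn (leqnn n))); last by rewrite (negPf Nr).
apply: (@right_red n w p N (pre n r) n (post n r) nz.1).
- by rewrite E {1}Er.
- by rewrite adjC adj_succ.
- exact: i2.
rewrite has_cat negb_or; apply/andP; split; apply: indep_N; rewrite ?pre_notin //.
- by move=> x /pre_sub xr; apply: (irr_le nz.1); rewrite E; mems; rewrite xr !orbT.
- by apply: contra Nr => /pre_sub.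
- by move=> x /sub xr; apply: (irr_le nz.1); rewrite E; mems; rewrite xr !orbT.
- by apply: contra Nr => /sub.
Qed.

Lemma indep_notin i y g : ~~ has (dep i) g -> dep i y -> y \notin g.
Proof. by move=> /hasPn h dy; apply/negP => /h; rewrite dy. Qed.

(** All occurrences are meant, so even the last [i] has letters of both sides behind it; for a
    [source] the last [i] can be carried to the end of the word. *)
Definition sink i w := forall a h, w = a ++ i :: h ->
  i.+1 \in pre i h /\ has (low i) (pre i h).
Definition source i w := forall a h, w = a ++ i :: h -> i \notin h -> ~~ has (dep i) h.

Lemma sink_n w : forkless w -> full w -> sink n w.
Proof.
move=> nz [fw _] a h E; have [[nh ih]|//] := forkless_gap nz E (introT andP (conj hn (leqnn n))).
exfalso; have Nh : N \notin h.
  by apply: indep_notin ih _; rewrite /dep adj_succ // orbT.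
have : N \in w by apply: fw; rewrite leqnn (leqW hn).
rewrite E mem_cat inE (gtn_eqF (ltnSn n)) (negPf Nh) !orbF.
move=> /last_split[p [q [Ea Nq]]].
have := @last_N w p (q ++ n :: h) nz; rewrite E Ea -catA /= !mem_cat !inE.
by rewrite (negPf Nq) (gtn_eqF (ltnSn n)) (negPf Nh) eqxx orbT => /(_ erefl isT).
Qed.

(** Were the last [i] followed by an [i+1], that one would in turn be followed by its lower
    neighbour, which is [i]. *)
Lemma source_of_sink w i : forkless w -> 2 <= i < n -> sink i.+1 w -> source i w.
Proof.
move=> nz /andP[i2 hin] sk a h E ih.
have [[]//|[/pre_sub i1h _]] := forkless_gap nz E (introT andP (conj i2 (ltnW hin))).
have Eh := pre_split i1h.
have [|_ /pre_has] := sk (a ++ i :: pre i.+1 h) (post i.+1 h).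
  by rewrite E {1}Eh; cats.
rewrite low_ge3 // => ip; move/negP: ih; case.
by rewrite Eh; mems; rewrite ip !orbT.
Qed.

(** If no [i+1] follows the last [i], then the last [i+1] has this [i] behind it and is not free to
    move to the end. *)
Lemma sink_of_source w i : forkless w -> full w -> 2 <= i < n -> source i.+1 w -> sink i w.
Proof.
move=> nz [fw _] /andP[i2 hin] sr a h E.
have [[ih dh]|//] := forkless_gap nz E (introT andP (conj i2 (ltnW hin))).
exfalso; have i1h : i.+1 \notin h.
  by apply: indep_notin dh _; rewrite /dep adj_succ // orbT.
have : i.+1 \in w by apply: fw; rewrite (leqW i2) ltnS ltnW.
rewrite E mem_cat inE (gtn_eqF (ltnSn i)) (negPf i1h) !orbF.
move=> /last_split[a1 [a2 [Ea i1a2]]].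
suff /negP[] : ~~ has (dep i.+1) (a2 ++ i :: h).
  by apply/hasP; exists i; [mems; rewrite eqxx orbT | rewrite /dep adjC adj_succ // orbT].
apply: (@sr a1); first by rewrite E Ea; cats.
by rewrite mem_cat inE (gtn_eqF (ltnSn i)) (negPf i1h) (negPf i1a2).
Qed.

Lemma sink_source w k : forkless w -> full w -> 2 <= n - k ->
  if odd k then source (n - k) w else sink (n - k) w.
Proof.
move=> nz fw; elim: k => [|k IH] hk; first by rewrite subn0; apply: sink_n.
have Ek : n - k = (n - k.+1).+1 by rewrite subnSK //; move: hk; clear; lia.
have hk' : 2 <= n - k.+1 < n by rewrite hk; move: hk; clear; lia.
have := IH; rewrite Ek => {}IH; have {}IH := IH (leqW hk).
rewrite /=; case: (odd k) IH => /= IH; first exact: sink_of_source.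
exact: source_of_sink.
Qed.

(** With nothing dependent behind the last 2, the last leaf lies before it. No other 2 is in
    between, since that 2 would require a leaf behind it; so the word ends with this leaf and 2. *)
Lemma not_source_2 w : forkless w -> full w -> source 2 w -> False.
Proof.
move=> nz fw sr; have lw := fw.2.
have /last_split[a [h [E h2]]] := full_2 fw.
have i2 := sr a h E h2.
have lh : ~~ has (low 2) h.
  by apply/hasPn => x xh; move/hasPn/(_ x xh): i2; apply: contra => /andP[ax _]; rewrite /dep ax orbT.
have : has (low 2) a by move: lw; rewrite E has_cat /= (negPf lh) !orbF.
move=> /last_splitP[a1 [c [a2 [Ea lc la2]]]].
have c1 : c <= 1 by move: lc; rewrite /low; case/andP.
have ca2 : c \notin a2 by apply/negP => ca; move/hasPn/(_ c ca): la2; rewrite lc.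
have ch : c \notin h by apply/negP => ca; move/hasPn/(_ c ca): lh; rewrite lc.
have a22 : 2 \notin a2.
  apply/negP => a22; have E2 := pre_split a22.
  have Ew : w = (a1 ++ c :: pre 2 a2) ++ 2 :: (post 2 a2 ++ 2 :: h).
    by rewrite E Ea {1}E2; cats.
  have [[]|[_]] := forkless_gap nz Ew hn; first by rewrite mem_cat mem_head orbT.
  have la : ~~ has (low 2) (post 2 a2).
    by apply: contra la2 => h'; rewrite E2 has_cat /= h' !orbT.
  have [q2|q2] := boolP (2 \in post 2 a2).
    rewrite {1}(pre_split q2) -catA pre_head ?pre_notin // => /pre_has.
    by rewrite (negPf la).
  by rewrite pre_head // (negPf la).
apply: (@right_red n w a1 c a2 2 h nz.1) => //.
- by rewrite E Ea; cats.
- by rewrite adjC adj_2.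
by rewrite has_cat negb_or; apply/andP; split; apply: indep_01.
Qed.

(** The alternation starts with a sink at [n]; for odd [n] it would make 2 a source. *)
Lemma full_even w : forkless w -> full w -> ~~ odd n.
Proof.
move=> nz fw; apply/negP => on; apply: (not_source_2 nz fw).
have := @sink_source w (n - 2) nz fw; rewrite subKn // oddB // on; exact.
Qed.

Lemma full_sink w i : forkless w -> full w -> 2 <= i <= n -> ~~ odd i -> sink i w.
Proof.
move=> nz fw /andP[i2 hin] oi; have := @sink_source w (n - i) nz fw.
by rewrite subKn // oddB // (negPf oi) (negPf (full_even nz fw)) /=; apply.
Qed.

(** Equal leaves contradict [gap01]. Different ones are both 0 and 1, so the leaf required behind
    the next 2 repeats one of them with a single 2 in between, against [alt01]. *)
Lemma slot w a c g d h : forkless w -> full w -> w = a ++ c :: g ++ d :: h ->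
  c <= 1 -> d <= 1 -> 2 \notin g -> False.
Proof.
(* Some 2 occurs, and not between the two leaves; reversal puts it on the right. *)
wlog: w a c g d h / 2 \in h => [H|h2] nz fw E hc hd g2.
  have [h2|h2] := boolP (2 \in h); first exact: (H w a c g d h).
  have := full_2 fw; rewrite E; mems; rewrite (negPf g2) (negPf h2) => w2.
  apply: (H (rev w) (rev h) d (rev g) c (rev a)) => //.
  - by move: w2; rewrite mem_rev (gtn_eqF (hc : c < 2)) (gtn_eqF (hd : d < 2)) !orbF.
  - exact: forkless_rev.
  - exact: full_rev.
  - by rewrite E !(rev_cat, rev_cons) -!cats1; cats.
  - by rewrite mem_rev.
have [cd|cd] := eqVneq c d.
  subst d; have [cg|cg] := boolP (c \in g).
    have := @gap01 n hn w a c (pre c g) (post c g ++ c :: h) nz.1.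
    rewrite pre_notin (@cnt0 2) => [H|]; last by apply: contra g2 => /pre_sub.
    by apply: notF; apply: H => //; rewrite E {1}(pre_split cg); cats.
  have := @gap01 n hn w a c g h nz.1 E cg hc.
  by rewrite (cnt0 g2).
have Eh := pre_split h2.
have E' : w = a ++ (c :: g ++ d :: pre 2 h) ++ 2 :: post 2 h by rewrite E {1}Eh; cats.
have [|_] := @full_sink w 2 nz fw (introT andP (conj isT hn)) isT (a ++ c :: g ++ d :: pre 2 h) (post 2 h).
  by rewrite E'; cats.
move=> /hasP[e eh le]; have e1 : e <= 1 by move: le; rewrite /low; case/andP.
have [r Er] : exists r, post 2 h = pre 2 (post 2 h) ++ r.
  by exists (drop (index 2 (post 2 h)) (post 2 h)); rewrite cat_take_drop.
apply: (@alt01 n hn w a (c :: g ++ d :: pre 2 h) (pre 2 (post 2 h)) r e nz.1) => //.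
- by rewrite -Er.
- by rewrite !(inE, mem_cat) (gtn_eqF (hc : c < 2)) (negPf g2) (gtn_eqF (hd : d < 2)) (negPf (pre_notin _ _)).
- exact: pre_notin.
- have [->|->] : e = c \/ e = d by move: e1 hc hd cd; clear; lia.
    exact: mem_head.
  by mems; rewrite eqxx !orbT.
Qed.

(** The ranges are 3, ..., n+1 here and 2, ..., n in [even_word]. *)
Definition odds := [seq x <- iota 3 n.-1 | odd x].
Definition even_word := [seq x <- iota 2 n.-1 | ~~ odd x].
Definition odd_word (c : nat) := c :: odds.

Lemma mem_odds x : (x \in odds) = odd x && (3 <= x <= N).
Proof. by rewrite mem_filter mem_iota; congr (_ && (_ && _)); move: hn; clear; lia. Qed.

Lemma mem_even_word x : (x \in even_word) = ~~ odd x && (2 <= x <= n).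
Proof. by rewrite mem_filter mem_iota; congr (_ && (_ && _)); move: hn; clear; lia. Qed.

Lemma dep_parity (x y : nat) : 2 <= x -> 2 <= y -> odd x = odd y -> x != y -> ~~ dep x y.
Proof.
move=> x2 y2 oxy xy; rewrite /dep (negPf xy) /= /adj /adj1.
have xs : y != x.+1 by apply: contra_eq_neq oxy => ->; rewrite /=; case: (odd x).
have ys : x != y.+1 by apply: contra_eq_neq oxy => ->; rewrite /=; case: (odd y).
by move: x2 y2 xs ys; clear; lia.
Qed.

Lemma pairwise_parity (L : seq nat) (b : bool) : uniq L -> {in L, forall x, (2 <= x) && (odd x == b)} ->
  pairwise (fun x y => ~~ dep x y) L.
Proof.
elim: L => //= x L IH /andP[xL uL] H; rewrite IH // => [|y yL]; last first.
  by apply: H; rewrite inE yL orbT.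
rewrite andbT; apply/allP => y yL; have /andP[x2 /eqP ox] := H x (mem_head _ _).
have /andP[y2 /eqP oy] : (2 <= y) && (odd y == b) by apply: H; rewrite inE yL orbT.
apply: dep_parity => //; first by rewrite ox oy.
by apply: contraNneq xL => ->.
Qed.

Lemma front_list (L v : seq nat) : uniq L -> pairwise (fun x y => ~~ dep x y) L ->
  (forall x, x \in L -> x \in v /\ ~~ has (dep x) (pre x v)) ->
  exists v', ceq v (L ++ v').
Proof.
elim: L v => [|x L IH] v /=; first by move=> _ _ _; exists v; apply: ceq_refl.
move=> /andP[xL uL] /andP[/allP ax aL] H.
have [xv xp] := H x (mem_head _ _).
have e := ceq_front xv xp; set v1 := _ ++ _ in e.
have [y yL|v' e'] := IH v1 uL aL; last first.
  by exists v'; apply: ceq_trans e (ceq_cons x e').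
have [yv yp] := H y (@mem_behead _ (x :: L) y yL).
have yx : y != x by apply: contraNneq xL => <-.
split; first by move: yv; rewrite (ceq_mem e) inE (negPf yx).
apply/hasPn => z zp; move/hasPn: yp; apply.
by rewrite {1}(pre_split xv); apply: pre_insert.
Qed.

Lemma even_word_commuting : uniq even_word && pairwise (fun x y => ~~ dep x y) even_word.
Proof.
have uE : uniq even_word by rewrite filter_uniq ?iota_uniq.
rewrite uE; apply: (@pairwise_parity _ false uE).
by move=> x; rewrite mem_even_word => /and3P[/negPf-> -> _].
Qed.

Lemma odd_word_commuting c : c <= 1 -> uniq (odd_word c) && pairwise (fun x y => ~~ dep x y) (odd_word c).
Proof.
move=> c1; have uO : uniq odds by rewrite filter_uniq ?iota_uniq.
rewrite /odd_word /= uO andbT mem_odds; apply/and3P; split; first by move: c1; clear; lia.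
  by apply/allP => x; rewrite mem_odds /dep /adj /adj1; move: c1; clear; lia.
apply: (@pairwise_parity _ true uO).
by move=> x; rewrite mem_odds => /and3P[-> /ltnW -> _].
Qed.

(** An odd label may come first because each of its even neighbours in 2, ..., n is preceded by it;
    the leaf [c] is one found before the first 2. *)
Lemma peel_odd v : ~~ odd n -> {in v, forall x, x <= N} ->
  (forall i, 2 <= i <= n -> ~~ odd i -> i.+1 \in pre i v /\ has (low i) (pre i v)) ->
  exists c v', c <= 1 /\ ceq v (odd_word c ++ v').
Proof.
move=> en le H; have [_] := H 2 (introT andP (conj isT hn)) isT.
move=> /hasP[c cp lc]; have c1 : c <= 1 by move: lc; rewrite /low; case/andP.
have /andP[uO pO] := odd_word_commuting c1.
have [x|v' e] := @front_list (odd_word c) v uO pO.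
  rewrite inE => /predU1P[->|].
    split; first exact: pre_sub cp.
    by apply: indep_01 => //; [exact: pre_notin | exact: pre_asym].
  rewrite mem_odds => /and3P[ox x3 xN].
  case: x ox x3 xN => // x; rewrite !ltnS => ox x2 xn.
  have [x1p lx] := H x (introT andP (conj x2 xn)) ox.
  split; first exact: pre_sub x1p.
  apply: indep_mid => //; first exact: leqW.
  + exact: pre_notin.
  + have [x1n|x1n] := leqP x.+2 n.
      have [_] := H x.+2 ltac:(by rewrite x1n leqW // leqW) ltac:(by rewrite /= negbK).
      by rewrite low_ge3 ?leqW // => h; apply: pre_asym.
    (* The upper neighbour [x+2] could only be [n+1], which would make [n] equal to the odd label
       [x+1]. *)
    apply/negP => /pre_sub /le; rewrite ltnS => x1n'.
    move: ox en; have -> : n = x.+1 by move: x1n x1n'; clear; lia.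
    by rewrite /= => ->.
  + by rewrite low_ge3 //; apply: pre_asym.
by exists c, v'.
Qed.

(** The letters of the layer behind [i] are even and larger, so both sides promised by [full_sink]
    are found in [v]. *)
Lemma even_step p v i : forkless (p ++ even_word ++ v) -> full (p ++ even_word ++ v) -> 2 <= i <= n ->
  ~~ odd i -> i.+1 \in pre i v /\ has (low i) (pre i v).
Proof.
move=> nz fw hi oi; have iE : i \in even_word by rewrite mem_even_word hi oi.
have EE : even_word = [seq x <- iota 2 (i - 2) | ~~ odd x] ++
               i :: [seq x <- iota i.+1 (n - i) | ~~ odd x].
  rewrite /even_word (_ : n.-1 = (i - 2) + (n - i).+1); last by move: hi; clear; lia.
  by rewrite iotaD subnKC ?(proj1 (andP hi)) // filter_cat /= oi.
set E2 := (X in _ ++ i :: X) in EE.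
have := full_sink nz fw hi oi (a := p ++ [seq x <- iota 2 (i - 2) | ~~ odd x]) (h := E2 ++ v).
rewrite {1}EE -!catA /= => /(_ erefl).
have mE2 x : x \in E2 -> ~~ odd x && (i < x) by rewrite mem_filter mem_iota => /and3P[->->].
have iE2 : i \notin E2 by apply/negP => /mE2; rewrite ltnn andbF.
rewrite pre_cat // mem_cat has_cat => -[h1 h2]; split.
  by case/orP: h1 => // /mE2 /=; rewrite negbK (negPf oi).
by case/orP: h2 => // /hasP[x /mE2 /andP[_ ix]]; rewrite /low => /andP[_]; rewrite ltnNge ltnW.
Qed.

Lemma mid_step p c v i : forkless (p ++ odd_word c ++ v) -> 3 <= i < n -> odd i ->
  (i \notin v /\ ~~ has (dep i) v) \/ (i.+1 \in pre i v /\ has (low i) (pre i v)).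
Proof.
move=> nz hi oi.
have EE : odds = [seq x <- iota 3 (i - 3) | odd x] ++
               i :: [seq x <- iota i.+1 (N - i) | odd x].
  rewrite /odds (_ : n.-1 = (i - 3) + (N - i).+1); last by move: hi; clear; lia.
  by rewrite iotaD subnKC ?(proj1 (andP hi)) // filter_cat /= oi.
set O2 := (X in _ ++ i :: X) in EE.
have hi' : 2 <= i <= n by move: hi; clear; lia.
have := @forkless_gap _ (p ++ c :: [seq x <- iota 3 (i - 3) | odd x]) i (O2 ++ v) nz _ hi'.
rewrite {1}/odd_word EE; case=> [|h|h]; first by cats.
  left; case: h; rewrite mem_cat has_cat !negb_or => /andP[_ ->] /andP[_ ->]; by [].
right; have mO2 x : x \in O2 -> odd x && (i < x) by rewrite mem_filter mem_iota => /and3P[->->].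
have iO2 : i \notin O2 by apply/negP => /mO2; rewrite ltnn andbF.
move: h; rewrite pre_cat // mem_cat has_cat => -[h1 h2]; split.
  by case/orP: h1 => // /mO2 /=; rewrite oi.
by case/orP: h2 => // /hasP[x /mO2 /andP[_ ix]]; rewrite /low => /andP[_]; rewrite ltnNge ltnW.
Qed.

(** A nonempty rest contains an even label, and through the odd labels between them ([nbv]) it then
    contains all. They can come first: an odd label from 3 to below [n] waits for both its
    neighbours, [n+1] waits for [n], and a leaf waits for 2 by [slot]. *)
Lemma peel_even p c v : forkless (p ++ odd_word c ++ v) -> full (p ++ odd_word c ++ v) -> c <= 1 ->
  v != [::] -> exists v', ceq v (even_word ++ v').
Proof.
move=> nz fw hc v0; have en := full_even nz fw.
have le x : x \in v -> x <= N by move=> xv; apply: (irr_le nz.1); rewrite !mem_cat xv !orbT.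
have n01 d : d <= 1 -> d \notin pre 2 v.
  move=> hd; apply/negP => dp; have Ed := pre_split (pre_sub dp).
  apply: (@slot _ p c (odds ++ pre d v) d (post d v) nz fw) => //.
    by rewrite {1}Ed; cats.
  by rewrite mem_cat mem_odds (negPf (pre_asym dp)).
have oddv i : 3 <= i < n -> odd i -> i \in v -> i.+1 \in pre i v /\ has (low i) (pre i v).
  by move=> hi oi iv; have [[]|//] := mid_step nz hi oi; rewrite iv.
have nbv i j : 3 <= i < n -> odd i -> j \in v -> dep i j -> i.+1 \in v /\ i.-1 \in v.
  move=> hi oi jv dj; have [[_ /hasPn/(_ j jv)]|[/pre_sub h1 /pre_has]] := mid_step nz hi oi.
    by rewrite dj.
  case: i hi oi dj h1 => // i /andP[i2 _] _ _ h1; rewrite low_ge3 //; by split.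
have Nv : N \in v -> n \in pre N v.
  move=> Nv; have EE : odds = [seq x <- iota 3 (n - 2) | odd x] ++ [:: N].
    rewrite /odds (_ : n.-1 = n - 2 + 1); last by move: hn; clear; lia.
    rewrite iotaD filter_cat (_ : 3 + (n - 2) = N); last by move: hn; clear; lia.
    by rewrite /= en.
  have := @gapN n hn _ (p ++ c :: [seq x <- iota 3 (n - 2) | odd x]) (pre N v) (post N v) nz.1.
  by rewrite -(pre_split Nv) /odd_word EE pre_notin => H; apply: H => //; cats.
have ev_ex : exists2 j, j \in v & ~~ odd j && (2 <= j <= n).
  case: v v0 nz fw le n01 oddv nbv Nv => // x v _ nz fw le n01 oddv nbv Nv.
  have xv := mem_head x v.
  have [x1|x1] := leqP x 1.
    exists 2 => //; have := n01 x x1; apply: contraR => h; by rewrite pre_id.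
  have [ox|ox] := boolP (odd x); last first.
    exists x => //; rewrite ox x1 /=; have := le x xv; rewrite leq_eqVlt => /predU1P[xN|//].
    by move: ox; rewrite xN /= en.
  have x3 : 2 < x by move: x1 ox; clear; case: x => [|[|[|]]].
  have [xn|xn] := ltnP x n.
    have [|h _] := oddv x _ ox xv; first by rewrite x3.
    exists x.+1; first exact: pre_sub h.
    by rewrite /= ox xn leqW.
  exists n; last by rewrite en hn leqnn.
  have xN : x = N.
    apply/eqP; rewrite eqn_leq (le x xv) /= ltn_neqAle xn andbT.
    by apply: contraTneq ox => <-.
  by subst x; apply: pre_sub (Nv xv).
have dn k : 0 < k -> k.*2.+2 <= n -> k.*2.+2 \in v -> k.*2 \in v.
  move=> k0 kn kv; have [||||//] := @nbv k.*2.+1 k.*2.+2.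
  - by move: k0 kn; clear; lia.
  - by rewrite /= odd_double.
  - exact: kv.
  - by rewrite /dep adj_succ ?orbT //; move: k0; clear; lia.
have up k : 0 < k -> k.*2.+2 <= n -> k.*2 \in v -> k.*2.+2 \in v.
  move=> k0 kn kv; have [||||//] := @nbv k.*2.+1 k.*2.
  - by move: k0 kn; clear; lia.
  - by rewrite /= odd_double.
  - exact: kv.
  - by rewrite /dep adjC adj_succ ?orbT //; move: k0; clear; lia.
have ev j : ~~ odd j && (2 <= j <= n) -> j \in v.
  have v2 : 2 \in v.
    case: ev_ex => i iv /andP[oi /andP[i2 hin]].
    move: iv i2 hin; rewrite -(even_halfK oi); case: (i./2) => // k + _.
    elim: k => // k IH kv kn; apply: IH; last by move: kn; clear; lia.
    exact: dn.
  move=> /andP[oj /andP[j2 hjn]]; move: j2 hjn; rewrite -(even_halfK oj).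
  case: (j./2) => // k _; elim: k => // k IH kn.
  by rewrite doubleS; apply: up => //; apply: IH; move: kn; clear; lia.
have /andP[uE pE] := even_word_commuting.
apply: front_list uE pE _.
move=> j; rewrite mem_even_word => hj; split; first exact: ev.
have /and3P[oj j2 jn] := hj.
apply: indep_mid => //; first exact: pre_notin.
  apply/negP => jp; have j1v := pre_sub jp.
  move: jn; rewrite leq_eqVlt => /predU1P[jN|jn].
    by subst j; move/negP: (pre_asym jp); apply; apply: Nv.
  have j1n : j.+1 < n.
    rewrite ltn_neqAle jn andbT; apply: contraNneq en => <-; by rewrite /= oj.
  have [||] := oddv j.+1 _ _ j1v; [by rewrite j1n ltnS j2 | by rewrite /= oj|].
  by rewrite low_ge3 // (negPf (pre_asym jp)).
have [j3|j3] := leqP j 2.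
  have -> : j = 2 by apply/eqP; rewrite eqn_leq j3.
  by rewrite low_2 negb_or !n01.
case: j {hj j2} oj jn j3 => // j /=; rewrite negbK => oj jn j2.
rewrite low_ge3 //; apply/negP => jp.
have j3 : 2 < j by move: j2 oj; clear; case: j => [|[|[|]]].
have [|h _] := oddv j _ oj (pre_sub jp); first by rewrite j3.
by move/negP: (pre_asym jp); apply.
Qed.

Definition candy_word (c : nat) (cs : seq nat) := odd_word c ++ flatten [seq even_word ++ odd_word d | d <- cs].

(** The two peelings alternate on an ever shorter rest. Consecutive leaves differ because a single 2
    separates them. *)
Lemma candy_tail p c v : forkless (p ++ odd_word c ++ v) -> full (p ++ odd_word c ++ v) -> c <= 1 ->
  exists cs, [/\ ceq v (flatten [seq even_word ++ odd_word d | d <- cs]), path (fun x y => x != y) c cs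
    & all (fun x => x <= 1) cs].
Proof.
have [k] := ubnP (size v); elim: k p c v => // k IH p c v; rewrite ltnS => sz nz fw hc.
have [->|v0] := eqVneq v [::]; first by exists [::]; split=> //; apply: ceq_refl.
have [v1 e1] := peel_even nz fw hc v0.
have e1' : ceq (p ++ odd_word c ++ v) ((p ++ odd_word c) ++ even_word ++ v1).
  by rewrite -catA; do 2!apply: ceq_catl.
have nz1 := forkless_ceq e1' nz; have fw1 := full_ceq e1' fw.
have [||d [v2 [hd e2]]] := @peel_odd v1 (full_even nz fw).
- by move=> x xv; apply: (irr_le nz1.1); rewrite !mem_cat xv !orbT.
- by move=> i; apply: even_step nz1 fw1.
have e2' : ceq (p ++ odd_word c ++ v) ((p ++ odd_word c ++ even_word) ++ odd_word d ++ v2).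
  apply: ceq_trans e1' _; rewrite -!catA; do 3!apply: ceq_catl; exact: e2.
have nz2 := forkless_ceq e2' nz; have fw2 := full_ceq e2' fw.
have EL2 : even_word = 2 :: [seq x <- iota 3 n.-2 | ~~ odd x].
  rewrite /even_word; have -> : n.-1 = n.-2.+1 by move: hn; clear; lia.
  by [].
have cd : c != d.
  apply/eqP => cd; subst d.
  apply: (@alt01 n hn _ p (odd_word c) ([seq x <- iota 3 n.-2 | ~~ odd x] ++ [:: c]) (odds ++ v2) c nz2.1) => //.
  - by rewrite EL2; cats.
  - by rewrite inE mem_odds; move: hc; clear; lia.
  - by rewrite mem_cat mem_filter mem_iota inE; move: hc; clear; lia.
  - exact: mem_head.
  - by rewrite mem_cat mem_head orbT.
have [|cs [e3 pcs acs]] := IH _ _ _ _ nz2 fw2 hd.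
  apply: leq_trans sz; have := perm_size (ceq_perm e1); have := perm_size (ceq_perm e2).
  rewrite !size_cat /= => -> ->; rewrite EL2 /=; clear; lia.
exists (d :: cs); split; rewrite /= ?cd ?hd //=.
rewrite -catA; apply: ceq_trans e1 _; apply: ceq_catl; apply: ceq_trans e2 _.
exact: ceq_catl.
Qed.

Lemma forkless_candy w : forkless w -> full w -> exists c cs,
  [/\ ceq w (candy_word c cs), path (fun x y => x != y) c cs, all (fun x => x <= 1) (c :: cs)
    & cs != [::]].
Proof.
move=> nz fw.
have [||c [v [hc e]]] := @peel_odd w (full_even nz fw).
- by move=> x xv; apply: (irr_le nz.1).
(* Both sides occur before the first [i]: this is [full_sink] at the last [i] of the reversed
   word. *)
- move=> i hi oi; have iw : i \in w by apply: fw.1; move: hi; clear; lia.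
  have Ei := pre_split iw.
  have := @full_sink (rev w) i (forkless_rev nz) (full_rev fw) hi oi (rev (post i w)) (rev (pre i w)).
  rewrite {1}Ei rev_cat rev_cons cat_rcons => /(_ erefl).
  by rewrite pre_id ?mem_rev ?pre_notin // has_rev.
have nz' := forkless_ceq e nz; have fw' := full_ceq e fw.
have [cs [e' pcs acs]] := @candy_tail [::] c v nz' fw' hc.
exists c, cs; split => //; first exact: ceq_trans e (ceq_catl _ e').
  by rewrite /= hc.
apply/eqP => cs0; rewrite cs0 /= in e'.
have := full_2 fw'; by rewrite mem_cat (ceq_mem e') inE mem_odds (gtn_eqF (hc : c < 2)).
Qed.

End Candy.

(** * Words in a Coxeter system *)

Section Length.
Variables (T : finType) (M : T -> T -> nat) (W : coxeterSystem M).
Hypothesis M1 : forall s, M s s = 1%N.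
Implicit Types (x y : W) (s t : T) (w : seq T).
Local Notation crst := (clos_refl_sym_trans (seq T) (comm_step M)).
Local Notation gn := (gen W).
Local Open Scope group_scope.

Lemma ev_cat w w' : ev W (w ++ w') = ev W w * ev W w'.
Proof. by rewrite /ev big_cat. Qed.

Lemma ev_cons s w : ev W (s :: w) = gn s * ev W w.
Proof. by rewrite /ev big_cons. Qed.

Lemma ev_seq1 s : ev W [:: s] = gn s.
Proof. by rewrite /ev big_seq1. Qed.

Lemma ev_relator s t : ev W (flatten (nseq (M s t) [:: s; t])) = 1.
Proof.
have -> : 1 = ev W [::] by rewrite /ev big_nil.
apply/gen_presentation/rst_step.
by have := @RelatorStep T M [::] [::] s t; rewrite cats0.
Qed.

Lemma gen_sq s : gn s * gn s = 1.
Proof. by have := ev_relator s s; rewrite M1 /= !ev_cons /ev big_nil mulg1. Qed.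

Lemma gen_mulK s x : gn s * (gn s * x) = x.
Proof. by rewrite mulgA gen_sq mul1g. Qed.

Lemma mulg_genK s x : x * gn s * gn s = x.
Proof. by rewrite -mulgA gen_sq mulg1. Qed.

Lemma ev_rev w : ev W w * ev W (rev w) = 1.
Proof.
elim: w => [|s w IH]; first by rewrite /ev big_nil mulg1.
by rewrite rev_cons -cats1 ev_cat ev_cons ev_seq1 mulgA -(mulgA (gn s)) IH mulg1 gen_sq.
Qed.

(** Turns a relator into the corresponding braid relation, the second half being inverted by
    reversal. *)
Lemma ev_split p q : ev W (p ++ q) = 1 -> ev W p = ev W (rev q).
Proof. by rewrite ev_cat => h; rewrite -[LHS]mulg1 -(ev_rev q) mulgA h mul1g. Qed.

Lemma ev_comm s t : M s t = 2%N -> ev W [:: s; t] = ev W [:: t; s].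
Proof. by move=> m; have := ev_relator s t; rewrite m => /(@ev_split [:: s; t] [:: s; t]). Qed.

Lemma ev_braid3 s t : M s t = 3%N -> ev W [:: s; t; s] = ev W [:: t; s; t].
Proof. by move=> m; have := ev_relator s t; rewrite m => /(@ev_split [:: s; t; s] [:: t; s; t]). Qed.

Lemma ev_braid4 s t : M s t = 4%N -> ev W [:: s; t; s; t] = ev W [:: t; s; t; s].
Proof.
by move=> m; have := ev_relator s t; rewrite m => /(@ev_split [:: s; t; s; t] [:: s; t; s; t]).
Qed.

Lemma comm_ev w w' : crst w w' -> ev W w = ev W w'.
Proof.
elim=> [_ _ [u v s t st]|//|w1 w2 _ ->//|w1 w2 w3 _ -> _ ->//].
by rewrite !ev_cat ev_comm.
Qed.

Lemma comm_size w w' : crst w w' -> size w = size w'.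
Proof.
elim=> [_ _ [u v s t st]|//|w1 w2 _ ->//|w1 w2 w3 _ -> _ ->//].
by rewrite !size_cat.
Qed.

Lemma comm_reduced w w' x : crst w w' -> reduced w x -> reduced w' x.
Proof. by move=> e [<- sz]; split; rewrite -?(comm_ev e) // -(comm_size e). Qed.

Lemma ell_le w : (ell (ev W w) <= size w)%N.
Proof.
rewrite /ell; case: ex_minnP => m _ H; apply: H; apply/asboolP; by exists w.
Qed.

Lemma ex_reduced x : exists w, reduced w x.
Proof.
rewrite /reduced /ell; case: ex_minnP => m /asboolP[w wx sw] _; by exists w.
Qed.

Lemma ell_genl s x : (ell (gn s * x) <= (ell x).+1)%N.
Proof. by have [w [<- sw]] := ex_reduced x; rewrite -ev_cons (leq_trans (ell_le _)) //= sw. Qed.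

Lemma ell_genr s x : (ell (x * gn s) <= (ell x).+1)%N.
Proof.
have [w [<- sw]] := ex_reduced x; rewrite -ev_seq1 -ev_cat.
by rewrite (leq_trans (ell_le _)) // size_cat addn1 sw.
Qed.

Lemma reduced_cons s w x : reduced (s :: w) x <-> reduced w (gn s * x) /\ DL x s.
Proof.
split=> [[<- /= sw]|[[ew sw] lt]].
  have l1 := ell_le w; have l2 := ell_genl s (ev W w).
  have E : gn s * ev W (s :: w) = ev W w by rewrite ev_cons gen_mulK.
  have sz : size w = ell (ev W w).
    by apply/eqP; rewrite eqn_leq l1 andbT -ltnS sw ev_cons.
  by split; [split; rewrite E | rewrite /DL /= E -sz -sw].
split; first by rewrite ev_cons ew gen_mulK.
rewrite /= sw; apply/eqP; rewrite eqn_leq lt /=.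
by have := ell_genl s (gn s * x); rewrite gen_mulK.
Qed.

Lemma reduced_rcons s w x : reduced (rcons w s) x <-> reduced w (x * gn s) /\ DR x s.
Proof.
have ev_rcons : ev W (rcons w s) = ev W w * gn s by rewrite -cats1 ev_cat ev_seq1.
split=> [[<- /= sw]|[[ew sw] lt]].
  have l1 := ell_le w; have l2 := ell_genr s (ev W w).
  have E : ev W (rcons w s) * gn s = ev W w by rewrite ev_rcons mulg_genK.
  rewrite size_rcons in sw.
  have sz : size w = ell (ev W w).
    by apply/eqP; rewrite eqn_leq l1 andbT -ltnS sw ev_rcons.
  by split; [split; rewrite E | rewrite /DR /= E -sz -sw].
split; first by rewrite ev_rcons ew mulg_genK.
rewrite size_rcons sw; apply/eqP; rewrite eqn_leq lt /=.
by have := ell_genr s (x * gn s); rewrite mulg_genK.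
Qed.

Lemma DLP x s : DL x s <-> exists w, reduced (s :: w) x.
Proof.
split=> [h|[w /reduced_cons[]//]].
by have [w hw] := ex_reduced (gn s * x); exists w; apply/reduced_cons.
Qed.

Lemma DRP x s : DR x s <-> exists w, reduced (rcons w s) x.
Proof.
split=> [h|[w /reduced_rcons[]//]].
by have [w hw] := ex_reduced (x * gn s); exists w; apply/reduced_rcons.
Qed.

Lemma left_starP x s t : left_star_reducible x s t <->
  (3 <= M s t)%N /\ exists w, reduced (s :: t :: w) x.
Proof.
split=> [[h1 /DLP[w hw] m]|[m [w /reduced_cons[hw h1]]]]; last first.
  by split=> //; apply/DLP; exists w.
by split=> //; exists w; apply/reduced_cons.
Qed.

Lemma right_starP x s t : right_star_reducible x s t <->
  (3 <= M s t)%N /\ exists w, reduced (rcons (rcons w t) s) x.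
Proof.
split=> [[h1 /DRP[w hw] m]|[m [w /reduced_rcons[hw h1]]]]; last first.
  by split=> //; apply/DRP; exists w.
by split=> //; exists w; apply/reduced_rcons.
Qed.

Lemma ev_swap_size w w' x : reduced w x -> ev W w' = ev W w -> size w' = size w ->
  reduced w' x.
Proof. by move=> [ew sw] e s; split; [rewrite e | rewrite s]. Qed.

Lemma not_reduced_sq a s b x : ~ reduced (a ++ s :: s :: b) x.
Proof.
move=> [ex sz]; have E : ev W (a ++ b) = x.
  by rewrite -ex !ev_cat !ev_cons gen_mulK.
have := ell_le (a ++ b); rewrite E -sz !size_cat /= !addnS; lia.
Qed.

End Length.

(** * From generators of type B to words of natural numbers *)

Section TypeBWords.
Variable n : nat.
Hypothesis hn : 2 <= n.
Variable W : coxeterSystem (mB n).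
Local Notation T := 'I_n.+2.
Local Notation N := n.+1.
Implicit Types (x : W) (s t : T) (w : seq T) (z : seq nat).
Local Notation crst := (clos_refl_sym_trans (seq T) (comm_step (mB n))).

Lemma mB_val s t : mB n s t =
  if s == t then 1%N else if spec n s t then 4 else if adj s t then 3 else 2.
Proof.
have hs := ltn_ord s; have ht := ltn_ord t; rewrite -val_eqE /= /mB /minn /maxn /spec /adj /adj1.
move: (nat_of_ord s) (nat_of_ord t) hs ht hn; clear => a b ha hb h.
have [ab|ab|->] := ltngtP a b; last by rewrite eqxx.
  rewrite (ltn_eqF ab).
  have -> : (a == n) && (b == N) || (a == N) && (b == n) = (a == n) && (b == N) by lia.
  by case E: (_ && _) => //; congr (if _ then _ else _); lia.
rewrite (ltn_eqF ab).
have -> : (a == n) && (b == N) || (a == N) && (b == n) = (b == n) && (a == N) by lia.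
by case E: (_ && _) => //; congr (if _ then _ else _); lia.
Qed.

Lemma spec_adj a b : spec n a b -> adj a b.
Proof. by move: hn; rewrite /spec /adj /adj1; clear; lia. Qed.

Lemma adj_ne a b : adj a b -> a != b.
Proof. by rewrite /adj /adj1; clear; lia. Qed.

Lemma mB_diag s : mB n s s = 1%N.
Proof. by rewrite mB_val eqxx. Qed.

Lemma mB_dep s t : (mB n s t == 2) = ~~ dep s t.
Proof.
rewrite mB_val /dep val_eqE; have [//|st] := eqVneq s t.
by have [/spec_adj->|_] := boolP (spec n s t); last case: (adj s t).
Qed.

Lemma mB_adj s t : (3 <= mB n s t) = adj s t.
Proof.
rewrite mB_val; have [->|st] := eqVneq s t.
  by apply/esym/negP => /adj_ne; rewrite eqxx.
by have [/spec_adj->|_] := boolP (spec n s t); last case: (adj s t).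
Qed.

Definition nat_word w : seq nat := map val w.
Definition ord_word z : seq T := map inord z.

Lemma nat_wordK w : ord_word (nat_word w) = w.
Proof. by rewrite /ord_word /nat_word -map_comp map_id_in // => s _ /=; rewrite inord_val. Qed.

Lemma ord_wordK z : {in z, forall a, a <= N} -> nat_word (ord_word z) = z.
Proof.
by move=> h; rewrite /ord_word /nat_word -map_comp map_id_in // => a az /=; rewrite inordK ?ltnS ?h.
Qed.

Lemma nat_word_le w : {in nat_word w, forall a, a <= N}.
Proof. by move=> a /mapP[s _ ->]; rewrite -ltnS ltn_ord. Qed.

Lemma mem_nat_word w s : (nat_of_ord s \in nat_word w) = (s \in w).
Proof. exact: (mem_map val_inj). Qed.

Lemma crst_ceq w w' : crst w w' -> ceq (nat_word w) (nat_word w').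
Proof.
elim=> [_ _ [u v s t st]|w1|w1 w2 _|w1 w2 w3 _ + _].
- rewrite /nat_word !map_cat /=; apply: ceq_swap; last exact: ceq_refl.
  by rewrite -mB_dep st.
- exact: ceq_refl.
- exact: ceq_sym.
- exact: ceq_trans.
Qed.

Lemma ceq_crst z z' : ceq z z' -> {in z, forall a, a <= N} -> crst (ord_word z) (ord_word z').
Proof.
elim=> [z0|u a b v z0 ab _ IH] le; first exact: rst_refl.
have {}IH : crst (ord_word (u ++ b :: a :: v)) (ord_word z0).
  apply: IH => c; rewrite mem_cat !inE => h; apply: le; rewrite mem_cat !inE.
  by move: h => /or4P[->|->|->|->]; rewrite ?orbT.
apply: rst_trans IH; apply: rst_step; rewrite /ord_word !map_cat /=.
have aN : a < n.+2 by rewrite ltnS; apply: le; rewrite mem_cat mem_head orbT.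
have bN : b < n.+2 by rewrite ltnS; apply: le; rewrite mem_cat !inE eqxx !orbT.
apply: (@CommStep _ (mB n) (ord_word u) (ord_word v) (inord a) (inord b)).
by apply/eqP; rewrite mB_dep !inordK.
Qed.

Lemma reduced_ceq w x z : reduced w x -> ceq (nat_word w) z -> reduced (ord_word z) x /\ nat_word (ord_word z) = z.
Proof.
move=> red_word e; split.
  by apply: (comm_reduced mB_diag) red_word; have := ceq_crst e (@nat_word_le w); rewrite nat_wordK.
by apply: ord_wordK => a; rewrite -(ceq_mem e); apply: nat_word_le.
Qed.

Lemma reduced_ceq_ow w x z : reduced w x -> ceq (nat_word w) z -> reduced (ord_word z) x.
Proof. by move=> red_word /(reduced_ceq red_word)[]. Qed.

Lemma FC_ceq x w w' : FC W x -> reduced w x -> reduced w' x -> ceq (nat_word w) (nat_word w').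
Proof. by move=> fc r r'; apply/crst_ceq/fc. Qed.

(** A braid move on [s t s] or [s t s t] would give another reduced word outside the commutation
    class: the number of letters [s] changes in the first case, the subword on [s] and [t] in the
    second. The last two fields are star irreducibility. *)
Lemma star_irr x w : star_irreducible W x -> reduced w x -> irr n (nat_word w).
Proof.
move=> [fc st] red_word.
have bnd z a : ceq (nat_word w) z -> a \in z -> nat_of_ord (inord a : T) = a.
  by move=> e az; rewrite inordK // ltnS; apply: (@nat_word_le w); rewrite (ceq_mem e).
split.
- exact: nat_word_le.
- move=> a s b e; have := reduced_ceq_ow red_word e; rewrite /ord_word map_cat /=.
  exact: (not_reduced_sq mB_diag).
- move=> a s t b ast nst e; have r1 := reduced_ceq_ow red_word e.
  have vs := bnd _ s e ltac:(by rewrite mem_cat !inE eqxx !orbT).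
  have vt := bnd _ t e ltac:(by rewrite mem_cat !inE eqxx !orbT).
  have m3 : mB n (inord s) (inord t) = 3.
    rewrite mB_val -val_eqE /= vs vt (negPf (adj_ne ast)) (negPf nst) ast //.
  have r2 : reduced (ord_word (a ++ [:: t, s, t & b])) x.
    apply: ev_swap_size r1 _ _; last by rewrite /ord_word !size_map !size_cat.
    rewrite -[a ++ [:: t, s, t & b]]/(a ++ [:: t; s; t] ++ b).
    rewrite -[a ++ [:: s, t, s & b]]/(a ++ [:: s; t; s] ++ b) /ord_word !map_cat !ev_cat.
    by congr (_ * (_ * _))%g; apply/esym; exact: ev_braid3 mB_diag _ _ m3.
  have := FC_ceq fc r1 r2; rewrite (reduced_ceq red_word e).2 ord_wordK; last first.
    move=> c; rewrite mem_cat !inE => h; apply: (@nat_word_le w); rewrite (ceq_mem e) mem_cat !inE.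
    by case/orP: h => [->//|/or4P[] ->]; rewrite ?orbT.
  move/ceq_perm/seq.permP/(_ (pred1 s)); rewrite !count_cat /= eqxx.
  by rewrite (negPf (adj_ne (etrans (adjC t s) ast))); clear; lia.
- move=> a s t b st' e; have r1 := reduced_ceq_ow red_word e; have ast := spec_adj st'.
  have vs := bnd _ s e ltac:(by rewrite mem_cat !inE eqxx !orbT).
  have vt := bnd _ t e ltac:(by rewrite mem_cat !inE eqxx !orbT).
  have m4 : mB n (inord s) (inord t) = 4.
    by rewrite mB_val -val_eqE /= vs vt (negPf (adj_ne ast)) st'.
  have r2 : reduced (ord_word (a ++ [:: t, s, t, s & b])) x.
    apply: ev_swap_size r1 _ _; last by rewrite /ord_word !size_map !size_cat.
    rewrite -[a ++ [:: t, s, t, s & b]]/(a ++ [:: t; s; t; s] ++ b).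
    rewrite -[a ++ [:: s, t, s, t & b]]/(a ++ [:: s; t; s; t] ++ b) /ord_word !map_cat !ev_cat.
    by congr (_ * (_ * _))%g; apply/esym; exact: ev_braid4 mB_diag _ _ m4.
  have := FC_ceq fc r1 r2; rewrite (reduced_ceq red_word e).2 ord_wordK; last first.
    move=> c; rewrite mem_cat !inE => h; apply: (@nat_word_le w); rewrite (ceq_mem e) mem_cat !inE.
    by case/orP: h => [->//|/orP[->|/or4P[] ->]]; rewrite ?orbT.
  have dst : dep s t by rewrite /dep ast orbT.
  move/(ceq_filter dst); rewrite !filter_cat /= !eqxx !orbT /= => /eqP.
  by rewrite eqseq_cat // eqxx eqseq_cons (negPf (adj_ne ast)).
- move=> s t b ast e; have r1 := reduced_ceq_ow red_word e.
  have vs := bnd _ s e ltac:(by rewrite !inE eqxx).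
  have vt := bnd _ t e ltac:(by rewrite !inE eqxx !orbT).
  have [+ _] := st (inord s) (inord t); apply; apply/(left_starP mB_diag).
  by rewrite mB_adj vs vt; split=> //; exists (ord_word b).
- move=> a s t ast e; have r1 := reduced_ceq_ow red_word e.
  have vs := bnd _ s e ltac:(by rewrite mem_cat !inE eqxx !orbT).
  have vt := bnd _ t e ltac:(by rewrite mem_cat !inE eqxx !orbT).
  have [_ +] := st (inord t) (inord s); apply; apply/(right_starP mB_diag).
  rewrite mB_adj vs vt adjC; split=> //; exists (ord_word a).
  by move: r1; rewrite /ord_word map_cat -!cats1 -catA.
Qed.

(* Toggling the colour of a node according to its neighbours: the affine
   reflection representation reduced modulo 2.  The Cartan matrix has an entry
   -2 at (n+1, n), hence the missing coefficient there. *)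
Definition coef s t := adj s t && (nat_of_ord s != N).
Definition nb (g : T -> bool) s := \big[addb/false]_(t : T) (coef s t && g t).
Definition act s (g : T -> bool) : T -> bool := fun t => if t == s then ~~ (g s (+) nb g s) else g t.
Definition actw w g := foldr act g w.

(** Isolates the two colours that a rank two relator changes, so that the relator becomes a Boolean
    identity in these colours and in the contributions of the other nodes. *)
Definition put s t (g : T -> bool) b c : T -> bool :=
  fun u => if u == s then b else if u == t then c else g u.

Lemma nb_put s t g b c : s != t ->
  nb (put s t g b c) s = (coef s t && c) (+) \big[addb/false]_(u | u != t) (coef s u && g u).
Proof.
move=> st; rewrite /nb (bigD1 t) //= /put eqxx eq_sym (negPf st); congr (_ (+) _).
apply: eq_bigr => u ut; rewrite (negPf ut); case: eqP => // ->.
have -> // : coef s s = false.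
by rewrite /coef; apply/negP => /andP[/adj_ne]; rewrite eqxx.
Qed.

Lemma putC s t g b c : s != t -> put s t g b c = put t s g c b.
Proof.
move=> st; apply: funext => u; rewrite /put; case: (eqVneq u s) => [->|//].
by rewrite (negPf st).
Qed.

Lemma act_put s t g b c : s != t ->
  act s (put s t g b c) =
  put s t g (~~ (b (+) ((coef s t && c) (+) \big[addb/false]_(u | u != t) (coef s u && g u)))) c.
Proof.
move=> st; apply: funext => u; rewrite /act nb_put //.
by rewrite {1 3}/put eqxx; case: (eqVneq u s) => // us; rewrite /put (negPf us).
Qed.

Lemma act_put' s t g b c : s != t ->
  act t (put s t g b c) =
  put s t g b (~~ (c (+) ((coef t s && b) (+) \big[addb/false]_(u | u != s) (coef t u && g u)))).
Proof. by move=> st; rewrite putC // act_put 1?eq_sym // putC // eq_sym. Qed.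

Lemma put_id s t g : g = put s t g (g s) (g t).
Proof. by apply: funext => u; rewrite /put; do 2![case: eqP => [->//|_]]. Qed.

Lemma act_sq s g : act s (act s g) = g.
Proof.
have nbE : nb (act s g) s = nb g s.
  apply: eq_bigr => t _; rewrite /act; case: eqP => // ->.
  have -> // : coef s s = false.
  by rewrite /coef; apply/negP => /andP[/adj_ne]; rewrite eqxx.
apply: funext => u; rewrite {1}/act nbE /act eqxx; case: eqP => // ->.
by case: (g s); case: (nb g s).
Qed.

Lemma actw_relator s t g : actw (flatten (nseq (mB n s t) [:: s; t])) g = g.
Proof.
rewrite mB_val; have [->|st] := eqVneq s t; first exact: act_sq.
rewrite (put_id s t g); have cst : coef s t = adj s t && (nat_of_ord s != N) by [].
have cts : coef t s = adj s t && (nat_of_ord t != N) by rewrite /coef adjC.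
(* An edge has order 4 exactly when one end is [n+1], that is, when just one of its two coefficients
   vanishes. *)
have sN : spec n s t = adj s t && ((nat_of_ord s == N) || (nat_of_ord t == N)).
  have := ltn_ord s; have := ltn_ord t; move: hn; rewrite /spec /adj /adj1; clear; lia.
have nN : ~~ ((nat_of_ord s == N) && (nat_of_ord t == N)).
  by move: st; rewrite -val_eqE /=; clear; lia.
rewrite sN; move: cst cts nN.
case: (adj s t) => /=; case: (nat_of_ord s == N) => /=; case: (nat_of_ord t == N) => //= cst cts _;
  rewrite !(act_put, act_put') // cst cts;
  set p := \big[_/_]_(_ | _ != t) _; set q := \big[_/_]_(_ | _ != s) _;
  by congr (put _ _ _ _ _); case: (g s); case: (g t); case: p; case: q.
Qed.

Lemma actw_cat w w' g : actw (w ++ w') g = actw w (actw w' g).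
Proof. exact: foldr_cat. Qed.

Lemma actw_inv w w' g : ev W w = ev W w' -> actw w g = actw w' g.
Proof.
move=> /gen_presentation e; elim: e g => [_ _ [u v s t]|//|w1 w2 _ IH g|w1 w2 w3 _ IH1 _ IH2 g].
- by move=> g; rewrite !actw_cat actw_relator.
- by rewrite IH.
- by rewrite IH1.
Qed.

Lemma actw_notin w s : s \notin w -> actw w (fun=> false) s = false.
Proof.
elim: w => //= t w IH; rewrite inE negb_or => /andP[st sw].
by rewrite /act (negPf st) IH.
Qed.

Definition commuting w := uniq w && pairwise (fun s t => mB n s t == 2) w.

(** The nodes already coloured commute with the next letter and contribute nothing, so the constant
    of the affine action simply colours its node. *)
Lemma actw_commuting w : commuting w -> actw w (fun=> false) = (fun t => t \in w).
Proof.
elim: w => [_|s w IH /andP[/= /andP[sw uw] /andP[/allP sc cw]]]; first exact: funext.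
have cw' : commuting w by rewrite /commuting uw.
rewrite /= IH //; apply: funext => t; rewrite /act /= inE.
case: eqP => //= _; rewrite (negPf sw) /nb big1 // => u _.
case uw' : (u \in w); last by rewrite andbF.
by have := sc u uw'; rewrite mB_dep /coef /dep negb_or => /andP[_ /negPf->].
Qed.

(** Both words act alike on the empty colouring, and a word without [s] leaves [s] uncoloured. *)
Lemma commuting_sub w w' : commuting w -> ev W w = ev W w' -> {subset w <= w'}.
Proof.
move=> cw e s sw; apply/negPn/negP => sw'.
have := congr1 (fun f => f s) (actw_inv (fun=> false) e).
by rewrite /= (actw_notin sw') actw_commuting // sw.
Qed.

Lemma commuting_reduced w w' x : commuting w -> ev W w = x -> reduced w' x ->
  size w' = size w /\ w =i w'.
Proof.
move=> cw e [e' sz].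
have [|||sz' me] := @uniq_min_size _ w w'; last by split.
- by case/andP: cw.
- by apply: commuting_sub cw _; rewrite e'.
- by rewrite sz -e ell_le.
Qed.

Lemma commuting_nat_word w : commuting w = uniq (nat_word w) && pairwise (fun a b => ~~ dep a b) (nat_word w).
Proof.
rewrite /commuting (map_inj_uniq val_inj) pairwise_map; congr (_ && _).
by apply: eq_pairwise => s t; rewrite mB_dep.
Qed.

End TypeBWords.

(** * The three kinds of irreducible words and their possible first letters *)

Section Words.
Variable n : nat.
Hypothesis hn : 2 <= n.
Implicit Types z v : seq nat.
Local Notation N := n.+1.

Definition commuting_word z := uniq z && pairwise (fun a b => ~~ dep a b) z.

Lemma not_uniq_split z : ~~ uniq z -> exists a i g c, z = a ++ i :: g ++ i :: c /\ i \notin g.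
Proof.
elim: z => //= x z IH; rewrite negb_and negbK => /orP[xz|/IH[a [i [g [c [-> ig]]]]]].
  by exists [::], x, (pre x z), (post x z); rewrite /= -(pre_split xz) pre_notin.
by exists (x :: a), i, g, c.
Qed.

Lemma nonadj_commuting_word z : uniq z -> {in z &, forall a b, ~~ adj a b} -> commuting_word z.
Proof.
rewrite /commuting_word => uz; rewrite uz; elim: z uz => //= x z IH /andP[xz uz] H.
rewrite IH // ?andbT => [|a b az bz]; last by apply: H; rewrite inE ?az ?bz orbT.
apply/allP => y yz; rewrite /dep negb_or H ?mem_head ?inE ?yz ?orbT // andbT.
by apply: contraNneq xz => ->.
Qed.

Lemma commuting_word_nonadj z : commuting_word z -> {in z &, forall a b, ~~ adj a b}.
Proof.
elim: z => // x z IH /andP[/= /andP[xz uz] /andP[/allP xa pz]] a b.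
have {}IH := IH (introT andP (conj uz pz)).
rewrite !inE => /predU1P[->|az] /predU1P[->|bz].
- by apply/negP => /adj_ne; rewrite eqxx.
- by have := xa b bz; rewrite negb_or => /andP[].
- by have := xa a az; rewrite adjC negb_or => /andP[].
- exact: IH.
Qed.

Lemma commuting_word_perm z z' : perm_eq z z' -> commuting_word z -> commuting_word z'.
Proof.
move=> e cz; apply: nonadj_commuting_word => [|a b]; first by rewrite -(perm_uniq e); case/andP: cz.
by rewrite -!(perm_mem e); apply: commuting_word_nonadj.
Qed.

Lemma commuting_word_ceq z z' : perm_eq z z' -> commuting_word z -> ceq z' z.
Proof.
move=> e cz; have /andP[uz pz] := cz; have cz' := commuting_word_perm e cz.
have [x xz|v' e'] := front_list uz pz (v := z').
  split; first by rewrite -(perm_mem e).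
  apply/hasPn => y yp; rewrite /dep negb_or; apply/andP; split.
    by apply/eqP => xy; move: yp; rewrite -xy (negPf (pre_notin _ _)).
  by apply: (commuting_word_nonadj cz'); rewrite -?(perm_mem e) // (perm_mem e) (pre_sub yp).
have := perm_size (ceq_perm e'); rewrite size_cat -(perm_size e) -[LHS]addn0.
by move/addnI => v0; move: e'; case: v' v0 => // _; rewrite cats0.
Qed.

Definition zigzag_word k := [:: 0, 1 & flatten (nseq k (iota 2 n ++ rev (iota 0 N)))].

Lemma ceq_01 v : ceq [:: 1, 0 & v] [:: 0, 1 & v].
Proof. by apply: (@ceq_swap [::] 1 0) (ceq_refl _). Qed.

Lemma zig_zigzag_word r : ceq (zig n r) (zigzag_word r).
Proof.
have EQ : iota 2 n ++ rev (iota 0 N) = (iota 2 n ++ descent n 2) ++ [:: 1; 0].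
  rewrite /descent -catA; congr (_ ++ _).
  rewrite -[LHS]/(rev (iota 0 N)) -{1}(subnKC (leqW hn)) iotaD rev_cat; exact: erefl.
rewrite /zig /zigzag_word EQ /period /ascent /=; move: (_ ++ descent n 2) => Q {EQ}.
elim: r => [|r IH] /=; first exact: ceq_refl.
do 2!apply: ceq_cons; rewrite -2!catA; apply: ceq_catl; apply: ceq_trans IH _.
exact: ceq_sym (ceq_01 _).
Qed.

Lemma rev_zigzag_word r : rev (zigzag_word r) = flatten (nseq r (period n)) ++ [:: 1; 0].
Proof.
rewrite -[zigzag_word r]/([:: 0; 1] ++ flatten _) rev_cat rev_flatten map_nseq rev_nseq.
congr (flatten (nseq _ _) ++ _).
rewrite rev_cat revK /period /ascent /descent.
have E m : iota 0 m.+2 ++ rev (iota 2 m.+1) = [:: 0, 1 & iota 2 m.+1] ++ rev (iota 2 (m.+2 - 2)).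
  have -> : iota 2 m.+1 = iota 2 m ++ [:: m.+2] by rewrite -{1}(addn1 m) iotaD.
  by rewrite rev_cat !subSS subn0 /= -catA.
by have := E n.-1; rewrite (ltn_predK hn).
Qed.

(** A zigzag is a palindrome up to exchanging 0 and 1, so statements about its right end follow from
    those about its left end. *)
Lemma zigzag_word_rev r : ceq (rev (zigzag_word r)) (zigzag_word r).
Proof.
rewrite rev_zigzag_word; apply: ceq_trans (zig_zigzag_word r); apply: ceq_catl.
exact: ceq_01.
Qed.

Lemma irr_cases z : irr n z -> [\/ commuting_word z, exists2 r, 0 < r & ceq z (zigzag_word r) |
  ~~ odd n /\ exists c cs, [/\ ceq z (candy_word n c cs), path (fun x y => x != y) c cs,
    all (fun x => x <= 1) (c :: cs) & cs != [::]]].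
Proof.
move=> iz; have [[w' [e h]]|n1] := pselect (exists w', ceq z w' /\ fork_end (rev w')).
  apply: Or32; have [r r0 e'] := fork_end_zigzag hn (irr_ceq e iz) h.
  by exists r => //; apply: ceq_trans e (ceq_trans e' (zig_zigzag_word r)).
have [[w' [e h]]|n2] := pselect (exists w', ceq z w' /\ fork_end w').
  apply: Or32; rewrite -(revK w') in h.
  have [r r0 e'] := fork_end_zigzag hn (irr_rev (irr_ceq e iz)) h.
  exists r => //; apply: ceq_trans e _; rewrite -(revK w').
  apply: ceq_trans (zigzag_word_rev r); apply: ceq_rev.
  exact: ceq_trans e' (zig_zigzag_word r).
have nz : forkless n z.
  by split=> // w' e; split=> h; [apply: n2 | apply: n1]; exists w'.
have [fz|nf] := pselect (full n z).
  by apply: Or33; split; [exact: full_even nz fz | exact: forkless_candy].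
have na : {in z &, forall a b, ~~ adj a b}.
  by move=> a b az bz; apply/negP => ab; apply: nf; apply: forkless_full nz az bz ab.
apply: Or31; apply: nonadj_commuting_word => //; apply/negPn/negP => /not_uniq_split[a [i [g [c [E ig]]]]].
have /hasP[y yg iy] := gap1' iz E ig.
have := na i y; rewrite iy E; mems; rewrite eqxx yg !orbT => /(_ isT isT).
by [].
Qed.

(** The subword on [r] and [t] begins with [r] on one side and with [t] on the other. A second
    neighbour of [t] ahead of it thus prevents the star reduction by [s] with respect to [t]. *)
Lemma two_first v z' (r t s : nat) v' : r \in v -> t \notin v -> adj r t -> r != s ->
  ceq (v ++ z') [:: s, t & v'] -> False.
Proof.
move=> rv tv rt rs e; have drt : dep r t by rewrite /dep rt orbT.
have := ceq_filter drt e; rewrite filter_cat /= [s == r]eq_sym (negPf rs) eqxx orbT /=.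
have : r \in filter (pred2 r t) v by rewrite mem_filter /= eqxx.
have : t \notin filter (pred2 r t) v by rewrite mem_filter (negPf tv) andbF.
case: (filter _ v) => //= x v0; rewrite inE negb_or => /andP[/negPf tx _] _.
by case: eqP => [st|_] [xt _]; move: tx; rewrite xt ?st eqxx.
Qed.

(** In the first ascent, 2 is preceded by 0 and any [s > 2] by [s - 1]. *)
Lemma zigzag_word_first k s v : 0 < k -> ceq (s :: v) (zigzag_word k) -> s <= 1.
Proof.
move=> k0 /front_inv[sz sp]; rewrite leqNgt; apply/negP => s1.
have le : s <= N.
  move: sz; rewrite !inE => /or3P[/eqP->|/eqP->|] //.
  move=> /flattenP[w /nseqP[-> _]]; rewrite mem_cat mem_rev !mem_iota; move: hn; clear; lia.
have [k' Ek] : exists v', zigzag_word k = [:: 0, 1 & iota 2 n] ++ v'.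
  by case: k k0 {sz sp} => // k _; exists (rev (iota 0 N) ++ flatten (nseq k (iota 2 n ++ rev (iota 0 N)))); rewrite /zigzag_word /= -catA.
have Es : iota 2 n = iota 2 (s - 2) ++ s :: iota s.+1 (N - s).
  have {1}-> : n = (s - 2) + (N - s).+1 by move: s1 le; clear; lia.
  by rewrite iotaD subnKC.
have Ep : pre s (zigzag_word k) = [:: 0, 1 & iota 2 (s - 2)].
  rewrite Ek Es -[[:: 0, 1 & _]]/([:: 0, 1 & iota 2 (s - 2)] ++ s :: iota s.+1 (N - s)) -catA /=.
  rewrite -[[:: 0, 1 & _]]/([:: 0, 1 & iota 2 (s - 2)] ++ s :: (iota s.+1 (N - s) ++ k')).
  by apply: pre_head; rewrite !inE mem_iota; move: s1; clear; lia.
move: sp; rewrite Ep => /hasPn h.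
have [s2|s2] := leqP s 2.
  have := h 0 (mem_head _ _); rewrite /dep /adj /adj1; move: s1 s2; clear; lia.
have /h : s.-1 \in [:: 0, 1 & iota 2 (s - 2)] by rewrite !inE mem_iota; move: s2; clear; lia.
by rewrite /dep /adj /adj1; move: s2; clear; lia.
Qed.

(** Only the set of letters is prescribed, since the factors of a normal form come with arbitrary
    reduced words. *)
Definition odd_layer c (v : seq nat) := forall a, (a \in v) = (a == c) || odd a && (3 <= a <= N).
Definition even_layer (v : seq nat) := forall a, (a \in v) = ~~ odd a && (2 <= a <= n).

(** A letter outside the first layer is even, with a neighbour in that layer, or it is the other
    leaf, with the 2 of the second layer ahead of it. *)
Lemma layer_first c v1 v2 v s v' : ~~ odd n -> c <= 1 -> odd_layer c v1 -> even_layer v2 ->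
  s <= N -> ceq (s :: v') (v1 ++ v2 ++ v) -> s \in v1.
Proof.
move=> en hc h1 h2 sN /front_inv[sz sp]; apply/negPn/negP => sv.
have h r : r \in v1 -> adj s r -> False.
  move=> rv sr; move/hasPn/(_ r): sp; rewrite pre_cat // mem_cat rv /dep sr orbT.
  by move=> /(_ isT).
have [s1|s1] := leqP s 1.
  have s2 : s \notin v2 by rewrite h2; move: s1; clear; lia.
  have s12 : s \notin v1 ++ v2 by rewrite mem_cat negb_or sv.
  have ds : dep s 2 by rewrite /dep adjC adj_2 // orbT.
  by move/hasPn/(_ 2): sp; rewrite catA pre_cat // ds !mem_cat h2 hn orbT => /(_ isT).
have os : ~~ odd s.
  apply: contra sv => os; rewrite h1 os sN.
  by have -> : 3 <= s by [move: s1 os; clear; case: s => [|[|[|]]]]; rewrite orbT.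
have sn : s <= n by move: sN; rewrite leq_eqVlt => /predU1P[sE|//]; move: os; rewrite sE /= en.
by apply: (h s.+1); rewrite ?h1 ?adj_succ //= os !ltnS s1 sn orbT.
Qed.

(** The even label [t] has two neighbours in the first layer, [t+1] and either [t-1] or, for
    [t = 2], the leaf [c]; [two_first] is applied to the one other than [s]. *)
Lemma layer_red c v1 v (s t : nat) v' : ~~ odd n -> c <= 1 -> odd_layer c v1 -> t <= N ->
  s \in v1 -> adj s t -> ceq (v1 ++ v) [:: s, t & v'] -> False.
Proof.
move=> en hc h1 tN sv st e; have [t2|t2] := leqP t 2.
  have Et : t = 2.
    move: sv st; rewrite h1 /adj /adj1; move: hc t2; clear.
    by case: c => [|[|]] //; case: t => [|[|[|]]] //; case: s => [|[|[|[|]]]].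
  subst t; have nt : 2 \notin v1 by rewrite h1 orbF gtn_eqF.
  have [sc|sc] := eqVneq s c.
    apply: (@two_first v1 v 3 2 s v') e => //; last by move: hc; rewrite sc; clear; lia.
    by rewrite h1 /= !ltnS hn orbT.
  have cv : c \in v1 by rewrite h1 eqxx.
  have c2 : adj c 2 by rewrite adjC adj_2.
  by apply: (two_first cv nt c2 _ e); rewrite eq_sym.
have os : odd s && (3 <= s <= N).
  by move: sv st; rewrite h1 => /predU1P[->|//]; rewrite /adj /adj1; move: hc t2; clear; lia.
have et : ~~ odd t.
  case/andP: os => os _; move: st t2 os; rewrite /adj /adj1 => h t2 os.
  have [E|E] : t = s.+1 \/ s = t.+1 by move: h t2; clear; lia.
    by rewrite E /= os.
  by move: os; rewrite E.
have tn : t <= n by move: tN; rewrite leq_eqVlt => /predU1P[E|//]; move: et; rewrite E /= en.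
have nt : t \notin v1 by rewrite h1 (negPf et) orbF gtn_eqF // (leq_ltn_trans hc) // ltnW.
have [E|E] : s = t.+1 \/ s = t.-1 by move: st t2 os; rewrite /adj /adj1; clear; lia.
  apply: (@two_first v1 v t.-1 t s v') e => //.
  - rewrite h1; have -> : odd t.-1 by move: et t2; clear; case: t => //= t; rewrite negbK.
    by apply/orP; right; move: t2 tn et; clear; case: t => [|[|[|[|]]]] //= t _; lia.
  - by rewrite /adj /adj1; move: t2; clear; lia.
  - by rewrite E; move: t2; clear; lia.
apply: (@two_first v1 v t.+1 t s v') e => //.
- by rewrite h1 /= et !ltnS tn (ltnW t2) !orbT.
- by rewrite adjC adj_succ // ltnW.
- by rewrite E; move: t2; clear; lia.
Qed.

End Words.

(** * The inclusions *)

Section Inclusions.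
Variable n : nat.
Hypothesis hn : 2 <= n.
Variable W : coxeterSystem (mB n).
Local Notation T := 'I_n.+2.
Local Notation N := n.+1.
Implicit Types (x : W) (s t : T) (w : seq T) (z : seq nat).
Local Notation M1 := (mB_diag hn).

Lemma CCP x : CC W x <-> exists2 w, commuting w & ev W w = x.
Proof.
split=> [[w [uw pw ->]]|[w /andP[uw pw] <-]]; last by exists w.
by exists w => //; rewrite /commuting uw.
Qed.

Lemma commuting_word_nat w : commuting w = commuting_word (nat_word w).
Proof. exact: commuting_nat_word. Qed.

Lemma CC_reduced x w : CC W x -> reduced w x -> commuting w.
Proof.
move=> /CCP[w0 c0 e0] r; have [sz me] := commuting_reduced hn c0 e0 r.
have /andP[u0 _] := c0; have uw : uniq w by rewrite (eq_uniq sz) // => s; rewrite me.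
rewrite commuting_word_nat; rewrite commuting_word_nat in c0; apply: commuting_word_perm c0.
by apply/perm_map/uniq_perm.
Qed.

Lemma commuting_is_reduced w : commuting w -> reduced w (ev W w).
Proof.
move=> cw; have [w' r] := ex_reduced (ev W w); split=> //.
by have [<- _] := commuting_reduced hn cw erefl r; case: r.
Qed.

Lemma supp_commuting w : commuting w -> supp (ev W w) = [set s | s \in w]%classic.
Proof.
move=> cw; apply/seteqP; split=> s /=.
  by move=> [w' r]; have [_ ->] := commuting_reduced hn cw erefl r.
move=> sw; by exists w => //; apply: commuting_is_reduced.
Qed.

Lemma CC_star x : CC W x -> star_irreducible W x.
Proof.
move=> cx; split=> [w w' r r'|s t].
  have cw := CC_reduced cx r; have cw' := CC_reduced cx r'.
  have pw : perm_eq (nat_word w') (nat_word w).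
    apply: perm_map; apply: uniq_perm; rewrite ?(andP cw).1 ?(andP cw').1 //.
    by have [_] := commuting_reduced hn cw' r'.1 r.
  rewrite -(nat_wordK w) -(nat_wordK w'); apply: (ceq_crst hn); last exact: nat_word_le.
  by apply: (commuting_word_ceq pw); rewrite -commuting_word_nat.
split.
  move=> /(left_starP M1)[]; rewrite (mB_adj hn) => st [w /(CC_reduced cx)].
  by rewrite commuting_word_nat => /commuting_word_nonadj/(_ s t); rewrite st !inE !eqxx ?orbT => /(_ isT isT).
move=> /(right_starP M1)[]; rewrite (mB_adj hn) => st [w /(CC_reduced cx)].
rewrite commuting_word_nat => /commuting_word_nonadj/(_ s t); rewrite st !mem_nat_word -!cats1 !mem_cat !inE !eqxx !orbT.
by move=> /(_ isT isT).
Qed.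

Lemma DL_front x w s : reduced w x -> FC W x ->
  DL x s <-> exists v, ceq (nat_of_ord s :: v) (nat_word w).
Proof.
move=> r fc; split=> [/(DLP M1)[w' r']|[v /ceq_sym e]].
  by exists (nat_word w'); apply: (FC_ceq hn fc r' r).
apply/(DLP M1); exists (ord_word n v).
by have := reduced_ceq_ow hn r e; rewrite /ord_word /= inord_val.
Qed.

Lemma DR_back x w s : reduced w x -> FC W x ->
  DR x s <-> exists v, ceq (rcons v (nat_of_ord s)) (nat_word w).
Proof.
move=> r fc; split=> [/(DRP M1)[w' r']|[v /ceq_sym e]].
  by exists (nat_word w'); have := FC_ceq hn fc r' r; rewrite /nat_word map_rcons.
apply/(DRP M1); exists (ord_word n v).
by have := reduced_ceq_ow hn r e; rewrite /ord_word map_rcons inord_val.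
Qed.

Lemma val_sB k : k <= N -> nat_of_ord (sB n k) = k.
Proof. by move=> h; rewrite /sB inordK. Qed.

Lemma nat_word_wA : nat_word (wA n) = iota 2 n.
Proof. by apply: ord_wordK => a; rewrite mem_iota; lia. Qed.

Lemma nat_word_wB : nat_word (wB n) = rev (iota 0 N).
Proof. by apply: ord_wordK => a; rewrite mem_rev mem_iota; lia. Qed.

Lemma nat_word_cat w w' : nat_word (w ++ w') = nat_word w ++ nat_word w'. Proof. exact: map_cat. Qed.

Lemma nat_word_flatten_nseq k w : nat_word (flatten (nseq k w)) = flatten (nseq k (nat_word w)).
Proof. by rewrite /nat_word map_flatten map_nseq. Qed.

Lemma nat_word_zigzag1 k h : nat_word (zigzag1 n k h) = [:: 0; 1] ++
  flatten (nseq k (iota 2 n ++ rev (iota 0 N))) ++ (if h then iota 2 n else [::]).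
Proof.
rewrite /zigzag1 !nat_word_cat nat_word_flatten_nseq nat_word_cat nat_word_wA nat_word_wB /=.
by rewrite !val_sB //; case: h; rewrite ?nat_word_wA.
Qed.

Lemma nat_word_zigzag2 k h : nat_word (zigzag2 n k h) = [:: N] ++
  flatten (nseq k (rev (iota 0 N) ++ iota 2 n)) ++ (if h then rev (iota 0 N) else [::]).
Proof.
rewrite /zigzag2 !nat_word_cat nat_word_flatten_nseq nat_word_cat nat_word_wA nat_word_wB /=.
by rewrite !val_sB //; case: h; rewrite ?nat_word_wB.
Qed.

(** Since [k + h > 0], each zigzag contains the adjacent labels [n] and [n+1]. *)
Lemma CC_CZ x : CC W x -> CZ W x -> False.
Proof.
move=> cx [_ [k [h [kh r]]]].
have An : n \in iota 2 n by rewrite mem_iota; move: hn; clear; lia.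
have AN : N \in iota 2 n by rewrite mem_iota; move: hn; clear; lia.
have Bn : n \in rev (iota 0 N) by rewrite mem_rev mem_iota; move: hn; clear; lia.
have bad w : reduced w x -> n \in nat_word w -> N \in nat_word w -> False.
  move=> /(CC_reduced cx); rewrite commuting_word_nat => /commuting_word_nonadj cw nw' Nw'.
  by have := cw _ _ nw' Nw'; rewrite adj_succ.
case: r => r; apply: (bad _ r).
- rewrite nat_word_zigzag1; case: k kh {r} => [|k] kh; last by rewrite /= !inE !mem_cat An !orbT.
  by case: h kh => // _; rewrite mem_cat /= An !orbT.
- rewrite nat_word_zigzag1; case: k kh {r} => [|k] kh; last by rewrite /= !inE !mem_cat AN !orbT.
  by case: h kh => // _; rewrite mem_cat /= AN !orbT.
- rewrite nat_word_zigzag2; case: k kh {r} => [|k] kh; last by rewrite /= !inE !mem_cat An !orbT.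
  by case: h kh => // _; rewrite mem_cat /= Bn !orbT.
- by rewrite nat_word_zigzag2 mem_head.
Qed.

Lemma D01 s : ([set sB n 0; sB n 1]%classic s) <-> nat_of_ord s <= 1.
Proof.
split=> [[->|->]|]; rewrite ?val_sB //.
case: s => -[|[|s]] hs //= _; [left|right]; apply: val_inj; by rewrite /= val_sB.
Qed.

Lemma zig_no_left z (s : nat) v : s <= 1 -> ceq ([:: 0, 1 & z]) [:: s, 2 & v] -> False.
Proof.
(* The witness [1 - s] is the other leaf. *)
move=> s1 e; apply: (@two_first [:: 0; 1] z (1 - s) 2 s v) e => //.
- by case: s s1 => [|[|]].
- by case: s s1 => [|[|]].
- by case: s s1 => [|[|]].
Qed.

Lemma adj_2_of s t : s <= 1 -> adj s t -> nat_of_ord t = 2.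
Proof. by rewrite /adj /adj1; clear; lia. Qed.

(** The descent sets select one shape: [zigzag2] begins with [n+1], and [h = true] makes [zigzag1]
    end with [n+1]. In the remaining shape both leaves precede the first 2 and follow the last
    one. *)
Lemma CZdot_star x : CZdot W x -> star_irreducible W x.
Proof.
move=> [[fc [k [h [kh r]]]] [dl dr]]; split=> // s t.
have NN : ~ (N <= 1) by move: hn; clear; lia.
have {}r : reduced (zigzag1 n k h) x.
  case: r => // r; exfalso; apply: NN.
  rewrite -(val_sB (leqnn N)); apply/D01; rewrite -dl; apply/(DL_front _ r fc).
  by rewrite nat_word_zigzag2 val_sB //; eexists; apply: ceq_refl.
have h0 : h = false.
  apply/negP => ht; apply: NN; rewrite -(val_sB (leqnn N)); apply/D01; rewrite -dr.
  apply/(DR_back _ r fc); rewrite nat_word_zigzag1 ht val_sB //.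
  have -> : iota 2 n = rcons (iota 2 n.-1) N.
    have E m : iota 2 m.+1 = rcons (iota 2 m) m.+2 by rewrite -{1}(addn1 m) iotaD cats1.
    by rewrite -{1}(ltn_predK hn) E (ltn_predK hn).
  by rewrite -!rcons_cat; eexists; apply: ceq_refl.
have k0 : 0 < k by move: kh; rewrite h0 addn0.
have Ez : nat_word (zigzag1 n k h) = zigzag_word n k by rewrite nat_word_zigzag1 h0 cats0.
split.
  move=> /(left_starP M1)[]; rewrite (mB_adj hn) => st [w r'].
  have s1 : s <= 1 by apply/D01; rewrite -dl; apply/(DLP M1); exists (t :: w).
  have t2 := adj_2_of s1 st.
  have := FC_ceq hn fc r r'; rewrite Ez /= t2.
  exact: zig_no_left.
move=> /(right_starP M1)[]; rewrite (mB_adj hn) => st [w r'].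
have s1 : s <= 1 by apply/D01; rewrite -dr; apply/(DRP M1); exists (rcons w t).
have t2 := adj_2_of s1 st.
have := FC_ceq hn fc r r'; rewrite Ez /nat_word !map_rcons /= t2 => /ceq_rev.
rewrite !rev_rcons => e; apply: (zig_no_left s1).
exact: ceq_trans (ceq_sym (zigzag_word_rev hn k)) e.
Qed.

Lemma star_CZdot x w k : star_irreducible W x -> reduced w x -> 0 < k ->
  ceq (nat_word w) (zigzag_word n k) -> CZdot W x.
Proof.
move=> [fc _] red_word k0 e.
have [r Er] := reduced_ceq hn red_word e.
have Ez : zigzag1 n k false = ord_word n (zigzag_word n k).
  rewrite /zigzag1 /zigzag_word /ord_word /= cats0 map_flatten map_nseq map_cat.
  by [].
have rv := zigzag_word_rev hn k.
have DLs s : DL x s <-> s <= 1.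
  apply: iff_trans (DL_front _ r fc) _; rewrite Er; split=> [[v]|s1].
    exact: zigzag_word_first.
  rewrite /zigzag_word; case: (nat_of_ord s) s1 => [|[|]] // _; first by eexists; apply: ceq_refl.
  by eexists; apply: ceq_01.
have DRs s : DR x s <-> s <= 1.
  apply: iff_trans (DR_back _ r fc) _; rewrite Er; split=> [[v] /ceq_rev|s1].
    by rewrite rev_rcons => /ceq_trans/(_ rv)/(zigzag_word_first hn k0).
  case: (nat_of_ord s) s1 => [|[|]] // _.
    exists (flatten (nseq k (period n)) ++ [:: 1]); rewrite rcons_cat.
    by apply: ceq_trans rv; rewrite rev_zigzag_word //; apply: ceq_refl.
  exists (flatten (nseq k (period n)) ++ [:: 0]); rewrite rcons_cat.
  exact: zig_zigzag_word.
split; last first.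
  by split; apply/seteqP; split=> s /=; [move/DLs/D01|move/D01/DLs|move/DRs/D01|move/D01/DRs].
split=> //; exists k, false; rewrite addn0; split=> //; left.
by rewrite Ez.
Qed.

End Inclusions.

(** * Candies and words in alternating layers *)

Section Candies.
Variable n : nat.
Hypothesis hn : 2 <= n.
Hypothesis en : ~~ odd n.
Variable W : coxeterSystem (mB n).
Local Notation T := 'I_n.+2.
Local Notation N := n.+1.
Implicit Types (x y : W) (s t : T) (w : seq T) (z : seq nat) (u : seq W).
Local Notation M1 := (mB_diag hn).

Definition red_word y : seq T := projT1 (cid (ex_reduced y)).

Lemma red_wordP y : reduced (red_word y) y.
Proof. exact: projT2 (cid (ex_reduced y)). Qed.

Lemma mem_red_word y s : CC W y -> (s \in red_word y) <-> supp y s.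
Proof.
move=> cy; have cw := CC_reduced hn cy (red_wordP y).
have E : supp y = [set s | s \in red_word y]%classic by rewrite -{1}(red_wordP y).1 supp_commuting.
by rewrite E.
Qed.

Lemma CFNF_reduced x u : CFNF x u -> reduced (flatten (map red_word u)) x.
Proof.
move=> [[_ ->] _ _ sz _]; split; last first.
  rewrite sz; elim: u {sz} => [|y u IH] /=; first by rewrite big_nil.
  by rewrite size_cat big_cons IH (red_wordP y).2.
elim: u {sz} => [|y u IH] /=; first by rewrite /ev !big_nil.
by rewrite ev_cat IH big_cons (red_wordP y).1.
Qed.

Lemma odd_layerP y (c : T) : CC W y -> c <= 1 ->
  supp y = ([set s : T | odd s /\ (3 <= s)%N] `|` [set c])%classic ->
  odd_layer n c (nat_word (red_word y)).
Proof.
move=> cy hc sy a; apply/idP/idP => [/mapP[s /(mem_red_word _ cy)]|].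
  rewrite sy => -[[os s3]|->] ->; rewrite ?eqxx //=.
  by rewrite os s3 -ltnS ltn_ord !orbT.
case: eqP => [-> _|_ /and3P[oa a3 aN]].
  by rewrite (mem_nat_word _ c); apply/(mem_red_word _ cy); rewrite sy; right.
have -> : a = nat_of_ord (inord a : T) by rewrite inordK.
rewrite mem_nat_word; apply/(mem_red_word _ cy); rewrite sy; left => /=.
by rewrite inordK.
Qed.

Lemma even_layerP y : CC W y -> supp y = [set s : T | ~~ odd s /\ (2 <= s)%N]%classic ->
  even_layer n (nat_word (red_word y)).
Proof.
move=> cy sy a; apply/idP/idP => [/mapP[s /(mem_red_word _ cy)]|].
  rewrite sy => -[os s2] ->; rewrite os s2 /=.
  have : s <= N by rewrite -ltnS ltn_ord.
  by rewrite leq_eqVlt => /predU1P[E|//]; move: os; rewrite E /= en.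
move=> /and3P[oa a2 an]; have aN : a < n.+2 by rewrite ltnS leqW.
have -> : a = nat_of_ord (inord a : T) by rewrite inordK.
by rewrite mem_nat_word; apply/(mem_red_word _ cy); rewrite sy /= inordK.
Qed.

(** Extracts the first two and the last two layers, for the two kinds of star reduction, and a
    further [n+1], which separates candies from [CC]. *)
Lemma candy_layers x : candy x -> FC W x /\ exists (u : seq W) c d y1 y2,
  [/\ reduced (flatten (map red_word u)) x, c <= 1 /\ d <= 1,
    exists a b r, [/\ u = [:: a, b & r], odd_layer n c (nat_word (red_word a)), even_layer n (nat_word (red_word b)),
      supp a = DL x & has (fun y => N \in nat_word (red_word y)) r]
  & [/\ odd_layer n d (nat_word (red_word y1)), even_layer n (nat_word (red_word y2)) & exists r, u = r ++ [:: y2; y1]]].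
Proof.
move=> [fc [m [u [c [[cf sz] [m2 em] h1 h2 h3]]]]]; split=> //.
have r := CFNF_reduced cf; have [_ ccu s0 _ _] := cf.
have Em : m = (m./2).*2 by rewrite even_halfK.
have m0 : 0 < m./2 by move: m2 Em; clear; case: (m./2) => //=; case: m.
have cc i : i <= m -> CC W (nth 1%g u i) by move=> h; apply: ccu; rewrite sz ltnS.
have c1 i : i <= m./2 -> c i <= 1.
  by move=> /h1[_ [->|->]]; rewrite val_sB.
have Lo i : i <= m./2 -> odd_layer n (c i) (nat_word (red_word (nth 1%g u i.*2))).
  move=> hi; apply: odd_layerP (c1 i hi) (h1 i hi).1.
  by apply: cc; rewrite Em leq_double.
have Le i : i < m./2 -> even_layer n (nat_word (red_word (nth 1%g u i.*2.+1))).
  move=> hi; apply: even_layerP (h3 i hi); apply: cc.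
  by rewrite Em -[_.*2.+1]/(i.*2.+1) ltn_double.
exists u, (c 0), (c m./2), (nth 1%g u m), (nth 1%g u m.-1); split=> //.
- by split; apply: c1.
- have l0 := Lo 0 (leq0n _); have l1 := Le 0 m0; have l2 := Lo 1 m0.
  case: u {cf ccu h1 h3 cc Lo Le r} sz s0 l0 l1 l2 => [|a [|b [|a' r]]] //=.
  + by move=> [E]; rewrite -E in m2.
  + by move=> [E]; rewrite -E in m2.
  move=> _ s0 l0 l1 l2; exists a, b, (a' :: r); split=> //=.
  by rewrite l2 /= leqnn en !ltnS hn !orbT.
- split; first by have := Lo _ (leqnn _); rewrite -Em.
    have := Le m./2.-1; rewrite ltn_predL => /(_ m0).
    by have <- : m.-1 = (m./2.-1).*2.+1 by rewrite {1}Em; move: m0; clear; lia.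
  exists (take m.-1 u).
  have h : m.-1.+1 = m by rewrite prednK // (leq_trans _ m2).
  rewrite -{1}(cat_take_drop m.-1 u) (drop_nth 1%g) ?sz ?ltnS ?leq_pred // h.
  by rewrite (drop_nth 1%g) ?sz // drop_oversize ?sz.
Qed.

(** This left descent separates candies from [CZdot]. *)
Lemma candy_N x : candy x -> DL x (sB n N).
Proof.
move=> /candy_layers[_ [u [c [d [y1 [y2 [_ [hc _] [a [b [r [_ l0 _ <- _]]]] _]]]]]]].
exists (red_word a); first exact: red_wordP.
by rewrite -mem_nat_word l0 val_sB // leqnn /= en ltnS hn orbT.
Qed.

Lemma candy_CC x : candy x -> CC W x -> False.
Proof.
move=> /candy_layers[_ [u [c [d [y1 [y2 [hr _ [a [b [r [Eu l0 _ _ /hasP[y yr Ny]]]]] _]]]]]]] cx.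
have := CC_reduced hn cx hr; rewrite commuting_word_nat // => /andP[+ _].
rewrite Eu /= !nat_word_cat cat_uniq => /and3P[_ /hasPn/(_ N) h _].
have Na : N \in nat_word (red_word a) by rewrite l0 /= leqnn en ltnS hn orbT.
move: h; rewrite mem_cat /= Na => h.
suff Nr : N \in nat_word (flatten (map red_word r)) by move: h; rewrite Nr orbT => /(_ isT).
rewrite /nat_word map_flatten; apply/flattenP; exists (nat_word (red_word y)) => //.
by rewrite -map_comp; apply/mapP; exists y.
Qed.

Lemma candy_star x : candy x -> star_irreducible W x.
Proof.
move=> /candy_layers[fc [u [c [d [y1 [y2 [hr [hc hd] h1 h2]]]]]]]; split=> // s t.
have le (v : T) : v <= N by rewrite -ltnS ltn_ord.
split.
  move=> /(left_starP M1)[]; rewrite (mB_adj hn) => st [w r'].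
  have e := FC_ceq hn fc hr r'.
  have [a [b [r [Eu l0 l1 _ _]]]] := h1; rewrite Eu /= !nat_word_cat /= in e.
  have sa := layer_first hn en hc l0 l1 (le s) (ceq_sym e).
  exact (layer_red hn en hc l0 (le t) sa st e).
move=> /(right_starP M1)[]; rewrite (mB_adj hn) => st [w r'].
have e := FC_ceq hn fc hr r'.
have [l0 l1 [r Eu]] := h2; move: e; rewrite Eu map_cat flatten_cat /= cats0 !nat_word_cat.
rewrite /nat_word !map_rcons -!/(nat_word _) => /ceq_rev; rewrite !rev_rcons !rev_cat -catA => e.
have l0' : odd_layer n d (rev (nat_word (red_word y1))) by move=> a; rewrite mem_rev; apply: l0.
have l1' : even_layer n (rev (nat_word (red_word y2))) by move=> a; rewrite mem_rev; apply: l1.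
have sa := layer_first hn en hd l0' l1' (le s) (ceq_sym e).
exact (layer_red hn en hd l0' (le t) sa st e).
Qed.

(** Factors of even index carry the odd labels; the leaf advances every second factor, hence
    [i./2]. *)
Definition layer (cs : seq nat) i := if odd i then even_word n else odd_word n (nth 0 cs i./2).

Lemma candy_word_layers c cs :
  candy_word n c cs = flatten (mkseq (layer (c :: cs)) (size cs).*2.+1).
Proof.
elim: cs c => [|d cs IH] c; first by rewrite /candy_word /= cats0.
have -> : candy_word n c (d :: cs) = odd_word n c ++ even_word n ++ candy_word n d cs.
  by rewrite /candy_word /= -catA.
have E f m : mkseq f m.+2 = [:: f 0, f 1 & mkseq (fun i => f i.+2) m].
  by rewrite /mkseq /= -[iota 2 _]/(iota (2 + 0) _) iotaDl -map_comp.
rewrite IH -[size (d :: cs)]/(size cs).+1 doubleS E.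
have -> // : mkseq (fun i => layer [:: c, d & cs] i.+2) (size cs).*2.+1 =
    mkseq (layer (d :: cs)) (size cs).*2.+1.
by apply: eq_mkseq => i; rewrite /layer /= negbK.
Qed.

Lemma layer_commuting cs i : all (fun a => a <= 1) cs -> commuting_word (layer cs i).
Proof.
rewrite /layer => a1; case: odd; first exact: even_word_commuting.
apply: odd_word_commuting => //; have [h|h] := ltnP i./2 (size cs); last by rewrite nth_default.
exact: (all_nthP 0 a1).
Qed.

Lemma layer_le cs i : all (fun a => a <= 1) cs -> {in layer cs i, forall a, a <= N}.
Proof.
rewrite /layer => a1 a; case: odd; first by rewrite mem_even_word // => /and3P[_ _ /leqW].
rewrite inE mem_odds // => /predU1P[->|/and3P[]//].
have [h|h] := ltnP i./2 (size cs); last by rewrite nth_default.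
exact: leq_trans (all_nthP 0 a1 _ h) _.
Qed.

Definition layer_elt cs i : W := ev W (ord_word n (layer cs i)).

Section Layers.
Variable cs : seq nat.
Hypothesis cs1 : all (fun a => a <= 1) cs.

Lemma nat_word_layer i : nat_word (ord_word n (layer cs i)) = layer cs i.
Proof. exact/ord_wordK/layer_le. Qed.

Lemma commuting_layer i : commuting (ord_word n (layer cs i)).
Proof. by rewrite commuting_word_nat // nat_word_layer layer_commuting. Qed.

Lemma layer_elt_CC i : CC W (layer_elt cs i).
Proof. by apply/CCP; exists (ord_word n (layer cs i)) => //; apply: commuting_layer. Qed.

Lemma layer_elt_ell i : ell (layer_elt cs i) = size (layer cs i).
Proof.
have [_ <-] := commuting_is_reduced hn W (commuting_layer i).
by rewrite size_map.
Qed.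

Lemma layer_elt_supp i s : supp (layer_elt cs i) s <-> nat_of_ord s \in layer cs i.
Proof.
by rewrite (supp_commuting hn W (commuting_layer i)) -{2}nat_word_layer mem_nat_word.
Qed.

Lemma layer_succ i a : a \in layer cs i.+1 -> exists2 b, b \in layer cs i & adj b a.
Proof.
rewrite /layer /=; case: (odd i) => /=.
  rewrite inE mem_odds // => /predU1P[->|].
    exists 2; first by rewrite mem_even_word.
    apply: adj_2; have [h|h] := ltnP (uphalf i) (size cs); last by rewrite nth_default.
    exact: (all_nthP 0 cs1).
  case: a => // a /= /and3P[oa a2 an]; exists a; first by rewrite mem_even_word // oa; exact: (introT andP (conj a2 an)).
  exact: adj_succ.
rewrite mem_even_word // => /and3P[oa a2 an]; exists a.+1; last by rewrite adjC adj_succ.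
by rewrite inE mem_odds //= oa !ltnS a2 an orbT.
Qed.

End Layers.

(** The layers of the word evaluate to the factors of the normal form: [layer_first] identifies the
    left descents with the first layer, and [layer_succ] gives each letter a neighbour in the
    preceding layer. *)
Lemma star_candy x w c cs : star_irreducible W x -> reduced w x ->
  ceq (nat_word w) (candy_word n c cs) -> path (fun a b => a != b) c cs ->
  all (fun a => a <= 1) (c :: cs) -> cs != [::] -> candy x.
Proof.
move=> [fc _] r0 e pcs acs cs0; split=> //; set C := c :: cs in acs.
pose m := (size cs).*2.
have [r Er] := reduced_ceq hn r0 e; rewrite candy_word_layers -/C -/m in r Er e.
have hc : c <= 1 by case/andP: acs.
have nthc i : i < size C -> nth 0 C i <= 1 by apply: (all_nthP 0 acs).
have m2 : m./2 = size cs by rewrite doubleK.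
exists m, (mkseq (layer_elt C) m.+1), (fun i => sB n (nth 0 C i)); split.
- split; last by rewrite size_mkseq.
  have Ex : x = (\prod_(y <- mkseq (layer_elt C) m.+1) y)%g.
    rewrite -r.1 /ord_word map_flatten /mkseq -map_comp big_map.
    elim: (iota 0 m.+1) => [|i l IH] /=; first by rewrite /ev !big_nil.
    by rewrite ev_cat IH big_cons.
  split.
  + by rewrite size_mkseq; split.
  + by move=> i; rewrite size_mkseq => hi; rewrite nth_mkseq //; apply: layer_elt_CC.
  + rewrite nth_mkseq //; apply/seteqP; split=> s /=.
      move/(layer_elt_supp acs) => sl; apply/(DL_front hn _ r fc); rewrite Er.
      have := layer_commuting 0 acs => cl; have Es := pre_split sl.
      set p := pre _ _ in Es; set q := post _ _ in Es.
      exists (p ++ q ++ flatten [seq layer C i | i <- iota 1 m]).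
      have -> : flatten (mkseq (layer C) m.+1) =
          layer C 0 ++ flatten [seq layer C i | i <- iota 1 m] by [].
      rewrite Es -catA; apply/ceq_sym/ceq_move.
      apply/hasPn => a ap; rewrite /dep negb_or (commuting_word_nonadj cl sl (pre_sub ap)) andbT.
      by apply/eqP => sa; move: ap; rewrite -sa (negPf (pre_notin _ _)).
    move/(DL_front hn _ r fc) => [v]; rewrite Er => ev'; apply/(layer_elt_supp acs).
    have [k Ek] : exists k, m = k.+1.
      by rewrite /m; case: (cs) cs0 => // d cs' _; rewrite doubleS; eexists.
    have le : s <= N by rewrite -ltnS ltn_ord.
    rewrite Ek /mkseq /= in ev'.
    apply: (@layer_first n hn c (layer C 0) (layer C 1) _ s v en hc _ _ le ev').
      by move=> a; rewrite /layer inE mem_odds.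
    by move=> a; rewrite /layer mem_even_word.
  + rewrite -(proj2 r) /ord_word size_map /mkseq big_map size_flatten /shape sumnE !big_map.
    by apply: eq_bigr => i _; rewrite layer_elt_ell.
  + move=> j t; rewrite size_mkseq => hj; rewrite !nth_mkseq ?(ltnW hj) //.
    move/(layer_elt_supp acs)/(layer_succ acs) => [b bl bt].
    have bN := layer_le acs bl.
    exists (sB n b); last by rewrite (mB_adj hn) val_sB.
    by apply/(layer_elt_supp acs); rewrite val_sB.
- by rewrite odd_double; split=> //; rewrite /m; case: (cs) cs0 => // d cs' _; rewrite doubleS.
- move=> i; rewrite m2 => hi; have hi' : nth 0 C i <= 1 by apply: nthc; rewrite ltnS.
  rewrite nth_mkseq ?ltnS ?leq_double //; split.
    apply/seteqP; split=> s.
      move/(layer_elt_supp acs); rewrite /layer odd_double doubleK inE mem_odds // => /predU1P[E|].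
        by right; apply: val_inj; rewrite /= val_sB // (leq_trans hi').
      by move=> /and3P[os s3 _]; left.
    move=> h; apply/(layer_elt_supp acs); rewrite /layer odd_double doubleK inE mem_odds //.
    case: h => [[os s3]|->]; last by rewrite val_sB ?eqxx // (leq_trans hi').
    by rewrite os s3 -ltnS ltn_ord orbT.
  by case: (nth 0 C i) hi' => [|[|]] // _; [left|right].
- move=> i; rewrite m2 => hi E; have /(pathP 0)/(_ i hi)/eqP := pcs; apply.
  have h1 : nth 0 C i <= 1 by apply: nthc; rewrite ltnS ltnW.
  have h2 : nth 0 C i.+1 <= 1 by apply: nthc; rewrite ltnS.
  have := congr1 val E; rewrite /= !val_sB //; [exact: leq_trans h2 _|exact: leq_trans h1 _].
- move=> i; rewrite m2 => hi; rewrite nth_mkseq; last by rewrite ltnS /m ltn_double.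
  apply/seteqP; split=> s.
    by move/(layer_elt_supp acs); rewrite /layer /= odd_double mem_even_word // => /and3P[].
  move=> [os s2]; apply/(layer_elt_supp acs); rewrite /layer /= odd_double mem_even_word // os s2 /=.
  have : s <= N by rewrite -ltnS ltn_ord.
  by rewrite leq_eqVlt => /predU1P[E|//]; move: os; rewrite E /= en.
Qed.

End Candies.

Local Open Scope classical_set_scope.

Theorem theorem3p9 (n : nat) (hn : (2 <= n)%N) (W : coxeterSystem (mB n)) :
  [/\ star_irreducible W = CC W `|` candies W `|` CZdot W,
      CC W `&` candies W = set0,
      CC W `&` CZdot W = set0,
      candies W `&` CZdot W = set0
    & odd n -> candies W = set0].
Proof.
split.
- apply/seteqP; split=> x.
    move=> sx; have [w r] := ex_reduced x.
    case: (irr_cases hn (star_irr hn sx r)) => [cw|[k k0 e]|[en [c [cs [e pcs acs cs0]]]]].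
    + left; left; rewrite -r.1; apply/CCP; exists w => //.
      by rewrite commuting_word_nat.
    + by right; apply: (star_CZdot hn sx r k0 e).
    + left; right; rewrite /candies (negPf en).
      exact: (star_candy hn en sx r e pcs acs cs0).
  move=> [[cx|]|zx]; [exact: CC_star| |exact: CZdot_star].
  rewrite /candies; case: ifP => [_ []|/negbT en]; exact: candy_star.
- apply/seteqP; split=> x // -[cx]; rewrite /candies; case: ifP => [_ []//|/negbT en kx].
  by case: (candy_CC hn en kx cx).
- by apply/seteqP; split=> x // -[cx [zx _]]; case: (CC_CZ hn cx zx).
- apply/seteqP; split=> x // -[]; rewrite /candies; case: ifP => [_ []//|/negbT en kx].
  move=> [_ [dl _]]; have := candy_N hn en kx; rewrite dl => /D01.
  by rewrite val_sB // => h; move: hn h; clear; lia.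
- by rewrite /candies => ->.
Qed.
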